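(* For every positive integer $k$, every simple topological graph on $n\ge 2$ vertices that contains no $(k,1)$-crossing family has at most $n(\log n)^{O(\log k)}$ edges (the constant in the $O(\cdot)$ being absolute).
   Context: A topological graph is a graph drawn in the plane with vertices as points and edges as non-self-intersecting arcs joining their endpoints, not passing through other vertices, with no tangencies (if two edges share an interior point they cross properly there); no parallel edges or loops. It is simple if every pair of edges has at most one point in common. Two edges cross if their interiors share a point; they are disjoint if they share no point (including endpoints). A $(k,1)$-crossing family consists of $k$ pairwise crossing edges together with one further edge that is disjoint from each of these $k$ edges. *)

(* Defs.v *)
From Stdlib Require Import Reals List.
Open Scope R_scope.

Definition point := (R * R)%type.

(* sup-distance on the plane (induces the usual topology) *)
Definition pdist (p q : point) : R :=
  Rmax (Rabs (fst p - fst q)) (Rabs (snd p - snd q)).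

Definition curve_continuous (g : R -> point) : Prop :=
  forall s, 0 <= s <= 1 -> forall eps, 0 < eps ->
    exists del, 0 < del /\
      forall s', 0 <= s' <= 1 -> Rabs (s' - s) < del -> pdist (g s') (g s) < eps.

Definition plane_continuous (h : point -> point) : Prop :=
  forall p eps, 0 < eps ->
    exists del, 0 < del /\ forall q, pdist q p < del -> pdist (h q) (h p) < eps.

Definition plane_homeo (h hi : point -> point) : Prop :=
  plane_continuous h /\ plane_continuous hi /\
  (forall p, hi (h p) = p) /\ (forall p, h (hi p) = p).

(* Proper crossing (no tangency) of the arcs g1, g2 at the common point
   g1 s = g2 t: after a homeomorphism of the plane sending the common point
   to the origin, near the crossing g1 runs along the horizontal axis from
   left to right and g2 runs along the vertical axis from bottom to top. *)
Definition proper_crossing (g1 g2 : R -> point) (s t : R) : Prop :=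
  exists h hi, plane_homeo h hi /\ h (g1 s) = (0, 0) /\
  exists eta, 0 < eta /\
    (forall s', Rabs (s' - s) < eta ->
       snd (h (g1 s')) = 0 /\
       (s' < s -> fst (h (g1 s')) < 0) /\ (s < s' -> 0 < fst (h (g1 s')))) /\
    (forall t', Rabs (t' - t) < eta ->
       fst (h (g2 t')) = 0 /\
       (t' < t -> snd (h (g2 t')) < 0) /\ (t < t' -> 0 < snd (h (g2 t')))).

(* A drawn graph on the vertex set {0,...,n-1}: vertex positions [vtx],
   edge list [E] of pairs (i,j) with i < j < n (so no loops; NoDup forbids
   parallel edges), and for each edge e the arc [cur e] parametrised on [0,1]. *)
Definition simple_topological_graph (n : nat) (vtx : nat -> point)
    (E : list (nat * nat)) (cur : nat * nat -> R -> point) : Prop :=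
  (forall i j, (i < n)%nat -> (j < n)%nat -> vtx i = vtx j -> i = j) /\
  NoDup E /\
  (forall e, In e E ->
     (fst e < snd e)%nat /\ (snd e < n)%nat /\
     curve_continuous (cur e) /\
     (forall s s', 0 <= s <= 1 -> 0 <= s' <= 1 -> cur e s = cur e s' -> s = s') /\
     cur e 0 = vtx (fst e) /\ cur e 1 = vtx (snd e) /\
     (forall s k, 0 < s < 1 -> (k < n)%nat -> cur e s <> vtx k)) /\
  (forall e f, In e E -> In f E -> e <> f ->
     forall s1 t1 s2 t2, 0 <= s1 <= 1 -> 0 <= t1 <= 1 -> 0 <= s2 <= 1 -> 0 <= t2 <= 1 ->
       cur e s1 = cur f t1 -> cur e s2 = cur f t2 -> cur e s1 = cur e s2) /\
  (forall e f, In e E -> In f E -> e <> f ->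
     forall s t, 0 < s < 1 -> 0 < t < 1 -> cur e s = cur f t ->
       proper_crossing (cur e) (cur f) s t).

Definition edges_cross (cur : nat * nat -> R -> point) (e f : nat * nat) : Prop :=
  exists s t, 0 < s < 1 /\ 0 < t < 1 /\ cur e s = cur f t.

Definition edges_disjoint (cur : nat * nat -> R -> point) (e f : nat * nat) : Prop :=
  forall s t, 0 <= s <= 1 -> 0 <= t <= 1 -> cur e s <> cur f t.

Definition has_k1_crossing_family (k : nat) (E : list (nat * nat))
    (cur : nat * nat -> R -> point) : Prop :=
  exists (F : list (nat * nat)) (g : nat * nat),
    length F = k /\ NoDup F /\ (forall e, In e F -> In e E) /\
    (forall e f, In e F -> In f F -> e <> f -> edges_cross cur e f) /\
    In g E /\ (forall e, In e F -> edges_disjoint cur e g).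

Definition log2 (x : R) : R := ln x / ln 2.

(* Main.v *)
Require Import Defs.
From Stdlib Require Import Reals List Lra Lia Psatz ZArith Bool Ring Classical ClassicalEpsilon.
From Coquelicot Require Import Coquelicot.
From HB Require structures.
From mathcomp Require all_boot all_order all_algebra zify ring lra.
Open Scope R_scope.

(** Two edges of a simple topological graph that share no vertex cross at most once, and whether
    they do is governed by parities of intersection numbers.

    (1) For an edge e and a vertex v off e, the angle swept by e around v is, up to full turns,
    determined by the endpoints of e.  Hence the crossing parity of vertex-disjoint edges is a
    coboundary plus a term that depends only on an ordering of the vertices, and the parities over
    the 18 independent pairs of edges of any K_{3,3}, drawn with paths of the graph as edges, sum
    to 1.  The same holds for the complementary relation "disjoint" if the graph is bipartite.

    (2) Call a relation on edges a conflict if it must hold for some pair of edges on two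
    independent paths of every such K_{3,3}, unless these paths share a vertex.  If a graph with
    more than n (log n)^B edges is minimal with this property, then it has conductance at least
    1/O(log n), so lazy random walks of length O(log^3 n) mix.  Joining random vertices by random
    bridges, whose steps are almost uniform edges, and using the union bound shows that at least
    a 1/(log n)^{O(1)} fraction of all pairs of edges are in conflict.

    (3) If a 1/q fraction of the pairs of m edges cross, then there are sets A and B of
    m / q^{O(1)} edges with every edge of A crossing every edge of B.  Indeed, choose edges
    w1, w2 that cross many edges e before and after their crossing with f, and w3, w4 likewise
    for f.  After separating the positions of the e and of the f along these four edges, two
    closed curves e w2 e' w1 and f w4 f' w3 only cross where e, e' meet f, f'; as closed curves
    cross evenly, the crossing matrix between the e and the f is a sum u(e) + v(f) mod 2.

    (4) By (2) with "cross" as conflict and by (3), a graph with too many edges and no k pairwise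
    crossing edges contains a large set of edges with no k/2 pairwise crossing ones; iterating
    log k times bounds its size by n (log n)^{O(log k)}.  If there is no (k,1)-crossing family,
    this applies to the set of edges disjoint from any given edge, so that few pairs of edges are
    disjoint, and (2) with "disjoint" as conflict on a bipartite subgraph finishes the proof. *)

(** * Angle lifts and homotopy invariance *)

(** Angle lifts stand in for the Jordan curve theorem and for general position: every global fact
    comes from one statement, that a field without zeros on a rectangle has turning number 0 along
    the boundary. A homeomorphism enters only through the local model of a crossing. It may reverse
    orientation, so a crossing counts 1 or -1 and only parities are kept. Both conflict relations
    obey one formula: a pair of edges uv, u'v' that share no vertex and are not in conflict has
    crossing parity (c(u) + c(v)) (c(u') + c(v')) for a colouring c of the vertices, constant for
    the relation of crossing and the bipartition for that of being disjoint. Over K_{3,3} such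
    products sum to 0 mod 2. Many edges may pass through one point of a simple drawing. A large
    bundle of this kind is itself a clique and yields two sides directly; if there is none, ties in
    the order along an edge are rare and enough separating edges exist. Logarithms are shifted so as
    to be at least 2; every absolute constant is then bounded by a power of them, whence exponents
    such as 36, 38 and 566. *)

Lemma real_induction (P : R -> Prop) (a b : R) :
  a <= b -> P a ->
  (forall x, a <= x <= b -> exists d, 0 < d /\
     forall y z, a <= y -> x - d < y -> y <= x -> y <= z -> z < x + d -> z <= b -> P y -> P z) ->
  P b.
Proof.
  intros Hab Pa Hloc.
  (* At the supremum s of the points satisfying P, the local step starts at such a point just left
     of s and passes beyond s, which is absurd unless b is reached. P need not be monotone. *)
  destruct (completeness (fun y => a <= y <= b /\ P y)) as [s [Hub Hlub]].
  - exists b; intros y [[_ Hy] _]; exact Hy.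
  - exists a; split; [lra | exact Pa].
  - assert (Hs : a <= s <= b).
    { split; [apply Hub; split; [lra | exact Pa] | apply Hlub; intros y [[_ Hy] _]; exact Hy]. }
    destruct (Hloc s Hs) as [d [Hd Hstep]].
    destruct (classic (exists y, (a <= y <= b /\ P y) /\ s - d < y)) as [[y [[Hy Py] Hyd]] | Hno].
    + assert (Hys : y <= s) by (apply Hub; split; assumption).
      destruct (Rlt_dec b (s + d)) as [Hb | Hb].
      * apply (Hstep y b); try lra; exact Py.
      * exfalso.
        assert (Pz : P (s + d / 2)) by (apply (Hstep y (s + d / 2)); try lra; exact Py).
        assert (s + d / 2 <= s) by (apply Hub; split; [lra | exact Pz]).
        lra.
    + exfalso.
      assert (s <= s - d); [| lra].
      apply Hlub; intros y Hy.
      apply Rnot_lt_le; intro Hlt; apply Hno; exists y; split; assumption.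
Qed.

Lemma cont_plus {U : UniformSpace} (f g : U -> R) (x : U) :
  continuous f x -> continuous g x -> continuous (fun y => f y + g y) x.
Proof. exact (continuous_plus f g x). Qed.

Lemma cont_minus {U : UniformSpace} (f g : U -> R) (x : U) :
  continuous f x -> continuous g x -> continuous (fun y => f y - g y) x.
Proof. exact (continuous_minus f g x). Qed.

Lemma cont_mult {U : UniformSpace} (f g : U -> R) (x : U) :
  continuous f x -> continuous g x -> continuous (fun y => f y * g y) x.
Proof. exact (continuous_mult f g x). Qed.

Lemma cont_div {U : UniformSpace} (f g : U -> R) (x : U) :
  continuous f x -> continuous g x -> g x <> 0 -> continuous (fun y => f y / g y) x.
Proof.
  intros Hf Hg Hn; apply cont_mult; [exact Hf |].
  apply (continuous_comp g Rinv); [exact Hg | apply continuous_Rinv; exact Hn].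
Qed.

Lemma cont_fst {U : UniformSpace} (f : U -> R * R) (x : U) :
  continuous f x -> continuous (fun y => fst (f y)) x.
Proof.
  intros Hf; apply (continuous_comp f fst); [exact Hf |].
  destruct (f x) as [p q]; apply continuous_fst.
Qed.

Lemma cont_snd {U : UniformSpace} (f : U -> R * R) (x : U) :
  continuous f x -> continuous (fun y => snd (f y)) x.
Proof.
  intros Hf; apply (continuous_comp f snd); [exact Hf |].
  destruct (f x) as [p q]; apply continuous_snd.
Qed.

Lemma cont_pair {U V W : UniformSpace} (f : U -> V) (g : U -> W) (x : U) :
  continuous f x -> continuous g x -> continuous (fun y => (f y, g y)) x.
Proof.
  intros Hf Hg; apply (continuous_comp_2 f g (fun p q => (p, q))); [exact Hf | exact Hg |].
  apply (continuous_ext (fun z => z)); [intros [p q]; reflexivity | apply continuous_id].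
Qed.

(** Clamping to [a, b]. Composing with it turns data on an interval into functions continuous on all
    of R, so that continuity can always be stated globally. *)
Definition cut (a b t : R) : R := Rmax a (Rmin b t).

Lemma cut_in (a b t : R) : a <= b -> a <= cut a b t <= b.
Proof. intros; unfold cut; split; [apply Rmax_l | apply Rmax_lub; [lra | apply Rmin_l]]. Qed.

Lemma cut_id (a b t : R) : a <= t <= b -> cut a b t = t.
Proof. intros; unfold cut; rewrite Rmin_right by lra; apply Rmax_right; lra. Qed.

Lemma cut_below (a b t : R) : a <= b -> t <= a -> cut a b t = a.
Proof. intros; unfold cut; rewrite Rmin_right by lra; apply Rmax_left; lra. Qed.

Lemma cut_above (a b t : R) : a <= b -> b <= t -> cut a b t = b.
Proof. intros; unfold cut; rewrite Rmin_left by lra; apply Rmax_right; lra. Qed.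

Lemma cont_cut (a b t : R) : continuous (cut a b) t.
Proof.
  apply filterlim_locally; intros eps; exists eps; intros s Hs.
  change (Rabs (s - t) < eps) in Hs; change (Rabs (cut a b s - cut a b t) < eps).
  apply Rle_lt_trans with (2 := Hs); unfold cut, Rmax, Rmin.
  repeat destruct (Rle_dec _ _); unfold Rabs; repeat destruct (Rcase_abs _); lra.
Qed.

Definition dir (p : R * R) (th : R) : Prop :=
  exists r, 0 < r /\ fst p = r * cos th /\ snd p = r * sin th.

Definition dot (p q : R * R) : R := fst p * fst q + snd p * snd q.
Definition cross (p q : R * R) : R := fst p * snd q - snd p * fst q.
Definition vsub (p q : R * R) : R * R := (fst p - fst q, snd p - snd q).

Lemma dot_self_pos (p : R * R) : p <> (0, 0) -> 0 < dot p p.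
Proof.
  destruct p as [x y]; intros H; unfold dot; simpl.
  destruct (Req_dec x 0) as [-> | Hx]; [destruct (Req_dec y 0) as [-> | Hy] |].
  - exfalso; apply H; reflexivity.
  - nra.
  - nra.
Qed.

(** As complex numbers, q / p has real part dot p q and imaginary part cross p q up to the factor 1
    / |p|^2; as the real part is positive, the arctangent is the angle from p to q. *)
Lemma dir_turn (p q : R * R) (th : R) :
  dir p th -> 0 < dot p q -> dir q (th + atan (cross p q / dot p q)).
Proof.
  intros [r [Hr [H1 H2]]] Hd.
  set (c := cross p q) in *; set (d := dot p q) in *.
  assert (Hcos : 0 < cos (atan (c / d))).
  { destruct (atan_bound (c / d)); apply cos_gt_0; lra. }
  assert (Hsin : sin (atan (c / d)) = cos (atan (c / d)) * (c / d)).
  { rewrite sin_atan, cos_atan; unfold Rdiv; ring. }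
  assert (Hrr : r * r = dot p p).
  { unfold dot; rewrite H1, H2.
    assert (Hsc := sin2_cos2 th); unfold Rsqr in Hsc; nra. }
  assert (E1 : fst p * d - snd p * c = r * r * fst q).
  { rewrite Hrr; unfold c, d, dot, cross; ring. }
  assert (E2 : snd p * d + fst p * c = r * r * snd q).
  { rewrite Hrr; unfold c, d, dot, cross; ring. }
  exists (d / (r * cos (atan (c / d)))); repeat split.
  - apply Rdiv_lt_0_compat; [lra | apply Rmult_lt_0_compat; lra].
  - rewrite cos_plus, Hsin.
    apply Rmult_eq_reg_l with (r * r); [| nra].
    rewrite <- E1, H1, H2; field; lra.
  - rewrite sin_plus, Hsin.
    apply Rmult_eq_reg_l with (r * r); [| nra].
    rewrite <- E2, H1, H2; field; lra.
Qed.

(** One of the four axis directions makes an acute angle with p, and [dir_turn] starts from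
    there. *)
Lemma dir_exists (p : R * R) : p <> (0, 0) -> exists th, dir p th.
Proof.
  intros Hp.
  assert (D0 : dir (1, 0) 0) by (exists 1; simpl; rewrite cos_0, sin_0; lra).
  assert (D1 : dir (0, 1) (PI / 2)) by (exists 1; simpl; rewrite cos_PI2, sin_PI2; lra).
  assert (D2 : dir (0, -1) (- (PI / 2))).
  { exists 1; simpl; rewrite cos_neg, sin_neg, cos_PI2, sin_PI2; lra. }
  assert (D3 : dir (-1, 0) PI) by (exists 1; simpl; rewrite cos_PI, sin_PI; lra).
  destruct p as [x y].
  destruct (Rtotal_order x 0) as [Hx | [Hx | Hx]].
  - eexists; apply (dir_turn _ _ _ D3); unfold dot; simpl; lra.
  - destruct (Rtotal_order y 0) as [Hy | [Hy | Hy]].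
    + eexists; apply (dir_turn _ _ _ D2); unfold dot; simpl; lra.
    + exfalso; apply Hp; subst; reflexivity.
    + eexists; apply (dir_turn _ _ _ D1); unfold dot; simpl; lra.
  - eexists; apply (dir_turn _ _ _ D0); unfold dot; simpl; lra.
Qed.

Lemma dir_unique (p : R * R) (t1 t2 : R) :
  dir p t1 -> dir p t2 -> exists k : Z, t2 - t1 = 2 * IZR k * PI.
Proof.
  intros [r [Hr [H1 H2]]] [r' [Hr' [H1' H2']]].
  assert (S1 := sin2_cos2 t1); assert (S2 := sin2_cos2 t2); unfold Rsqr in *.
  assert (Err : r * r = r' * r').
  { transitivity (fst p * fst p + snd p * snd p); [rewrite H1, H2 | rewrite H1', H2']; nra. }
  assert (Er : r = r') by nra.
  subst r'; rewrite H1 in H1'; rewrite H2 in H2'.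
  apply Rmult_eq_reg_l in H1'; [| lra]; apply Rmult_eq_reg_l in H2'; [| lra].
  assert (Hc : cos (t2 - t1) = 1) by (rewrite cos_minus, <- H1', <- H2'; lra).
  assert (Hs : sin ((t2 - t1) / 2) = 0).
  { assert (Hh := cos_2a_sin ((t2 - t1) / 2)).
    replace (2 * ((t2 - t1) / 2)) with (t2 - t1) in Hh by field.
    rewrite Hc in Hh; nra. }
  destruct (sin_eq_0_0 _ Hs) as [k Hk]; exists k; lra.
Qed.

Lemma dir_cross (p q : R * R) (t1 t2 : R) :
  dir p t1 -> dir q t2 -> exists r, 0 < r /\ cross p q = r * sin (t2 - t1).
Proof.
  intros [r [Hr [H1 H2]]] [r' [Hr' [H1' H2']]]; exists (r * r'); split.
  - apply Rmult_lt_0_compat; assumption.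
  - unfold cross; rewrite H1, H2, H1', H2', sin_minus; ring.
Qed.

Lemma dir_opp (p : R * R) (th : R) : dir p th -> dir (- fst p, - snd p) (th + PI).
Proof.
  intros [r [Hr [H1 H2]]]; exists r; simpl; rewrite neg_cos, neg_sin; repeat split; nra.
Qed.

Definition is_lift (u : R -> R * R) (a b : R) (th : R -> R) : Prop :=
  (forall t, continuous th t) /\ forall t, a <= t <= b -> dir (u t) (th t).

Lemma multiple_2PI_const (F : R -> R) (a b : R) :
  a <= b -> (forall t, continuous F t) ->
  (forall t, a <= t <= b -> exists k : Z, F t = 2 * IZR k * PI) -> F b = F a.
Proof.
  intros Hab HF Hk.
  apply (real_induction (fun t => F t = F a) a b Hab eq_refl).
  intros x Hx.
  destruct (proj1 (filterlim_locally _ _) (HF x) (mkposreal PI PI_RGT_0)) as [d Hd].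
  exists d; split; [apply cond_pos |].
  intros y z Hay Hxy Hyx Hyz Hzx Hzb Fy; rewrite <- Fy.
  assert (By : Rabs (F y - F x) < PI).
  { apply (Hd y); change (Rabs (y - x) < d); apply Rabs_def1; lra. }
  assert (Bz : Rabs (F z - F x) < PI).
  { apply (Hd z); change (Rabs (z - x) < d); apply Rabs_def1; lra. }
  destruct (Hk y) as [k Ek]; [lra |]; destruct (Hk z) as [l El]; [lra |].
  apply Rabs_def2 in By; apply Rabs_def2 in Bz.
  assert (HP := PI_RGT_0).
  assert (IZR l - IZR k < 1) by nra; assert (IZR k - IZR l < 1) by nra.
  rewrite <- minus_IZR in *.
  assert (l - k < 1)%Z by (apply lt_IZR; assumption).
  assert (k - l < 1)%Z by (apply lt_IZR; assumption).
  assert (k = l) by lia; subst; lra.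
Qed.

Lemma lift_unique (u : R -> R * R) (a b : R) (t1 t2 : R -> R) :
  a <= b -> is_lift u a b t1 -> is_lift u a b t2 -> t1 b - t1 a = t2 b - t2 a.
Proof.
  intros Hab [C1 L1] [C2 L2].
  assert (H : t2 b - t1 b = t2 a - t1 a); [| lra].
  apply (multiple_2PI_const (fun t => t2 t - t1 t) a b Hab).
  - intros t; apply cont_minus; auto.
  - intros t Ht; apply dir_unique with (u t); auto.
Qed.

Lemma cont_dot {U : UniformSpace} (f g : U -> R * R) (x : U) :
  continuous f x -> continuous g x -> continuous (fun y => dot (f y) (g y)) x.
Proof. intros; apply cont_plus; apply cont_mult; auto using cont_fst, cont_snd. Qed.

Lemma cont_cross {U : UniformSpace} (f g : U -> R * R) (x : U) :
  continuous f x -> continuous g x -> continuous (fun y => cross (f y) (g y)) x.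
Proof. intros; apply cont_minus; apply cont_mult; auto using cont_fst, cont_snd. Qed.

Lemma cont_vsub {U : UniformSpace} (f g : U -> R * R) (x : U) :
  continuous f x -> continuous g x -> continuous (fun y => vsub (f y) (g y)) x.
Proof.
  intros; apply cont_pair; apply cont_minus; auto using cont_fst, cont_snd.
Qed.

Definition turn (p q : R * R) : R := atan (cross p q / dot p q).

Lemma turn_self (p : R * R) : turn p p = 0.
Proof.
  unfold turn; replace (cross p p) with 0 by (unfold cross; ring).
  unfold Rdiv; rewrite Rmult_0_l; apply atan_0.
Qed.

Lemma lift_turn (u v : R -> R * R) (a b : R) (th : R -> R) :
  a <= b -> (forall t, continuous u t) -> (forall t, continuous v t) ->
  (forall t, a <= t <= b -> 0 < dot (u t) (v t)) -> is_lift u a b th ->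
  is_lift v a b (fun t => th t + turn (u (cut a b t)) (v (cut a b t))).
Proof.
  intros Hab Cu Cv Hd [Cth L]; split.
  - intros t; apply cont_plus; [apply Cth |].
    apply (continuous_comp _ atan); [| apply continuous_atan].
    apply cont_div.
    + apply cont_cross; apply (continuous_comp (cut a b)); auto using cont_cut.
    + apply cont_dot; apply (continuous_comp (cut a b)); auto using cont_cut.
    + apply Rgt_not_eq, Hd, cut_in, Hab.
  - intros t Ht; rewrite cut_id by assumption; apply dir_turn; auto.
Qed.

Lemma cont_pos {U : UniformSpace} (f : U -> R) (x : U) :
  continuous f x -> 0 < f x -> locally x (fun y => 0 < f y).
Proof.
  intros Hf Hx.
  generalize (proj1 (filterlim_locally _ _) Hf (mkposreal _ Hx)); apply filter_imp.
  intros y Hy; change (Rabs (f y - f x) < f x) in Hy; apply Rabs_def2 in Hy; lra.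
Qed.

(** Near a parameter x all values of u are pairwise within a right angle, so a lift up to y < x
    extends past x by the angle from u y to u t. *)
Lemma lift_exists (u : R -> R * R) (a b : R) :
  a <= b -> (forall t, continuous u t) -> (forall t, a <= t <= b -> u t <> (0, 0)) ->
  exists th, is_lift u a b th.
Proof.
  intros Hab Cu Hu.
  apply (real_induction (fun z => exists th, is_lift u a z th) a b Hab).
  - destruct (dir_exists (u a)) as [t0 Ht0]; [apply Hu; lra |].
    exists (fun _ => t0); split; [intros; apply continuous_const |].
    intros t Ht; replace t with a by lra; exact Ht0.
  - intros x Hx.
    assert (C2 : continuous (fun z : R * R => dot (u (fst z)) (u (snd z))) (x, x)).
    { apply cont_dot.
      - apply (continuous_comp fst u); [apply continuous_fst | apply Cu].
      - apply (continuous_comp snd u); [apply continuous_snd | apply Cu]. }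
    destruct (cont_pos _ _ C2) as [d Hd]; [simpl; apply dot_self_pos, Hu, Hx |].
    exists d; split; [apply cond_pos |].
    intros y z Hay Hxy Hyx Hyz Hzx Hzb [th [Cth L]].
    assert (Hpos : forall t, y <= t <= z -> 0 < dot (u y) (u t)).
    { intros t Ht; apply (Hd (y, t)); split; simpl;
        [change (Rabs (y - x) < d) | change (Rabs (t - x) < d)]; apply Rabs_def1; lra. }
    exists (fun t => th (cut a y t) + turn (u y) (u (cut y z t))); split.
    + intros t; apply cont_plus.
      * apply (continuous_comp (cut a y) th); [apply cont_cut | apply Cth].
      * apply (continuous_comp _ atan); [| apply continuous_atan].
        apply cont_div.
        -- apply cont_cross; [apply continuous_const |].
           apply (continuous_comp (cut y z)); auto using cont_cut.
        -- apply cont_dot; [apply continuous_const |].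
           apply (continuous_comp (cut y z)); auto using cont_cut.
        -- apply Rgt_not_eq, Hpos, cut_in, Hyz.
    + intros t Ht; destruct (Rle_dec t y) as [Hty | Hty].
      * rewrite cut_id by lra; rewrite (cut_below y z) by lra.
        rewrite turn_self, Rplus_0_r; apply L; lra.
      * rewrite (cut_above a y) by lra; rewrite cut_id by lra.
        apply dir_turn; [apply L; lra | apply Hpos; lra].
Qed.

(** By [lift_unique] the chosen value does not depend on the lift; it is meaningful only if u has no
    zero on [a, b]. *)
Definition angle_change (u : R -> R * R) (a b : R) : R :=
  epsilon (inhabits 0) (fun d => exists th, is_lift u a b th /\ d = th b - th a).

Lemma angle_change_lift (u : R -> R * R) (a b : R) (th : R -> R) :
  a <= b -> is_lift u a b th -> angle_change u a b = th b - th a.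
Proof.
  intros Hab Hth; unfold angle_change.
  destruct (epsilon_spec (inhabits 0) (fun d => exists th, is_lift u a b th /\ d = th b - th a))
    as [th' [H1 H2]]; [exists (th b - th a), th; auto |].
  rewrite H2; apply lift_unique with u; assumption.
Qed.

Definition nonvanishing (u : R -> R * R) (a b : R) : Prop :=
  (forall t, continuous u t) /\ forall t, a <= t <= b -> u t <> (0, 0).

Lemma nonvanishing_sub (u : R -> R * R) (a b a' b' : R) :
  a <= a' -> b' <= b -> nonvanishing u a b -> nonvanishing u a' b'.
Proof. intros H1 H2 [C H]; split; [exact C | intros; apply H; lra]. Qed.

Lemma angle_change_add (u : R -> R * R) (a m b : R) :
  a <= m <= b -> nonvanishing u a b -> angle_change u a b = angle_change u a m + angle_change u m b.
Proof.
  intros Hm [Cu Hu]; destruct (lift_exists u a b) as [th [C L]]; [lra | auto | auto |].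
  rewrite (angle_change_lift u a b th), (angle_change_lift u a m th), (angle_change_lift u m b th);
    try lra; split; auto; intros; apply L; lra.
Qed.

Lemma angle_change_ext (u v : R -> R * R) (a b : R) :
  a <= b -> nonvanishing u a b -> (forall t, a <= t <= b -> u t = v t) -> angle_change u a b = angle_change v a b.
Proof.
  intros Hab [Cu Hu] E; destruct (lift_exists u a b) as [th [C L]]; [lra | auto | auto |].
  rewrite (angle_change_lift u a b th), (angle_change_lift v a b th); try lra; split; auto.
  intros t Ht; rewrite <- E; auto.
Qed.

Lemma angle_change_comp (u : R -> R * R) (phi : R -> R) (a b a' b' : R) (th : R -> R) :
  a <= b -> (forall t, continuous phi t) -> (forall t, a <= t <= b -> a' <= phi t <= b') ->
  is_lift u a' b' th -> angle_change (fun t => u (phi t)) a b = th (phi b) - th (phi a).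
Proof.
  intros Hab Cphi Hphi [C L].
  apply (angle_change_lift (fun t => u (phi t)) a b (fun t => th (phi t)) Hab); split.
  - intros t; apply (continuous_comp phi th); auto.
  - intros t Ht; auto.
Qed.

Lemma angle_change_dir (u : R -> R * R) (a b t1 t2 : R) :
  a <= b -> nonvanishing u a b -> dir (u a) t1 -> dir (u b) t2 ->
  exists k : Z, angle_change u a b = t2 - t1 + 2 * IZR k * PI.
Proof.
  intros Hab [Cu Hu] D1 D2; destruct (lift_exists u a b) as [th [C L]]; [lra | auto | auto |].
  rewrite (angle_change_lift u a b th) by (try split; auto).
  destruct (dir_unique (u a) t1 (th a)) as [k Hk]; [auto | apply L; lra |].
  destruct (dir_unique (u b) t2 (th b)) as [l Hl]; [auto | apply L; lra |].
  exists (l - k)%Z; rewrite minus_IZR; lra.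
Qed.

Lemma angle_change_opp (u : R -> R * R) (a b : R) :
  a <= b -> nonvanishing u a b -> angle_change (fun t => (- fst (u t), - snd (u t))) a b = angle_change u a b.
Proof.
  intros Hab [Cu Hu]; destruct (lift_exists u a b) as [th [C L]]; [lra | auto | auto |].
  rewrite (angle_change_lift u a b th) by (try split; auto).
  rewrite (angle_change_lift _ a b (fun t => th t + PI)); [lra | lra |]; split.
  - intros t; apply cont_plus; [apply C | apply continuous_const].
  - intros t Ht; apply dir_opp; auto.
Qed.

Lemma angle_change_turn (u v : R -> R * R) (a b : R) :
  a <= b -> nonvanishing u a b -> (forall t, continuous v t) ->
  (forall t, a <= t <= b -> 0 < dot (u t) (v t)) ->
  angle_change v a b = angle_change u a b + turn (u b) (v b) - turn (u a) (v a).
Proof.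
  intros Hab [Cu Hu] Cv Hd; destruct (lift_exists u a b) as [th L]; [lra | auto | auto |].
  rewrite (angle_change_lift u a b th) by auto.
  rewrite (angle_change_lift v a b _ Hab (lift_turn u v a b th Hab Cu Cv Hd L)).
  rewrite !cut_id by lra; lra.
Qed.

Lemma angle_change_const_turn (p : R * R) (v : R -> R * R) (a b : R) :
  a <= b -> p <> (0, 0) -> (forall t, continuous v t) ->
  (forall t, a <= t <= b -> 0 < dot p (v t)) ->
  angle_change v a b = turn p (v b) - turn p (v a).
Proof.
  intros Hab Hp Cv Hd; destruct (dir_exists p Hp) as [t0 Ht0].
  assert (L : is_lift (fun _ => p) a b (fun _ => t0)).
  { split; [intros; apply continuous_const | intros; exact Ht0]. }
  rewrite (angle_change_turn (fun _ => p) v a b Hab); auto.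
  - rewrite (angle_change_lift (fun _ => p) a b _ Hab L); lra.
  - split; [intros; apply continuous_const | intros; exact Hp].
Qed.

Lemma tube (f : R * R -> R) (a b t0 : R) :
  a <= b -> (forall z, continuous f z) -> (forall s, a <= s <= b -> 0 < f (s, t0)) ->
  exists d, 0 < d /\ forall s t, a <= s <= b -> Rabs (t - t0) < d -> 0 < f (s, t).
Proof.
  intros Hab Cf Hf.
  apply (real_induction (fun z => exists d, 0 < d /\
    forall s t, a <= s <= z -> Rabs (t - t0) < d -> 0 < f (s, t)) a b Hab).
  - destruct (cont_pos f (a, t0) (Cf _)) as [d Hd]; [apply Hf; lra |].
    exists d; split; [apply cond_pos |]; intros s t Hs Ht; apply Hd; split; simpl.
    + replace s with a by lra; apply ball_center.
    + exact Ht.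
  - intros x Hx.
    destruct (cont_pos f (x, t0) (Cf _)) as [d Hd]; [apply Hf; lra |].
    exists d; split; [apply cond_pos |].
    intros y z Hay Hxy Hyx Hyz Hzx Hzb [d' [Hd' H]].
    exists (Rmin d d'); split; [apply Rmin_glb_lt; [apply cond_pos | exact Hd'] |].
    intros s t Hs Ht; destruct (Rle_dec s y) as [Hsy | Hsy].
    + apply H; [lra |]; apply Rlt_le_trans with (1 := Ht); apply Rmin_r.
    + apply Hd; split; simpl.
      * change (Rabs (s - x) < d); apply Rabs_def1; lra.
      * apply Rlt_le_trans with (1 := Ht); apply Rmin_l.
Qed.

(** Homotopy invariance of the turning number, by continuous induction on the upper side. In a thin
    strip around height x every U(s, t) is within a right angle of U(s, x), so the horizontal change
    at height t and the two vertical changes differ from those at height x by [turn] terms at the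
    corners, and these cancel. *)
Lemma rectangle (U : R * R -> R * R) (a b c d : R) :
  a <= b -> c <= d -> (forall z, continuous U z) ->
  (forall s t, a <= s <= b -> c <= t <= d -> U (s, t) <> (0, 0)) ->
  angle_change (fun s => U (s, c)) a b + angle_change (fun t => U (b, t)) c d =
  angle_change (fun s => U (s, d)) a b + angle_change (fun t => U (a, t)) c d.
Proof.
  intros Hab Hcd CU HU.
  assert (C1 : forall t s, continuous (fun s => U (s, t)) s).
  { intros t s; apply (continuous_comp (fun s => (s, t)) U); [| apply CU].
    apply cont_pair; [apply continuous_id | apply continuous_const]. }
  assert (C2 : forall s t, continuous (fun t => U (s, t)) t).
  { intros s t; apply (continuous_comp (fun t => (s, t)) U); [| apply CU].
    apply cont_pair; [apply continuous_const | apply continuous_id]. }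
  assert (N2 : forall s z, a <= s <= b -> z <= d -> nonvanishing (fun t => U (s, t)) c z).
  { intros s z Hs Hz; split; [apply C2 | intros; apply HU; lra]. }
  apply (real_induction (fun z => angle_change (fun s => U (s, c)) a b + angle_change (fun t => U (b, t)) c z =
    angle_change (fun s => U (s, z)) a b + angle_change (fun t => U (a, t)) c z) c d Hcd).
  - assert (E : forall s, a <= s <= b -> angle_change (fun t => U (s, t)) c c = 0).
    { intros s Hs; destruct (lift_exists (fun t => U (s, t)) c c) as [th L];
        [lra | apply C2 | intros; apply HU; lra |].
      rewrite (angle_change_lift _ c c th); lra || auto. }
    rewrite !E by lra; reflexivity.
  - intros x Hx.
    destruct (tube (fun z => dot (U z) (U (fst z, x))) a b x Hab) as [e [He Htube]].
    { intros z; apply cont_dot; [apply CU |].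
      apply (continuous_comp (fun z : R * R => (fst z, x)) U); [| apply CU].
      apply cont_pair; [apply cont_fst, continuous_id | apply continuous_const]. }
    { intros s Hs; simpl; apply dot_self_pos, HU; lra. }
    simpl in Htube.
    assert (Hnear : forall t, c <= t <= d -> Rabs (t - x) < e ->
      angle_change (fun s => U (s, x)) a b = angle_change (fun s => U (s, t)) a b
        + turn (U (b, t)) (U (b, x)) - turn (U (a, t)) (U (a, x))).
    { intros t Ht Htx; apply (angle_change_turn (fun s => U (s, t)) (fun s => U (s, x)) a b Hab).
      - split; [apply C1 | intros; apply HU; lra].
      - apply C1.
      - intros s Hs; apply Htube; assumption. }
    assert (Hside : forall s y z, a <= s <= b -> c <= y -> z <= d -> y <= z ->
       x - e < y -> z < x + e ->
       angle_change (fun t => U (s, t)) y z = turn (U (s, x)) (U (s, z)) - turn (U (s, x)) (U (s, y))).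
    { intros s y z Hs Hy Hz Hyz Hye Hze.
      apply (angle_change_const_turn (U (s, x)) (fun t => U (s, t)) y z Hyz).
      - apply HU; lra.
      - apply C2.
      - intros t Ht.
        replace (dot (U (s, x)) (U (s, t))) with (dot (U (s, t)) (U (s, x)))
          by (unfold dot; ring).
        apply Htube; [exact Hs | apply Rabs_def1; lra]. }
    assert (Hanti : forall p q, turn q p = - turn p q).
    { intros p q; unfold turn; rewrite <- atan_opp; f_equal.
      replace (cross q p) with (- cross p q) by (unfold cross; ring).
      replace (dot q p) with (dot p q) by (unfold dot; ring).
      unfold Rdiv; ring. }
    exists e; split; [exact He |].
    intros y z Hcy Hxy Hyx Hyz Hzx Hzd IH.
    rewrite (angle_change_add (fun t => U (b, t)) c y z) by (try apply N2; lra).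
    rewrite (angle_change_add (fun t => U (a, t)) c y z) by (try apply N2; lra).
    assert (Ey := Hnear y ltac:(lra) ltac:(apply Rabs_def1; lra)).
    assert (Ez := Hnear z ltac:(lra) ltac:(apply Rabs_def1; lra)).
    rewrite (Hside a y z), (Hside b y z) by lra.
    rewrite (Hanti (U (b, x))), (Hanti (U (a, x))) in Ey, Ez; lra.
Qed.

Lemma plane_continuous_continuous (h : point -> point) :
  plane_continuous h -> forall p : R * R, continuous h p.
Proof.
  intros Hh p; apply filterlim_locally; intros eps.
  destruct (Hh p eps (cond_pos eps)) as [d [Hd H]].
  exists (mkposreal d Hd); intros q [B1 B2].
  change (Rabs (fst q - fst p) < d) in B1; change (Rabs (snd q - snd p) < d) in B2.
  specialize (H q); unfold pdist in H.
  assert (Hlt : Rmax (Rabs (fst q - fst p)) (Rabs (snd q - snd p)) < d)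
    by (apply Rmax_lub_lt; assumption).
  specialize (H Hlt); split.
  - change (Rabs (fst (h q) - fst (h p)) < eps).
    apply Rle_lt_trans with (2 := H); apply Rmax_l.
  - change (Rabs (snd (h q) - snd (h p)) < eps).
    apply Rle_lt_trans with (2 := H); apply Rmax_r.
Qed.

Lemma vsub_nonzero (p q : R * R) : p <> q -> vsub p q <> (0, 0).
Proof.
  destruct p as [x y], q as [z w]; unfold vsub; simpl; intros H E.
  injection E; intros; apply H; f_equal; lra.
Qed.

Lemma angle_change_refl (u : R -> R * R) (a : R) : nonvanishing u a a -> angle_change u a a = 0.
Proof.
  intros H; assert (E := angle_change_add u a a a ltac:(lra) H); lra.
Qed.

(** Each period repeats the same whole number k of turns. Only the divisibility by N matters later,
    so the degree k is never computed. *)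
Lemma angle_change_periodic (v : R -> R * R) (N : nat) (a : R) :
  (forall t, continuous v t) -> (forall t, v t <> (0, 0)) -> (forall t, v (t + 2 * PI) = v t) ->
  exists k : Z, angle_change v a (a + 2 * PI * INR N) = 2 * IZR k * PI * INR N.
Proof.
  intros Cv Hv Hper; assert (HP := PI_RGT_0).
  assert (NV : forall a b, nonvanishing v a b) by (intros; split; auto).
  destruct (dir_exists (v a)) as [t0 D0]; [auto |].
  destruct (angle_change_dir v a (a + 2 * PI) t0 t0) as [k Hk];
    [lra | auto | auto | rewrite Hper; auto |].
  exists k; induction N as [| N IH].
  - simpl; rewrite Rmult_0_r, Rplus_0_r, angle_change_refl; [ring | auto].
  - assert (HN := pos_INR N); rewrite S_INR.
    rewrite (angle_change_add v a (a + 2 * PI * INR N)) by (auto; nra).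
    rewrite IH.
    assert (Hsh : forall j t, v (t + 2 * PI * INR j) = v t).
    { intros j; induction j as [| j IHj]; intros t.
      - simpl; f_equal; ring.
      - rewrite S_INR; replace (t + 2 * PI * (INR j + 1)) with (t + 2 * PI * INR j + 2 * PI) by ring.
        rewrite Hper; apply IHj. }
    destruct (lift_exists v (a + 2 * PI * INR N) (a + 2 * PI * (INR N + 1))) as [th L];
      [nra | auto | auto |].
    rewrite (angle_change_lift _ _ _ th) by (auto; nra).
    assert (E : angle_change (fun t => v (t + 2 * PI * INR N)) a (a + 2 * PI) =
      th (a + 2 * PI + 2 * PI * INR N) - th (a + 2 * PI * INR N)).
    { apply (angle_change_comp v (fun t => t + 2 * PI * INR N) a (a + 2 * PI) _ _ th) with (4 := L).
      - lra.
      - intros; apply cont_plus; [apply continuous_id | apply continuous_const].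
      - intros; nra. }
    rewrite <- (angle_change_ext v (fun t => v (t + 2 * PI * INR N)) a (a + 2 * PI)) in E;
      [| lra | auto | intros; symmetry; apply Hsh].
    replace (a + 2 * PI * (INR N + 1)) with (a + 2 * PI + 2 * PI * INR N) by ring.
    rewrite <- E, Hk; ring.
Qed.

Lemma cos_2kPI (x : R) (k : Z) : cos (x + 2 * IZR k * PI) = cos x /\ sin (x + 2 * IZR k * PI) = sin x.
Proof.
  destruct (Z_le_dec 0 k) as [Hk | Hk].
  - rewrite <- (Z2Nat.id k Hk), <- INR_IZR_INZ; split; [apply cos_period | apply sin_period].
  - assert (E : x + 2 * IZR k * PI + 2 * INR (Z.to_nat (- k)) * PI = x).
    { rewrite INR_IZR_INZ, Z2Nat.id, opp_IZR by lia; ring. }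
    split; [rewrite <- (cos_period (x + 2 * IZR k * PI) (Z.to_nat (- k)))
           | rewrite <- (sin_period (x + 2 * IZR k * PI) (Z.to_nat (- k)))]; rewrite E; reflexivity.
Qed.

(* The configuration space of two points deforms onto a circle: contract the second point to the
   origin and make the difference vector rotate at constant speed on the unit circle. *)
Lemma angle_change_homeo (h : R * R -> R * R) (x y : R -> R * R) (I : Z) :
  (forall p, continuous h p) -> (forall p q, h p = h q -> p = q) ->
  (forall t, continuous x t) -> (forall t, continuous y t) ->
  (forall t, 0 <= t <= 4 -> x t <> y t) -> x 0 = x 4 -> y 0 = y 4 ->
  angle_change (fun t => vsub (x t) (y t)) 0 4 = 2 * IZR I * PI ->
  exists k : Z, angle_change (fun t => vsub (h (x t)) (h (y t))) 0 4 = 2 * IZR (k * I) * PI.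
Proof.
  intros Ch Ih Cx Cy Hxy Ex Ey HI; assert (HP := PI_RGT_0).
  destruct (lift_exists (fun t => vsub (x t) (y t)) 0 4) as [th [Cth L]].
  { lra. } { intros; apply cont_vsub; auto. } { intros; apply vsub_nonzero; auto. }
  rewrite (angle_change_lift _ 0 4 th) in HI by (try split; auto; lra).
  set (rho := fun t => sqrt (dot (vsub (x t) (y t)) (vsub (x t) (y t)))).
  assert (Crho : forall t, continuous rho t).
  { intros t; apply continuous_sqrt_comp, cont_dot; apply cont_vsub; auto. }
  assert (Prho : forall t, 0 <= t <= 4 -> 0 < rho t).
  { intros t Ht; apply sqrt_lt_R0, dot_self_pos, vsub_nonzero; auto. }
  assert (Erho : forall t, 0 <= t <= 4 ->
     vsub (x t) (y t) = (rho t * cos (th t), rho t * sin (th t))).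
  { intros t Ht; destruct (L t Ht) as [r [Hr [H1 H2]]].
    assert (Er : rho t = r).
    { unfold rho, dot; rewrite H1, H2.
      assert (Hsc := sin2_cos2 (th t)); unfold Rsqr in Hsc.
      replace (r * cos (th t) * (r * cos (th t)) + r * sin (th t) * (r * sin (th t)))
        with (r * r) by nra.
      apply sqrt_square; lra. }
    rewrite Er, <- H1, <- H2; destruct (vsub (x t) (y t)); reflexivity. }
  set (Y := fun z : R * R => ((1 - fst z) * fst (y (snd z)), (1 - fst z) * snd (y (snd z)))).
  set (Rd := fun z : R * R => (1 - fst z) * rho (snd z) + fst z).
  set (A := fun z : R * R => (1 - fst z) * th (snd z)
              + fst z * (th 0 + 2 * IZR I * PI / 4 * snd z)).
  set (X := fun z : R * R => (fst (Y z) + Rd z * cos (A z), snd (Y z) + Rd z * sin (A z))).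
  assert (Cf : forall z : R * R, continuous (fun z : R * R => fst z) z)
    by (intros; apply cont_fst, continuous_id).
  assert (Cs : forall z : R * R, continuous (fun z : R * R => snd z) z)
    by (intros; apply cont_snd, continuous_id).
  assert (C1f : forall z : R * R, continuous (fun z : R * R => 1 - fst z) z)
    by (intros; apply cont_minus; [apply continuous_const | apply Cf]).
  assert (CY : forall z, continuous Y z).
  { intros z; apply cont_pair; (apply cont_mult; [apply C1f |]);
      [apply cont_fst | apply cont_snd]; apply (continuous_comp (fun z : R * R => snd z) y); auto. }
  assert (CR : forall z, continuous Rd z).
  { intros z; apply cont_plus; [apply cont_mult; [apply C1f |] | apply Cf].
    apply (continuous_comp (fun z : R * R => snd z) rho); auto. }
  assert (CA : forall z, continuous A z).
  { intros z; apply cont_plus; apply cont_mult; auto.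
    - apply (continuous_comp (fun z : R * R => snd z) th); auto.
    - apply cont_plus; [apply continuous_const |].
      apply cont_mult; [apply continuous_const | apply Cs]. }
  assert (CX : forall z, continuous X z).
  { intros z; apply cont_pair; (apply cont_plus; [| apply cont_mult; [apply CR |]]).
    - apply cont_fst, CY.
    - apply (continuous_comp A cos); [apply CA | apply continuous_cos].
    - apply cont_snd, CY.
    - apply (continuous_comp A sin); [apply CA | apply continuous_sin]. }
  set (U := fun z => vsub (h (X z)) (h (Y z))).
  assert (CU : forall z, continuous U z).
  { intros z; apply cont_vsub; [apply (continuous_comp X h) | apply (continuous_comp Y h)]; auto. }
  assert (NU : forall s t, 0 <= s <= 1 -> 0 <= t <= 4 -> U (s, t) <> (0, 0)).
  { intros s t Hs Ht; apply vsub_nonzero; intros E; apply Ih in E.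
    assert (HR : 0 < Rd (s, t)).
    { unfold Rd; simpl; specialize (Prho t Ht).
      destruct (Req_dec s 1) as [-> | Hs1]; nra. }
    unfold X in E; destruct (Y (s, t)) as [p q]; simpl in E; injection E; intros E2 E1.
    assert (Hsc := sin2_cos2 (A (s, t))); unfold Rsqr in Hsc.
    assert (cos (A (s, t)) = 0) by nra; assert (sin (A (s, t)) = 0) by nra; nra. }
  assert (Hrect := rectangle U 0 1 0 4 ltac:(lra) ltac:(lra) CU NU).
  assert (Hcirc : forall t, U (1, t) =
     vsub (h (cos (th 0 + 2 * IZR I * PI / 4 * t), sin (th 0 + 2 * IZR I * PI / 4 * t))) (h (0, 0))).
  { intros t; unfold U, X, Y, Rd, A; simpl; f_equal; f_equal; f_equal; try ring.
    - replace ((1 - 1) * fst (y t) + ((1 - 1) * rho t + 1) *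
        cos ((1 - 1) * th t + 1 * (th 0 + 2 * IZR I * PI / 4 * t))) with
        (cos ((1 - 1) * th t + 1 * (th 0 + 2 * IZR I * PI / 4 * t))) by ring.
      f_equal; ring.
    - replace ((1 - 1) * snd (y t) + ((1 - 1) * rho t + 1) *
        sin ((1 - 1) * th t + 1 * (th 0 + 2 * IZR I * PI / 4 * t))) with
        (sin ((1 - 1) * th t + 1 * (th 0 + 2 * IZR I * PI / 4 * t))) by ring.
      f_equal; ring. }
  assert (H04 : forall s, U (s, 0) = U (s, 4)).
  { intros s; unfold U.
    assert (EY : Y (s, 0) = Y (s, 4)) by (unfold Y; simpl; rewrite Ey; reflexivity).
    assert (ER : Rd (s, 0) = Rd (s, 4)) by (unfold Rd, rho; simpl; rewrite Ex, Ey; reflexivity).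
    assert (EA : A (s, 4) = A (s, 0) + 2 * IZR I * PI) by (unfold A; simpl; nra).
    unfold X; rewrite <- EY, <- ER, EA.
    destruct (cos_2kPI (A (s, 0)) I) as [-> ->]; reflexivity. }
  assert (E0 : angle_change (fun t => U (0, t)) 0 4 = angle_change (fun t => vsub (h (x t)) (h (y t))) 0 4).
  { apply angle_change_ext; [lra | | ].
    - split; [| intros; apply NU; lra].
      intros t; apply (continuous_comp (fun t => (0, t)) U); [| apply CU].
      apply cont_pair; [apply continuous_const | apply continuous_id].
    - intros t Ht; specialize (Erho t Ht); unfold U, X, Y, Rd, A; simpl.
      unfold vsub in Erho; injection Erho; intros E2 E1.
      destruct (x t) as [x1 x2], (y t) as [y1 y2]; simpl in *.
      replace ((1 - 0) * th t + 0 * (th 0 + 2 * IZR I * PI / 4 * t)) with (th t) by ring.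
      f_equal; f_equal; f_equal; lra. }
  assert (Eside : angle_change (fun s => U (s, 0)) 0 1 = angle_change (fun s => U (s, 4)) 0 1).
  { apply angle_change_ext; [lra | | intros; apply H04].
    split; [| intros; apply NU; lra].
    intros t; apply (continuous_comp (fun s => (s, 0)) U); [| apply CU].
    apply cont_pair; [apply continuous_id | apply continuous_const]. }
  set (v := fun p => vsub (h (cos p, sin p)) (h (0, 0))).
  assert (Cv : forall p, continuous v p).
  { intros p; apply cont_vsub; [| apply continuous_const].
    apply (continuous_comp (fun p => (cos p, sin p)) h); [| apply Ch].
    apply cont_pair; [apply continuous_cos | apply continuous_sin]. }
  assert (Nv : forall p, v p <> (0, 0)).
  { intros p; apply vsub_nonzero; intros E; apply Ih in E; injection E; intros E2 E1.
    assert (Hsc := sin2_cos2 p); unfold Rsqr in Hsc; rewrite E1, E2 in Hsc; lra. }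
  assert (Pv : forall p, v (p + 2 * PI) = v p).
  { intros p; unfold v; destruct (cos_2kPI p 1) as [E1 E2].
    rewrite Rmult_1_r in E1, E2; rewrite E1, E2; reflexivity. }
  rewrite <- E0; clear E0.
  assert (E1 : angle_change (fun t => U (1, t)) 0 4 = angle_change (fun t => U (0, t)) 0 4) by lra.
  rewrite <- E1.
  set (phi := fun t => th 0 + 2 * IZR I * PI / 4 * t).
  assert (Cphi : forall t, continuous phi t).
  { intros t; apply cont_plus; [apply continuous_const |].
    apply cont_mult; [apply continuous_const | apply continuous_id]. }
  rewrite (angle_change_ext (fun t => U (1, t)) (fun t => v (phi t)));
    [| lra | | intros; apply Hcirc].
  2:{ split; [| intros; apply NU; lra].
      intros t; apply (continuous_comp (fun t => (1, t)) U); [| apply CU].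
      apply cont_pair; [apply continuous_const | apply continuous_id]. }
  assert (Ephi : phi 4 = th 0 + 2 * IZR I * PI) by (unfold phi; field).
  assert (Ephi0 : phi 0 = th 0) by (unfold phi; ring).
  (* [angle_change_periodic] takes a natural number of periods; for negative I it is applied from
     the far end of the interval, and the circle is run through backwards. *)
  destruct (Z_le_dec 0 I) as [Hpos | Hneg].
  - assert (HIR : 0 <= IZR I) by (apply IZR_le; exact Hpos).
    assert (0 <= IZR I * PI) by nra.
    destruct (angle_change_periodic v (Z.to_nat I) (th 0) Cv Nv Pv) as [k Hk].
    rewrite INR_IZR_INZ, Z2Nat.id in Hk by exact Hpos.
    destruct (lift_exists v (th 0) (th 0 + 2 * PI * IZR I)) as [T LT]; [nra | auto | auto |].
    rewrite (angle_change_comp v phi 0 4 _ _ T) with (4 := LT);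
      [| lra | exact Cphi | intros t Ht; unfold phi;
       replace (2 * IZR I * PI / 4 * t) with (IZR I * PI * (t / 2)) by field; nra].
    rewrite (angle_change_lift _ _ _ T) in Hk; [| nra | exact LT].
    exists k; rewrite Ephi, Ephi0, mult_IZR.
    replace (th 0 + 2 * IZR I * PI) with (th 0 + 2 * PI * IZR I) by ring.
    rewrite Hk; ring.
  - assert (HIR : IZR I <= 0) by (apply IZR_le; lia).
    assert (IZR I * PI <= 0) by nra.
    destruct (angle_change_periodic v (Z.to_nat (- I)) (th 0 + 2 * PI * IZR I) Cv Nv Pv) as [k Hk].
    rewrite INR_IZR_INZ, Z2Nat.id, opp_IZR in Hk by lia.
    replace (th 0 + 2 * PI * IZR I + 2 * PI * - IZR I) with (th 0) in Hk by ring.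
    destruct (lift_exists v (th 0 + 2 * PI * IZR I) (th 0)) as [T LT]; [nra | auto | auto |].
    rewrite (angle_change_comp v phi 0 4 _ _ T) with (4 := LT);
      [| lra | exact Cphi | intros t Ht; unfold phi;
       replace (2 * IZR I * PI / 4 * t) with (IZR I * PI * (t / 2)) by field; nra].
    rewrite (angle_change_lift _ _ _ T) in Hk; [| nra | exact LT].
    exists k; rewrite Ephi, Ephi0, mult_IZR.
    replace (th 0 + 2 * IZR I * PI) with (th 0 + 2 * PI * IZR I) by ring.
    lra.
Qed.

(** * Intersection numbers of arcs *)

(** Together with [loop_t], this runs over [0, 4] counterclockwise around the boundary of [a, b] x
    [c, d]: bottom, right, top, left. *)
Definition loop_s (a b t : R) : R := a + (b - a) * (cut 0 1 t - (cut 2 3 t - 2)).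
Definition loop_t (c d t : R) : R := c + (d - c) * ((cut 1 2 t - 1) - (cut 3 4 t - 3)).

Ltac cuts := repeat first
  [ rewrite cut_id by lra | rewrite cut_below by lra | rewrite cut_above by lra ].

Lemma cont_loop_s (a b t : R) : continuous (loop_s a b) t.
Proof.
  apply cont_plus; [apply continuous_const | apply cont_mult; [apply continuous_const |]].
  apply cont_minus; [apply cont_cut | apply cont_minus; [apply cont_cut | apply continuous_const]].
Qed.

Lemma cont_loop_t (c d t : R) : continuous (loop_t c d) t.
Proof.
  apply cont_plus; [apply continuous_const | apply cont_mult; [apply continuous_const |]].
  apply cont_minus; (apply cont_minus; [apply cont_cut | apply continuous_const]).
Qed.

Lemma loop_cases (a b c d t : R) : a < b -> c < d -> 0 <= t <= 4 ->
  (0 <= t <= 1 /\ loop_t c d t = c /\ a <= loop_s a b t <= b) \/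
  (1 <= t <= 2 /\ loop_s a b t = b /\ c <= loop_t c d t <= d) \/
  (2 <= t <= 3 /\ loop_t c d t = d /\ a <= loop_s a b t <= b) \/
  (3 <= t <= 4 /\ loop_s a b t = a /\ c <= loop_t c d t <= d).
Proof.
  intros Hab Hcd Ht; unfold loop_s, loop_t.
  destruct (Rle_dec t 1); [left | right; destruct (Rle_dec t 2); [left |
    right; destruct (Rle_dec t 3); [left | right]]]; cuts; repeat split; nra.
Qed.

(** U may vanish inside the rectangle, as it does at a crossing, so the four sides are
    reparametrised one by one and the total need not be 0. *)
Lemma loop_ac (U : R * R -> R * R) (a b c d : R) :
  a < b -> c < d -> (forall z, continuous U z) ->
  (forall s, a <= s <= b -> U (s, c) <> (0, 0) /\ U (s, d) <> (0, 0)) ->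
  (forall t, c <= t <= d -> U (a, t) <> (0, 0) /\ U (b, t) <> (0, 0)) ->
  angle_change (fun t => U (loop_s a b t, loop_t c d t)) 0 4 =
  angle_change (fun s => U (s, c)) a b + angle_change (fun t => U (b, t)) c d
  - angle_change (fun s => U (s, d)) a b - angle_change (fun t => U (a, t)) c d.
Proof.
  intros Hab Hcd CU HUs HUt.
  assert (C1 : forall t s, continuous (fun s => U (s, t)) s).
  { intros t s; apply (continuous_comp (fun s => (s, t)) U); [| apply CU].
    apply cont_pair; [apply continuous_id | apply continuous_const]. }
  assert (C2 : forall s t, continuous (fun t => U (s, t)) t).
  { intros s t; apply (continuous_comp (fun t => (s, t)) U); [| apply CU].
    apply cont_pair; [apply continuous_const | apply continuous_id]. }
  set (V := fun t => U (loop_s a b t, loop_t c d t)).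
  assert (NV : nonvanishing V 0 4).
  { split.
    - intros t; apply (continuous_comp (fun t => (loop_s a b t, loop_t c d t)) U); [| apply CU].
      apply cont_pair; [apply cont_loop_s | apply cont_loop_t].
    - intros t Ht; unfold V.
      destruct (loop_cases a b c d t Hab Hcd Ht) as
        [[_ [-> H]] | [[_ [-> H]] | [[_ [-> H]] | [_ [-> H]]]]];
      [apply (HUs _ H) | apply (HUt _ H) | apply (HUs _ H) | apply (HUt _ H)]. }
  assert (NVsub : forall i j, 0 <= i -> j <= 4 -> nonvanishing V i j)
    by (intros i j Hi Hj; apply (nonvanishing_sub V 0 4); assumption).
  rewrite (angle_change_add V 0 1 4), (angle_change_add V 1 2 4), (angle_change_add V 2 3 4) by (try apply NVsub; lra).
  destruct (lift_exists (fun s => U (s, c)) a b) as [th1 L1];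
    [lra | apply C1 | intros; apply HUs; assumption |].
  destruct (lift_exists (fun s => U (s, d)) a b) as [th3 L3];
    [lra | apply C1 | intros; apply HUs; assumption |].
  destruct (lift_exists (fun t => U (b, t)) c d) as [th2 L2];
    [lra | apply C2 | intros; apply HUt; assumption |].
  destruct (lift_exists (fun t => U (a, t)) c d) as [th4 L4];
    [lra | apply C2 | intros; apply HUt; assumption |].
  rewrite (angle_change_lift _ a b th1), (angle_change_lift _ a b th3), (angle_change_lift _ c d th2), (angle_change_lift _ c d th4)
    by (assumption || lra).
  assert (E1 : angle_change V 0 1 = th1 b - th1 a).
  { rewrite (angle_change_ext V (fun t => U (loop_s a b t, c))); [| lra | apply NVsub; lra |].
    - rewrite (angle_change_comp (fun s => U (s, c)) (loop_s a b) 0 1 a b th1) with (4 := L1).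
      + unfold loop_s; cuts; f_equal; f_equal; ring.
      + lra.
      + apply cont_loop_s.
      + intros t Ht; unfold loop_s; cuts; nra.
    - intros t Ht; unfold V, loop_t; cuts; f_equal; f_equal; ring. }
  assert (E2 : angle_change V 1 2 = th2 d - th2 c).
  { rewrite (angle_change_ext V (fun t => U (b, loop_t c d t))); [| lra | apply NVsub; lra |].
    - rewrite (angle_change_comp (fun t => U (b, t)) (loop_t c d) 1 2 c d th2) with (4 := L2).
      + unfold loop_t; cuts; f_equal; f_equal; ring.
      + lra.
      + apply cont_loop_t.
      + intros t Ht; unfold loop_t; cuts; nra.
    - intros t Ht; unfold V, loop_s; cuts; f_equal; f_equal; ring. }
  assert (E3 : angle_change V 2 3 = th3 a - th3 b).
  { rewrite (angle_change_ext V (fun t => U (loop_s a b t, d))); [| lra | apply NVsub; lra |].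
    - rewrite (angle_change_comp (fun s => U (s, d)) (loop_s a b) 2 3 a b th3) with (4 := L3).
      + unfold loop_s; cuts; f_equal; f_equal; ring.
      + lra.
      + apply cont_loop_s.
      + intros t Ht; unfold loop_s; cuts; nra.
    - intros t Ht; unfold V, loop_t; cuts; f_equal; f_equal; ring. }
  assert (E4 : angle_change V 3 4 = th4 c - th4 d).
  { rewrite (angle_change_ext V (fun t => U (a, loop_t c d t))); [| lra | apply NVsub; lra |].
    - rewrite (angle_change_comp (fun t => U (a, t)) (loop_t c d) 3 4 c d th4) with (4 := L4).
      + unfold loop_t; cuts; f_equal; f_equal; ring.
      + lra.
      + apply cont_loop_t.
      + intros t Ht; unfold loop_t; cuts; nra.
    - intros t Ht; unfold V, loop_s; cuts; f_equal; f_equal; ring. }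
  rewrite E1, E2, E3, E4; ring.
Qed.

(** Measured from the fixed vector p, both ends have angles in (-PI/2, PI/2). Hence the change is
    smaller than PI in absolute value and has the sign of its sine. *)
Lemma angle_change_halfplane (v : R -> R * R) (p : R * R) (a b : R) :
  a <= b -> p <> (0, 0) -> (forall t, continuous v t) ->
  (forall t, a <= t <= b -> 0 < dot p (v t)) ->
  - PI < angle_change v a b < PI /\
  (0 < cross (v a) (v b) -> 0 < angle_change v a b) /\ (cross (v a) (v b) < 0 -> angle_change v a b < 0).
Proof.
  intros Hab Hp Cv Hd; assert (HP := PI_RGT_0).
  assert (B : - PI < angle_change v a b < PI).
  { rewrite (angle_change_const_turn p v a b) by assumption; unfold turn.
    destruct (atan_bound (cross p (v a) / dot p (v a)));
    destruct (atan_bound (cross p (v b) / dot p (v b))); lra. }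
  assert (Hn : forall t, a <= t <= b -> v t <> (0, 0)).
  { intros t Ht E; specialize (Hd t Ht); rewrite E in Hd; unfold dot in Hd; simpl in Hd; lra. }
  destruct (lift_exists v a b Hab Cv Hn) as [th L].
  rewrite (angle_change_lift v a b th Hab L) in *.
  destruct L as [_ L].
  destruct (dir_cross (v a) (v b) (th a) (th b)) as [r [Hr E]]; [apply L; lra | apply L; lra |].
  split; [exact B | rewrite E; split; intros H; apply Rnot_le_lt; intros Hle].
  - assert (0 <= sin (- (th b - th a))) by (apply sin_ge_0; lra).
    rewrite sin_neg in *; nra.
  - assert (0 <= sin (th b - th a)) by (apply sin_ge_0; lra); nra.
Qed.

Definition signed_change (u : R -> R * R) (a b : R) : R :=
  if Rlt_dec a b then angle_change u a b else if Rlt_dec b a then - angle_change u b a else 0.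

Lemma signed_change_anti (u : R -> R * R) (a b : R) : signed_change u b a = - signed_change u a b.
Proof. unfold signed_change; destruct (Rlt_dec a b), (Rlt_dec b a); lra. Qed.

Lemma signed_change_le (u : R -> R * R) (a b : R) : a <= b -> nonvanishing u a b -> signed_change u a b = angle_change u a b.
Proof.
  intros Hab H; unfold signed_change; destruct (Rlt_dec a b); [reflexivity |].
  destruct (Rlt_dec b a); [lra |]; replace b with a in * by lra.
  rewrite angle_change_refl; auto.
Qed.

(* [sweep g a b v] is the angle swept by the ray from [v] to [g s] as [s] goes from [a] to [b];
   [isect] is [2 PI] times the algebraic number of intersections of two arcs. *)
Definition sweep (g : R -> R * R) (a b : R) (v : R * R) : R := signed_change (fun s => vsub (g s) v) a b.

Definition isect (g : R -> R * R) (a b : R) (f : R -> R * R) (c d : R) : R :=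
  sweep g a b (f c) - sweep g a b (f d) + sweep f c d (g b) - sweep f c d (g a).

Lemma isect_anti_l (g f : R -> R * R) (a b c d : R) : isect g b a f c d = - isect g a b f c d.
Proof. unfold isect, sweep; rewrite !(signed_change_anti _ a b); ring. Qed.

Lemma isect_anti_r (g f : R -> R * R) (a b c d : R) : isect g a b f d c = - isect g a b f c d.
Proof. unfold isect, sweep; rewrite !(signed_change_anti _ c d); ring. Qed.

Definition pcont (g : R -> R * R) : Prop := forall t, continuous g t.

Lemma nonvanishing_vsub (g : R -> R * R) (v : R * R) (a b : R) :
  pcont g -> (forall s, a <= s <= b -> g s <> v) -> nonvanishing (fun s => vsub (g s) v) a b.
Proof.
  intros Cg H; split.
  - intros t; apply cont_vsub; [apply Cg | apply continuous_const].
  - intros t Ht; apply vsub_nonzero; auto.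
Qed.

Lemma sweep_add (g : R -> R * R) (a m b : R) (v : R * R) :
  pcont g -> a <= m <= b -> (forall s, a <= s <= b -> g s <> v) ->
  sweep g a b v = sweep g a m v + sweep g m b v.
Proof.
  intros Cg Hm Hv; unfold sweep.
  rewrite !signed_change_le by (try apply nonvanishing_vsub; try lra; auto; intros; apply Hv; lra).
  apply angle_change_add; [lra | apply nonvanishing_vsub; auto].
Qed.

Lemma angle_change_vsub_swap (f : R -> R * R) (v : R * R) (c d : R) :
  pcont f -> c <= d -> (forall t, c <= t <= d -> f t <> v) ->
  angle_change (fun t => vsub v (f t)) c d = sweep f c d v.
Proof.
  intros Cf Hcd Hv.
  assert (NV := nonvanishing_vsub f v c d Cf Hv).
  unfold sweep; rewrite signed_change_le by assumption.
  rewrite <- (angle_change_opp (fun t => vsub (f t) v)) by assumption.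
  apply angle_change_ext; [exact Hcd | |].
  - split; [intros; apply cont_vsub; [apply continuous_const | apply Cf] |].
    intros t Ht; apply vsub_nonzero; intros E; apply (Hv t Ht); auto.
  - intros t _; unfold vsub; simpl; f_equal; ring.
Qed.

(** The field g(s) - f(t) has no zero on the parameter rectangle, and [isect] is its turning number
    along the boundary. *)
Lemma isect_disjoint_le (g f : R -> R * R) (a b c d : R) :
  pcont g -> pcont f -> a <= b -> c <= d ->
  (forall s t, a <= s <= b -> c <= t <= d -> g s <> f t) -> isect g a b f c d = 0.
Proof.
  intros Cg Cf Hab Hcd H.
  assert (E := rectangle (fun z => vsub (g (fst z)) (f (snd z))) a b c d Hab Hcd); simpl in E.
  assert (E' : angle_change (fun s => vsub (g s) (f c)) a b + angle_change (fun t => vsub (g b) (f t)) c d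
    = angle_change (fun s => vsub (g s) (f d)) a b + angle_change (fun t => vsub (g a) (f t)) c d).
  { apply E.
    - intros z; apply cont_vsub;
        [apply (continuous_comp (fun z : R * R => fst z) g) |
         apply (continuous_comp (fun z : R * R => snd z) f)];
        auto using cont_fst, cont_snd, continuous_id.
    - intros s t Hs Ht; apply vsub_nonzero; auto. }
  assert (Fa : forall t, c <= t <= d -> f t <> g a) by (intros t Ht Q; apply (H a t); auto; lra).
  assert (Fb : forall t, c <= t <= d -> f t <> g b) by (intros t Ht Q; apply (H b t); auto; lra).
  rewrite !angle_change_vsub_swap in E' by auto.
  unfold isect; unfold sweep at 1 2.
  rewrite !signed_change_le by (auto; apply nonvanishing_vsub; auto; intros; apply H; lra).
  lra.
Qed.

Definition hull (a b x : R) : Prop := a <= x <= b \/ b <= x <= a.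

Lemma isect_disjoint (g f : R -> R * R) (a b c d : R) :
  pcont g -> pcont f ->
  (forall s t, hull a b s -> hull c d t -> g s <> f t) -> isect g a b f c d = 0.
Proof.
  unfold hull; intros Cg Cf H.
  destruct (Rle_dec a b), (Rle_dec c d).
  - apply isect_disjoint_le; auto.
  - rewrite <- (Ropp_involutive (isect _ _ _ _ _ _)), <- isect_anti_r, isect_disjoint_le; auto; lra.
  - rewrite <- (Ropp_involutive (isect _ _ _ _ _ _)), <- isect_anti_l, isect_disjoint_le; auto; lra.
  - rewrite <- (Ropp_involutive (isect _ _ _ _ _ _)), <- isect_anti_l.
    rewrite <- (Ropp_involutive (isect _ _ _ _ _ _)), <- isect_anti_r, isect_disjoint_le; auto; lra.
Qed.

Lemma isect_add_l (g f : R -> R * R) (a m b c d : R) :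
  pcont g -> a <= m <= b -> (forall s, a <= s <= b -> g s <> f c /\ g s <> f d) ->
  isect g a b f c d = isect g a m f c d + isect g m b f c d.
Proof.
  intros Cg Hm H; unfold isect.
  rewrite (sweep_add g a m b (f c)), (sweep_add g a m b (f d));
    try assumption; try (intros; apply H; assumption); ring.
Qed.

Lemma isect_add_r (g f : R -> R * R) (a b c m d : R) :
  pcont f -> c <= m <= d -> (forall t, c <= t <= d -> f t <> g a /\ f t <> g b) ->
  isect g a b f c d = isect g a b f c m + isect g a b f m d.
Proof.
  intros Cf Hm H; unfold isect.
  rewrite (sweep_add f c m d (g a)), (sweep_add f c m d (g b));
    try assumption; try (intros; apply H; assumption); ring.
Qed.

(** After applying h the two arcs run along the axes, so on each side of the parameter rectangle the
    difference vector stays in an open half-plane and its turning is controlled.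
    [angle_change_homeo] carries the result back, up to the unknown degree of h. *)
Lemma isect_local (g f : R -> R * R) (h : R * R -> R * R) (s0 t0 r : R) :
  pcont g -> pcont f -> 0 < r ->
  (forall p, continuous h p) -> (forall p q, h p = h q -> p = q) ->
  (forall s, s0 - r <= s <= s0 + r -> snd (h (g s)) = 0 /\
     (s < s0 -> fst (h (g s)) < 0) /\ (s0 < s -> 0 < fst (h (g s)))) ->
  (forall t, t0 - r <= t <= t0 + r -> fst (h (f t)) = 0 /\
     (t < t0 -> snd (h (f t)) < 0) /\ (t0 < t -> 0 < snd (h (f t)))) ->
  exists k : Z, Z.Odd k /\ isect g (s0 - r) (s0 + r) f (t0 - r) (t0 + r) = 2 * IZR k * PI.
Proof.
  intros Cg Cf Hr Ch Ih Hg Hf; assert (HP := PI_RGT_0).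
  set (a := s0 - r) in *; set (b := s0 + r) in *; set (c := t0 - r) in *; set (d := t0 + r) in *.
  assert (Hab : a < b) by (unfold a, b; lra); assert (Hcd : c < d) by (unfold c, d; lra).
  assert (Ha : a < s0) by (unfold a; lra); assert (Hb : s0 < b) by (unfold b; lra).
  assert (Hc : c < t0) by (unfold c; lra); assert (Hd : t0 < d) by (unfold d; lra).
  clearbody a b c d.
  assert (Hne : forall s t, a <= s <= b -> c <= t <= d -> (s <> s0 \/ t <> t0) -> g s <> f t).
  { intros s t Hs Ht Hst E.
    destruct (Hg s Hs) as [G1 [G2 G3]]; destruct (Hf t Ht) as [F1 [F2 F3]].
    rewrite <- E in F1, F2, F3.
    destruct Hst as [Hst | Hst].
    - destruct (Rtotal_order s s0) as [Q | [Q | Q]]; [specialize (G2 Q) | contradiction |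
        specialize (G3 Q)]; lra.
    - destruct (Rtotal_order t t0) as [Q | [Q | Q]]; [specialize (F2 Q) | contradiction |
        specialize (F3 Q)]; lra. }
  set (x := fun t => g (loop_s a b t)); set (y := fun t => f (loop_t c d t)).
  assert (Cx : forall t, continuous x t)
    by (intros t; apply (continuous_comp (loop_s a b) g); [apply cont_loop_s | apply Cg]).
  assert (Cy : forall t, continuous y t)
    by (intros t; apply (continuous_comp (loop_t c d) f); [apply cont_loop_t | apply Cf]).
  assert (Hxy : forall t, 0 <= t <= 4 -> x t <> y t).
  { intros t Ht; unfold x, y.
    destruct (loop_cases a b c d t Hab Hcd Ht) as
        [[_ [-> H]] | [[_ [-> H]] | [[_ [-> H]] | [_ [-> H]]]]]; apply Hne; lra. }
  assert (Ex : x 0 = x 4) by (unfold x, loop_s; cuts; f_equal; ring).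
  assert (Ey : y 0 = y 4) by (unfold y, loop_t; cuts; f_equal; ring).
  assert (Eind : angle_change (fun t => vsub (x t) (y t)) 0 4 = isect g a b f c d).
  { transitivity (angle_change (fun s => vsub (g s) (f c)) a b + angle_change (fun t => vsub (g b) (f t)) c d
      - angle_change (fun s => vsub (g s) (f d)) a b - angle_change (fun t => vsub (g a) (f t)) c d);
      [apply (loop_ac (fun z => vsub (g (fst z)) (f (snd z))) a b c d Hab Hcd); simpl |].
    - intros z; apply cont_vsub;
        [apply (continuous_comp (fun z : R * R => fst z) g) |
         apply (continuous_comp (fun z : R * R => snd z) f)];
        auto using cont_fst, cont_snd, continuous_id.
    - intros s Hs; split; apply vsub_nonzero, Hne; lra.
    - intros t Ht; split; apply vsub_nonzero, Hne; lra.
    - assert (Fa : forall t, c <= t <= d -> f t <> g a)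
        by (intros t Ht Q; apply (Hne a t); auto; lra).
      assert (Fb : forall t, c <= t <= d -> f t <> g b)
        by (intros t Ht Q; apply (Hne b t); auto; lra).
      rewrite !angle_change_vsub_swap by (auto; lra).
      unfold isect; unfold sweep at 3 4.
      rewrite !signed_change_le by (try lra; apply nonvanishing_vsub; auto; intros; apply Hne; lra).
      ring. }
  assert (NVxy : nonvanishing (fun t => vsub (x t) (y t)) 0 4).
  { split; [intros; apply cont_vsub; auto | intros; apply vsub_nonzero; auto]. }
  destruct (dir_exists (vsub (x 0) (y 0))) as [p0 D0]; [apply vsub_nonzero, Hxy; lra |].
  destruct (angle_change_dir _ 0 4 p0 p0 ltac:(lra) NVxy D0) as [I HI].
  { simpl; rewrite <- Ex, <- Ey; exact D0. }
  replace (p0 - p0 + 2 * IZR I * PI) with (2 * IZR I * PI) in HI by ring.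
  destruct (angle_change_homeo h x y I Ch Ih Cx Cy Hxy Ex Ey HI) as [k Hk].
  set (W := fun z : R * R => vsub (h (g (fst z))) (h (f (snd z)))).
  assert (CW : forall z, continuous W z).
  { intros z; apply cont_vsub.
    - apply (continuous_comp (fun z : R * R => g (fst z)) h); [| apply Ch].
      apply (continuous_comp (fun z : R * R => fst z) g); auto using cont_fst, continuous_id.
    - apply (continuous_comp (fun z : R * R => f (snd z)) h); [| apply Ch].
      apply (continuous_comp (fun z : R * R => snd z) f); auto using cont_snd, continuous_id. }
  assert (NW : forall s t, a <= s <= b -> c <= t <= d -> (s <> s0 \/ t <> t0) -> W (s, t) <> (0, 0)).
  { intros s t Hs Ht Hst; apply vsub_nonzero; intros E; apply Ih in E; exact (Hne s t Hs Ht Hst E). }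
  assert (EW : angle_change (fun t => vsub (h (x t)) (h (y t))) 0 4 =
    angle_change (fun s => W (s, c)) a b + angle_change (fun t => W (b, t)) c d
    - angle_change (fun s => W (s, d)) a b - angle_change (fun t => W (a, t)) c d).
  { apply (loop_ac W a b c d Hab Hcd CW).
    - intros s Hs; split; apply NW; lra.
    - intros t Ht; split; apply NW; lra. }
  assert (Wv : forall s t, a <= s <= b -> c <= t <= d -> W (s, t) = (fst (h (g s)), - snd (h (f t)))).
  { intros s t Hs Ht; unfold W, vsub; simpl.
    rewrite (proj1 (Hg s Hs)), (proj1 (Hf t Ht)); f_equal; ring. }
  assert (C1 : forall t s, continuous (fun s => W (s, t)) s).
  { intros t s; apply (continuous_comp (fun s => (s, t)) W); [| apply CW].
    apply cont_pair; [apply continuous_id | apply continuous_const]. }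
  assert (C2 : forall s t, continuous (fun t => W (s, t)) t).
  { intros s t; apply (continuous_comp (fun t => (s, t)) W); [| apply CW].
    apply cont_pair; [apply continuous_const | apply continuous_id]. }
  assert (Ga := proj1 (proj2 (Hg a ltac:(lra))) Ha).
  assert (Gb := proj2 (proj2 (Hg b ltac:(lra))) Hb).
  assert (Fc := proj1 (proj2 (Hf c ltac:(lra))) Hc).
  assert (Fd := proj2 (proj2 (Hf d ltac:(lra))) Hd).
  assert (Nz : forall p q : R, (p <> 0 \/ q <> 0) -> (p, q) <> (0, 0)).
  { intros p q H E; injection E; intros; destruct H; contradiction. }
  destruct (angle_change_halfplane (fun s => W (s, c)) (0, 1) a b) as [B1 [_ B1']];
    [lra | apply Nz; lra | apply C1 | intros; rewrite Wv by lra; unfold dot; simpl; lra |].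
  destruct (angle_change_halfplane (fun s => W (s, d)) (0, -1) a b) as [B3 [B3' _]];
    [lra | apply Nz; lra | apply C1 | intros; rewrite Wv by lra; unfold dot; simpl; lra |].
  destruct (angle_change_halfplane (fun t => W (b, t)) (1, 0) c d) as [B2 [_ B2']];
    [lra | apply Nz; lra | apply C2 | intros; rewrite Wv by lra; unfold dot; simpl; lra |].
  destruct (angle_change_halfplane (fun t => W (a, t)) (-1, 0) c d) as [B4 [B4' _]];
    [lra | apply Nz; lra | apply C2 | intros; rewrite Wv by lra; unfold dot; simpl; lra |].
  rewrite !Wv in B1', B2', B3', B4' by lra.
  unfold cross in B1', B2', B3', B4'; simpl in B1', B2', B3', B4'.
  specialize (B1' ltac:(nra)); specialize (B2' ltac:(nra)).
  specialize (B3' ltac:(nra)); specialize (B4' ltac:(nra)).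
  rewrite EW in Hk.
  (* The two sides that are added turn negatively and the two that are subtracted positively, each
     by less than PI. The total is a multiple of 2 PI strictly between -4 PI and 0, hence -2 PI, and
     so I is 1 or -1. *)
  assert (Hm : (k * I = -1)%Z).
  { assert (-2 < IZR (k * I) < 0) by nra.
    destruct H as [H1 H2]; apply lt_IZR in H1; apply lt_IZR in H2; lia. }
  exists I; split; [| rewrite <- Eind; exact HI].
  destruct (Z.Even_or_Odd I) as [[j Hj] | Ho]; [exfalso; nia | exact Ho].
Qed.

(** Both arcs are cut down to the neighbourhood of the crossing in which the local model is valid;
    the pieces cut off miss the other arc and contribute 0. *)
Lemma isect_cross (g f : R -> R * R) (a b c d s0 t0 : R) :
  pcont g -> pcont f -> a < s0 < b -> c < t0 < d ->
  (forall s t, a <= s <= b -> c <= t <= d -> g s = f t -> s = s0 /\ t = t0) ->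
  proper_crossing g f s0 t0 ->
  exists k : Z, Z.Odd k /\ isect g a b f c d = 2 * IZR k * PI.
Proof.
  intros Cg Cf Hs Ht Huniq [h [hi [[Ch [_ [Hinv _]]] [_ [eta [Heta [Hg Hf]]]]]]].
  set (r := Rmin (eta / 2) (Rmin (Rmin ((s0 - a) / 2) ((b - s0) / 2))
                               (Rmin ((t0 - c) / 2) ((d - t0) / 2)))).
  assert (Hr : 0 < r /\ r <= eta / 2 /\ r <= (s0 - a) / 2 /\ r <= (b - s0) / 2
     /\ r <= (t0 - c) / 2 /\ r <= (d - t0) / 2).
  { unfold r, Rmin; repeat destruct (Rle_dec _ _); lra. }
  clearbody r.
  assert (Inj : forall p q, h p = h q -> p = q).
  { intros p q E; rewrite <- (Hinv p), <- (Hinv q), E; reflexivity. }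
  destruct (isect_local g f h s0 t0 r Cg Cf ltac:(lra) (plane_continuous_continuous h Ch) Inj)
    as [k [Ko Hk]].
  { intros s Hs'; apply Hg; apply Rabs_def1; lra. }
  { intros t Ht'; apply Hf; apply Rabs_def1; lra. }
  exists k; split; [exact Ko |]; rewrite <- Hk.
  assert (Hne : forall s t, a <= s <= b -> c <= t <= d -> (s <> s0 \/ t <> t0) -> g s <> f t).
  { intros s t Hs' Ht' Hst E; destruct (Huniq s t Hs' Ht' E); destruct Hst; contradiction. }
  rewrite (isect_add_r g f a b c (t0 - r) d); [| assumption | lra |].
  2:{ intros t Ht'; split; intros E; [apply (Hne a t) | apply (Hne b t)]; auto; lra. }
  rewrite (isect_add_r g f a b (t0 - r) (t0 + r) d); [| assumption | lra |].
  2:{ intros t Ht'; split; intros E; [apply (Hne a t) | apply (Hne b t)]; auto; lra. }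
  rewrite (isect_disjoint_le g f a b c (t0 - r)), (isect_disjoint_le g f a b (t0 + r) d);
    try assumption; try lra; try (intros; apply Hne; lra).
  rewrite (isect_add_l g f a (s0 - r) b); [| assumption | lra |].
  2:{ intros s Hs'; split; apply Hne; lra. }
  rewrite (isect_add_l g f (s0 - r) (s0 + r) b); [| assumption | lra |].
  2:{ intros s Hs'; split; apply Hne; lra. }
  rewrite (isect_disjoint_le g f a (s0 - r)), (isect_disjoint_le g f (s0 + r) b);
    try assumption; try lra; try (intros; apply Hne; lra).
Qed.

(** * Crossings of the edges of a simple topological graph, and closed curves made of four edges *)

Definition crossing (E : list (nat * nat)) (cur : nat * nat -> R -> point) (e f : nat * nat) : Prop :=
  In e E /\ In f E /\ e <> f /\ edges_cross cur e f.

(** The parameter on e of its crossing with f, unique for edges of a simple drawing; the value is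
    arbitrary if e and f do not cross. *)
Definition crossing_time (cur : nat * nat -> R -> point) (e f : nat * nat) : R :=
  epsilon (inhabits 0) (fun s => 0 < s < 1 /\ exists t, 0 < t < 1 /\ cur e s = cur f t).

Definition arc (cur : nat * nat -> R -> point) (e : nat * nat) (s : R) : R * R :=
  cur e (cut 0 1 s).

Lemma arc_in (cur : nat * nat -> R -> point) (e : nat * nat) (s : R) :
  0 <= s <= 1 -> arc cur e s = cur e s.
Proof. intros Hs; unfold arc; rewrite cut_id; auto. Qed.

Lemma arc_pcont (cur : nat * nat -> R -> point) (e : nat * nat) :
  curve_continuous (cur e) -> pcont (arc cur e).
Proof.
  intros Hc t; apply filterlim_locally; intros eps.
  destruct (Hc (cut 0 1 t) (cut_in 0 1 t ltac:(lra)) eps (cond_pos eps)) as [d [Hd H]].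
  generalize (proj1 (filterlim_locally _ _) (cont_cut 0 1 t) (mkposreal d Hd)); apply filter_imp.
  intros s Hs; specialize (H (cut 0 1 s) (cut_in 0 1 s ltac:(lra)) Hs).
  unfold pdist in H; split.
  - change (Rabs (fst (cur e (cut 0 1 s)) - fst (cur e (cut 0 1 t))) < eps).
    apply Rle_lt_trans with (2 := H); apply Rmax_l.
  - change (Rabs (snd (cur e (cut 0 1 s)) - snd (cur e (cut 0 1 t))) < eps).
    apply Rle_lt_trans with (2 := H); apply Rmax_r.
Qed.

Lemma proper_crossing_arc (cur : nat * nat -> R -> point) (e f : nat * nat) (s t : R) :
  0 < s < 1 -> 0 < t < 1 -> proper_crossing (cur e) (cur f) s t ->
  proper_crossing (arc cur e) (arc cur f) s t.
Proof.
  intros Hs Ht [h [hi [Hh [H0 [eta [Heta [Hg Hf]]]]]]].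
  exists h, hi; split; [exact Hh |]; split; [rewrite arc_in by lra; exact H0 |].
  set (r := Rmin eta (Rmin (Rmin s (1 - s)) (Rmin t (1 - t)))).
  assert (Hr : 0 < r /\ r <= eta /\ r <= s /\ r <= 1 - s /\ r <= t /\ r <= 1 - t).
  { unfold r, Rmin; repeat destruct (Rle_dec _ _); lra. }
  exists r; split; [lra |]; split.
  - intros s' Hs'; assert (Q := Hs'); apply Rabs_def2 in Q; rewrite arc_in by lra; apply Hg; lra.
  - intros t' Ht'; assert (Q := Ht'); apply Rabs_def2 in Q; rewrite arc_in by lra; apply Hf; lra.
Qed.

Section Graph.

Variables (n : nat) (vtx : nat -> point) (E : list (nat * nat)) (cur : nat * nat -> R -> point).
Hypothesis G : simple_topological_graph n vtx E cur.

Local Notation crs := (crossing E cur).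
Local Notation pos := (crossing_time cur).

Lemma crossing_sym (e f : nat * nat) : crs e f -> crs f e.
Proof.
  intros [He [Hf [Hn [s [t [Hs [Ht Est]]]]]]]; repeat split; auto.
  exists t, s; auto.
Qed.

Lemma crossing_time_spec (e f : nat * nat) : crs e f ->
  0 < pos e f < 1 /\ exists t, 0 < t < 1 /\ cur e (pos e f) = cur f t.
Proof.
  intros [_ [_ [_ [s [t [Hs [Ht Est]]]]]]].
  apply (epsilon_spec (inhabits 0)
    (fun s => 0 < s < 1 /\ exists t, 0 < t < 1 /\ cur e s = cur f t)).
  exists s; split; [exact Hs | exists t; auto].
Qed.

Lemma edge_inj (e : nat * nat) (s s' : R) :
  In e E -> 0 <= s <= 1 -> 0 <= s' <= 1 -> cur e s = cur e s' -> s = s'.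
Proof. intros He; apply (proj1 (proj2 (proj2 G)) e He). Qed.

Lemma edge_pcont (e : nat * nat) : In e E -> pcont (arc cur e).
Proof. intros He; apply arc_pcont, (proj1 (proj2 (proj2 G)) e He). Qed.

Lemma common_point_unique (e f : nat * nat) (s1 t1 s2 t2 : R) :
  In e E -> In f E -> e <> f ->
  0 <= s1 <= 1 -> 0 <= t1 <= 1 -> 0 <= s2 <= 1 -> 0 <= t2 <= 1 ->
  cur e s1 = cur f t1 -> cur e s2 = cur f t2 -> s1 = s2 /\ t1 = t2.
Proof.
  intros He Hf Hn H1 H2 H3 H4 E1 E2.
  assert (Q : cur e s1 = cur e s2)
    by (apply (proj1 (proj2 (proj2 (proj2 G))) e f He Hf Hn s1 t1 s2 t2); assumption).
  split; [apply (edge_inj e); assumption |].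
  apply (edge_inj f); try assumption; congruence.
Qed.

Lemma crossing_time_unique (e f : nat * nat) (s t : R) : crs e f ->
  0 <= s <= 1 -> 0 <= t <= 1 -> cur e s = cur f t -> s = pos e f /\ t = pos f e.
Proof.
  intros Hc Hs Ht Est.
  assert (He := proj1 Hc); assert (Hf := proj1 (proj2 Hc)); assert (Hn := proj1 (proj2 (proj2 Hc))).
  destruct (crossing_time_spec e f Hc) as [P1 [t1 [T1 Q1]]].
  destruct (crossing_time_spec f e (crossing_sym e f Hc)) as [P2 [t2 [T2 Q2]]].
  destruct (common_point_unique e f s t (pos e f) t1); auto; try lra.
  destruct (common_point_unique e f s t t2 (pos f e)); auto; try lra.
Qed.

Lemma crossing_time_point (e f : nat * nat) : crs e f -> cur e (pos e f) = cur f (pos f e).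
Proof.
  intros Hc; destruct (crossing_time_spec e f Hc) as [P1 [t1 [T1 Q1]]].
  destruct (crossing_time_unique e f (pos e f) t1 Hc) as [_ <-]; auto; lra.
Qed.

Lemma crossing_time_in (e f : nat * nat) : crs e f -> 0 < pos e f < 1.
Proof. intros Hc; apply (crossing_time_spec e f Hc). Qed.

Lemma meet_crossing (e f : nat * nat) (s t : R) :
  In e E -> In f E -> e <> f -> 0 < s < 1 -> 0 < t < 1 -> cur e s = cur f t ->
  crs e f /\ s = pos e f /\ t = pos f e.
Proof.
  intros He Hf Hn Hs Ht Est.
  assert (Hc : crs e f) by (repeat split; auto; exists s, t; auto).
  split; [exact Hc |]; apply crossing_time_unique; auto; lra.
Qed.

(** Drawings may have several edges through one point; such edges cross each other there. This is
    the only tool for handling ties between crossing times. *)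
Lemma crossing_concurrent (w e f : nat * nat) :
  crs w e -> crs w f -> e <> f -> pos w e = pos w f -> crs e f /\ pos e f = pos e w.
Proof.
  intros He Hf Hn Q.
  assert (Ie := proj1 (proj2 He)); assert (If := proj1 (proj2 Hf)).
  destruct (meet_crossing e f (pos e w) (pos f w)) as [Hc [P1 P2]]; auto.
  - apply crossing_time_in, crossing_sym, He.
  - apply crossing_time_in, crossing_sym, Hf.
  - rewrite <- (crossing_time_point w e), <- (crossing_time_point w f), Q by assumption; reflexivity.
Qed.

(** Two subarcs, none of whose ends lies on the other, meet at most once by simplicity, and then in
    a proper crossing in the interior of both. So [isect_cross] or [isect_disjoint_le] applies. *)
Lemma isect_parity (e f : nat * nat) (a b c d : R) :
  In e E -> In f E -> e <> f -> 0 <= a -> a < b -> b <= 1 -> 0 <= c -> c < d -> d <= 1 ->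
  (forall s, a <= s <= b -> cur e s <> cur f c /\ cur e s <> cur f d) ->
  (forall t, c <= t <= d -> cur f t <> cur e a /\ cur f t <> cur e b) ->
  exists k : Z, isect (arc cur e) a b (arc cur f) c d = 2 * IZR k * PI /\
    (Z.Odd k <-> crs e f /\ a < pos e f < b /\ c < pos f e < d).
Proof.
  intros He Hf Hn Ha Hab Hb Hc Hcd Hd K1 K2.
  destruct (classic (crs e f /\ a < pos e f < b /\ c < pos f e < d)) as [[X [X1 X2]] | X].
  - destruct (isect_cross (arc cur e) (arc cur f) a b c d (pos e f) (pos f e)) as [k [Ko Hk]]; auto.
    + apply edge_pcont; auto.
    + apply edge_pcont; auto.
    + intros s t Hs Ht Q; rewrite !arc_in in Q by lra.
      apply crossing_time_unique; auto; lra.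
    + apply proper_crossing_arc; try (apply crossing_time_in; auto using crossing_sym).
      apply (proj2 (proj2 (proj2 (proj2 G)))); auto using crossing_time_point;
        apply crossing_time_in; auto using crossing_sym.
    + exists k; split; [exact Hk | split; auto].
  - exists 0%Z; split.
    + rewrite isect_disjoint_le; auto using edge_pcont; try lra.
      intros s t Hs Ht Q; rewrite !arc_in in Q by lra; apply X.
      assert (Hs' : a < s < b).
      { split; apply Rnot_le_lt; intros Q'.
        - apply (proj1 (K2 t Ht)); replace a with s by lra; auto.
        - apply (proj2 (K2 t Ht)); replace b with s by lra; auto. }
      assert (Ht' : c < t < d).
      { split; apply Rnot_le_lt; intros Q'.
        - apply (proj1 (K1 s Hs)); replace c with t by lra; auto.
        - apply (proj2 (K1 s Hs)); replace d with t by lra; auto. }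
      destruct (meet_crossing e f s t) as [X0 [-> ->]]; auto; lra.
    + split; [intros [m Hm]; lia | contradiction].
Qed.

(** Closed curves have intersection number 0, by pure algebra: [isect] is a difference of sweeps
    over the ends of each arc, and around the two cycles these differences telescope. *)
Lemma isect_cycles (g1 g2 g3 g4 f1 f2 f3 f4 : R -> R * R)
    (a1 a2 a3 a4 b1 b2 b3 b4 c1 c2 c3 c4 d1 d2 d3 d4 : R) :
  g1 b1 = g2 a2 -> g2 b2 = g3 a3 -> g3 b3 = g4 a4 -> g4 b4 = g1 a1 ->
  f1 d1 = f2 c2 -> f2 d2 = f3 c3 -> f3 d3 = f4 c4 -> f4 d4 = f1 c1 ->
  isect g1 a1 b1 f1 c1 d1 + isect g1 a1 b1 f2 c2 d2 + isect g1 a1 b1 f3 c3 d3 + isect g1 a1 b1 f4 c4 d4 +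
  isect g2 a2 b2 f1 c1 d1 + isect g2 a2 b2 f2 c2 d2 + isect g2 a2 b2 f3 c3 d3 + isect g2 a2 b2 f4 c4 d4 +
  isect g3 a3 b3 f1 c1 d1 + isect g3 a3 b3 f2 c2 d2 + isect g3 a3 b3 f3 c3 d3 + isect g3 a3 b3 f4 c4 d4 +
  isect g4 a4 b4 f1 c1 d1 + isect g4 a4 b4 f2 c2 d2 + isect g4 a4 b4 f3 c3 d3 + isect g4 a4 b4 f4 c4 d4 = 0.
Proof.
  intros P1 P2 P3 P4 Q1 Q2 Q3 Q4; unfold isect; rewrite P1, P2, P3, P4, Q1, Q2, Q3, Q4; ring.
Qed.

Definition inner (w1 w2 w3 w4 e f : nat * nat) : Prop :=
  crs e f /\ pos e w1 < pos e f < pos e w2 /\ pos f w3 < pos f e < pos f w4.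

(** The closed curves follow e from w1 to w2, then w2 to e', e' back to w1 and w1 back to e, and
    likewise for f, f', w3, w4. The last three assumptions rule out all meetings except those of e,
    e' with f, f'. The edges w1, w2 may coincide with w3, w4, in which case the parts used must be
    disjoint. *)
Lemma four_curves_parity (e e' f f' w1 w2 w3 w4 : nat * nat) :
  (forall g, g = e \/ g = e' -> crs g w1 /\ crs g w2 /\ pos g w1 < pos g w2) ->
  (forall g, g = f \/ g = f' -> crs g w3 /\ crs g w4 /\ pos g w3 < pos g w4) ->
  (forall g g', g = e \/ g = e' -> g' = f \/ g' = f' -> g <> g') ->
  (forall g w, g = f \/ g = f' -> w = w1 \/ w = w2 ->
     g <> w /\ (crs w g -> ~ hull (pos w e) (pos w e') (pos w g))) ->
  (forall g w, g = e \/ g = e' -> w = w3 \/ w = w4 ->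
     g <> w /\ (crs w g -> ~ hull (pos w f) (pos w f') (pos w g))) ->
  (forall w v, w = w1 \/ w = w2 -> v = w3 \/ v = w4 ->
     (w = v -> forall x, hull (pos w e) (pos w e') x -> ~ hull (pos w f) (pos w f') x) /\
     (crs w v -> hull (pos w e) (pos w e') (pos w v) -> ~ hull (pos v f) (pos v f') (pos v w))) ->
  exists z1 z2 z3 z4 : Z, (z1 + z2 + z3 + z4 = 0)%Z /\
    (Z.Odd z1 <-> inner w1 w2 w3 w4 e f) /\ (Z.Odd z2 <-> inner w1 w2 w3 w4 e f') /\
    (Z.Odd z3 <-> inner w1 w2 w3 w4 e' f) /\ (Z.Odd z4 <-> inner w1 w2 w3 w4 e' f').
Proof.
  intros He Hf Hef Hfw Hew Hww.
  assert (Iw1 : forall w, w = w1 \/ w = w2 -> In w E).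
  { intros w [-> | ->]; [apply (He e) | apply (He e)]; auto. }
  assert (Iw3 : forall w, w = w3 \/ w = w4 -> In w E).
  { intros w [-> | ->]; [apply (Hf f) | apply (Hf f)]; auto. }
  assert (Ie : forall g, g = e \/ g = e' -> In g E) by (intros g Hg; apply (He g Hg)).
  assert (If : forall g, g = f \/ g = f' -> In g E) by (intros g Hg; apply (Hf g Hg)).
  assert (Pe : forall g w, g = e \/ g = e' -> w = w1 \/ w = w2 ->
     0 < pos g w < 1 /\ 0 < pos w g < 1 /\ cur g (pos g w) = cur w (pos w g)).
  { intros g w Hg Hw; assert (Hc : crs g w) by (destruct Hw as [-> | ->]; apply (He g Hg)).
    repeat split; try (apply crossing_time_in; auto using crossing_sym).
    apply crossing_time_point; auto. }
  assert (Pf : forall g w, g = f \/ g = f' -> w = w3 \/ w = w4 ->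
     0 < pos g w < 1 /\ 0 < pos w g < 1 /\ cur g (pos g w) = cur w (pos w g)).
  { intros g w Hg Hw; assert (Hc : crs g w) by (destruct Hw as [-> | ->]; apply (Hf g Hg)).
    repeat split; try (apply crossing_time_in; auto using crossing_sym).
    apply crossing_time_point; auto. }
  assert (Dfw : forall g w s t, g = f \/ g = f' -> w = w1 \/ w = w2 ->
     hull (pos w e) (pos w e') s -> 0 < t < 1 -> cur w s <> cur g t).
  { intros g w s t Hg Hw Hs Ht Q.
    destruct (Pe e w ltac:(auto) Hw) as [_ [B1 _]]; destruct (Pe e' w ltac:(auto) Hw) as [_ [B2 _]].
    destruct (Hfw g w Hg Hw) as [N1 N2].
    destruct (meet_crossing w g s t) as [X [-> ->]]; auto.
    - unfold hull in Hs; lra.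
    - exact (N2 X Hs). }
  assert (Dew : forall g w s t, g = e \/ g = e' -> w = w3 \/ w = w4 ->
     hull (pos w f) (pos w f') s -> 0 < t < 1 -> cur w s <> cur g t).
  { intros g w s t Hg Hw Hs Ht Q.
    destruct (Pf f w ltac:(auto) Hw) as [_ [B1 _]]; destruct (Pf f' w ltac:(auto) Hw) as [_ [B2 _]].
    destruct (Hew g w Hg Hw) as [N1 N2].
    destruct (meet_crossing w g s t) as [X [-> ->]]; auto.
    - unfold hull in Hs; lra.
    - exact (N2 X Hs). }
  assert (Zww : forall w v, w = w1 \/ w = w2 -> v = w3 \/ v = w4 ->
     isect (arc cur w) (pos w e) (pos w e') (arc cur v) (pos v f) (pos v f') = 0).
  { intros w v Hw Hv.
    destruct (Pe e w ltac:(auto) Hw) as [_ [B1 _]]; destruct (Pe e' w ltac:(auto) Hw) as [_ [B2 _]].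
    destruct (Pf f v ltac:(auto) Hv) as [_ [B3 _]]; destruct (Pf f' v ltac:(auto) Hv) as [_ [B4 _]].
    apply isect_disjoint; auto using edge_pcont.
    intros s t Hs Ht Q.
    assert (Rs : 0 < s < 1) by (unfold hull in Hs; lra).
    assert (Rt : 0 < t < 1) by (unfold hull in Ht; lra).
    rewrite !arc_in in Q by lra.
    destruct (Hww w v Hw Hv) as [N1 N2].
    destruct (classic (w = v)) as [Ewv | Nwv].
    - subst v; assert (s = t) by (apply (edge_inj w); auto; lra).
      subst t; exact (N1 eq_refl s Hs Ht).
    - destruct (meet_crossing w v s t) as [X [-> ->]]; auto.
      exact (N2 X Hs Ht). }
  assert (Zfw : forall g w, g = f \/ g = f' -> w = w1 \/ w = w2 ->
     isect (arc cur w) (pos w e) (pos w e') (arc cur g) (pos g w3) (pos g w4) = 0).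
  { intros g w Hg Hw.
    destruct (Pe e w ltac:(auto) Hw) as [_ [B1 _]]; destruct (Pe e' w ltac:(auto) Hw) as [_ [B2 _]].
    destruct (Pf g w3 Hg ltac:(auto)) as [B3 _]; destruct (Pf g w4 Hg ltac:(auto)) as [B4 _].
    apply isect_disjoint; auto using edge_pcont.
    intros s t Hs Ht.
    assert (Rs : 0 < s < 1) by (unfold hull in Hs; lra).
    assert (Rt : 0 < t < 1) by (unfold hull in Ht; lra).
    rewrite !arc_in by lra; apply Dfw; auto. }
  assert (Zew : forall g w, g = e \/ g = e' -> w = w3 \/ w = w4 ->
     isect (arc cur g) (pos g w1) (pos g w2) (arc cur w) (pos w f) (pos w f') = 0).
  { intros g w Hg Hw.
    destruct (Pf f w ltac:(auto) Hw) as [_ [B1 _]]; destruct (Pf f' w ltac:(auto) Hw) as [_ [B2 _]].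
    destruct (Pe g w1 Hg ltac:(auto)) as [B3 _]; destruct (Pe g w2 Hg ltac:(auto)) as [B4 _].
    apply isect_disjoint; auto using edge_pcont.
    intros t s Ht Hs.
    assert (Rs : 0 < s < 1) by (unfold hull in Hs; lra).
    assert (Rt : 0 < t < 1) by (unfold hull in Ht; lra).
    rewrite !arc_in by lra; intros Q; apply (Dew g w s t); auto. }
  assert (Kef : forall g g', g = e \/ g = e' -> g' = f \/ g' = f' -> exists k : Z,
     isect (arc cur g) (pos g w1) (pos g w2) (arc cur g') (pos g' w3) (pos g' w4) = 2 * IZR k * PI /\
     (Z.Odd k <-> inner w1 w2 w3 w4 g g')).
  { intros g g' Hg Hg'.
    destruct (Pe g w1 Hg ltac:(auto)) as [B1 [_ Q1]]; destruct (Pe g w2 Hg ltac:(auto)) as [B2 [_ Q2]].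
    destruct (Pf g' w3 Hg' ltac:(auto)) as [B3 [_ Q3]];
      destruct (Pf g' w4 Hg' ltac:(auto)) as [B4 [_ Q4]].
    destruct (He g Hg) as [_ [_ O1]]; destruct (Hf g' Hg') as [_ [_ O2]].
    assert (Be : forall w, hull (pos w e) (pos w e') (pos w g)).
    { intros w; unfold hull; destruct Hg as [-> | ->]; lra. }
    assert (Bf : forall w, hull (pos w f) (pos w f') (pos w g')).
    { intros w; unfold hull; destruct Hg' as [-> | ->]; lra. }
    apply isect_parity; auto; try lra.
    - intros s Hs; rewrite Q3, Q4; split; intros Q.
      + apply (Dew g w3 (pos w3 g') s); auto; lra.
      + apply (Dew g w4 (pos w4 g') s); auto; lra.
    - intros s Hs; rewrite Q1, Q2; split; intros Q.
      + apply (Dfw g' w1 (pos w1 g) s); auto; lra.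
      + apply (Dfw g' w2 (pos w2 g) s); auto; lra. }
  destruct (Kef e f ltac:(auto) ltac:(auto)) as [z1 [Z1 O1]].
  destruct (Kef e f' ltac:(auto) ltac:(auto)) as [z2 [Z2 O2]].
  destruct (Kef e' f ltac:(auto) ltac:(auto)) as [z3 [Z3 O3]].
  destruct (Kef e' f' ltac:(auto) ltac:(auto)) as [z4 [Z4 O4]].
  assert (Odd_opp : forall z, Z.Odd z <-> Z.Odd (- z)).
  { intros z; split; intros [m Hm]; [exists (- m - 1)%Z | exists (- m - 1)%Z]; lia. }
  (* The closed curves run through e' and f' backwards, so the pairs (e, f') and (e', f) enter with
     a minus sign, which leaves the parity unchanged. *)
  exists z1, (- z2)%Z, (- z3)%Z, z4; split; [| rewrite <- !Odd_opp; tauto].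
  assert (S := isect_cycles (arc cur e) (arc cur w2) (arc cur e') (arc cur w1)
     (arc cur f) (arc cur w4) (arc cur f') (arc cur w3)
     (pos e w1) (pos w2 e) (pos e' w2) (pos w1 e') (pos e w2) (pos w2 e') (pos e' w1) (pos w1 e)
     (pos f w3) (pos w4 f) (pos f' w4) (pos w3 f') (pos f w4) (pos w4 f') (pos f' w3) (pos w3 f)).
  assert (Arcs : forall g w, (g = e \/ g = e') -> (w = w1 \/ w = w2) ->
     arc cur g (pos g w) = arc cur w (pos w g)).
  { intros g w Hg Hw; destruct (Pe g w Hg Hw) as [B1 [B2 Q]]; rewrite !arc_in by lra; exact Q. }
  assert (Arcs' : forall g w, (g = f \/ g = f') -> (w = w3 \/ w = w4) ->
     arc cur g (pos g w) = arc cur w (pos w g)).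
  { intros g w Hg Hw; destruct (Pf g w Hg Hw) as [B1 [B2 Q]]; rewrite !arc_in by lra; exact Q. }
  specialize (S ltac:(auto) ltac:(symmetry; auto) ltac:(auto) ltac:(symmetry; auto)
                ltac:(auto) ltac:(symmetry; auto) ltac:(auto) ltac:(symmetry; auto)).
  rewrite !(isect_anti_l _ _ (pos w1 e) (pos w1 e')) in S.
  rewrite !(isect_anti_l _ _ (pos e' w1) (pos e' w2)) in S.
  rewrite !(isect_anti_r _ _ _ _ (pos w3 f) (pos w3 f')) in S.
  rewrite !(isect_anti_r _ _ _ _ (pos f' w3) (pos f' w4)) in S.
  rewrite !Zww, !Zew, !Zfw, Z1, Z2, Z3, Z4 in S by auto.
  apply eq_IZR; rewrite !plus_IZR, !opp_IZR; assert (HP := PI_RGT_0); nra.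
Qed.

(** * Crossing parities of vertex-disjoint edges, and of K_{3,3} *)

Definition below (p q : nat) : Z := if (p <? q)%nat then 1%Z else 0%Z.

Definition vertex_disjoint (e f : nat * nat) : Prop :=
  fst e <> fst f /\ fst e <> snd f /\ snd e <> fst f /\ snd e <> snd f.

Lemma vertex_off_edge (e : nat * nat) (v : nat) (s : R) :
  In e E -> (v < n)%nat -> v <> fst e -> v <> snd e -> 0 <= s <= 1 -> cur e s <> vtx v.
Proof.
  intros He Hv N1 N2 Hs Q.
  destruct G as [Hinj [_ [Hedge _]]].
  destruct (Hedge e He) as [L1 [L2 [_ [_ [E0 [E1 Eint]]]]]].
  destruct (Req_dec s 0) as [-> | S0]; [rewrite E0 in Q; apply N1; symmetry; apply Hinj; auto; lia |].
  destruct (Req_dec s 1) as [-> | S1]; [rewrite E1 in Q; apply N2; symmetry; apply Hinj; auto; lia |].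
  apply (Eint s v); auto; lra.
Qed.

Lemma disjoint_or_crossing (e f : nat * nat) :
  In e E -> In f E -> vertex_disjoint e f -> ~ crs e f -> edges_disjoint cur e f.
Proof.
  intros He Hf [N1 [N2 [N3 N4]]] Hc s t Hs Ht Q.
  destruct (proj1 (proj2 (proj2 G)) e He) as [Le [Le' [_ [_ [E0 [E1 _]]]]]].
  destruct (proj1 (proj2 (proj2 G)) f Hf) as [Lf [Lf' [_ [_ [F0 [F1 _]]]]]].
  assert (Hn : e <> f) by (intros ->; apply N1; reflexivity).
  destruct (Req_dec s 0) as [-> | S0].
  { rewrite E0 in Q; apply (vertex_off_edge f (fst e) t); auto; lia. }
  destruct (Req_dec s 1) as [-> | S1].
  { rewrite E1 in Q; apply (vertex_off_edge f (snd e) t); auto; lia. }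
  destruct (Req_dec t 0) as [-> | T0].
  { rewrite F0 in Q; apply (vertex_off_edge e (fst f) s); auto; lia. }
  destruct (Req_dec t 1) as [-> | T1].
  { rewrite F1 in Q; apply (vertex_off_edge e (snd f) s); auto; lia. }
  apply Hc, (meet_crossing e f s t); auto; lra.
Qed.

(* [w e v] counts full turns of [e] around [v], relative to fixed arguments of the vectors between
   vertices; reversing such a vector changes its argument by [PI], whence the terms [below]. *)
Lemma crossing_parity : exists w : nat * nat -> nat -> Z, forall e f,
  In e E -> In f E -> vertex_disjoint e f ->
  (crs e f <-> Z.Odd (w e (fst f) + w e (snd f) + w f (fst e) + w f (snd e)
     + below (fst f) (fst e) + below (fst f) (snd e) + below (snd f) (fst e) + below (snd f) (snd e))).
Proof.
  set (ang0 := fun p : R * R => epsilon (inhabits 0) (fun th => dir p th)).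
  assert (Hang0 : forall p, p <> (0, 0) -> dir p (ang0 p)).
  { intros p Hp; apply (epsilon_spec (inhabits 0) (fun th => dir p th)); apply dir_exists; auto. }
  set (A := fun v u => if (v <? u)%nat then ang0 (vsub (vtx v) (vtx u)) + PI
                       else ang0 (vsub (vtx u) (vtx v))).
  assert (Hinj := proj1 G).
  assert (HA : forall v u, (v < n)%nat -> (u < n)%nat -> v <> u -> dir (vsub (vtx u) (vtx v)) (A v u)).
  { intros v u Hv Hu Hn; unfold A.
    assert (N1 : vsub (vtx u) (vtx v) <> (0, 0)) by (apply vsub_nonzero; intros Q; apply Hn; auto).
    assert (N2 : vsub (vtx v) (vtx u) <> (0, 0)) by (apply vsub_nonzero; intros Q; apply Hn; auto).
    destruct (v <? u)%nat; [| auto].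
    assert (Q := dir_opp _ _ (Hang0 _ N2)).
    replace (- fst (vsub (vtx v) (vtx u)), - snd (vsub (vtx v) (vtx u)))
      with (vsub (vtx u) (vtx v)) in Q by (unfold vsub; simpl; f_equal; ring).
    exact Q. }
  assert (AA : forall v u, v <> u -> A v u - A u v = (2 * IZR (below v u) - 1) * PI).
  { intros v u Hn; unfold A, below.
    destruct (Nat.ltb_spec v u), (Nat.ltb_spec u v); try lia; simpl; lra. }
  set (w := fun e v => epsilon (inhabits 0%Z) (fun k =>
     sweep (arc cur e) 0 1 (vtx v) = A v (snd e) - A v (fst e) + 2 * IZR k * PI)).
  assert (Hw : forall e v, In e E -> (v < n)%nat -> v <> fst e -> v <> snd e ->
     sweep (arc cur e) 0 1 (vtx v) = A v (snd e) - A v (fst e) + 2 * IZR (w e v) * PI).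
  { intros e v He Hv N1 N2; unfold w; apply epsilon_spec.
    destruct (proj1 (proj2 (proj2 G)) e He) as [L1 [L2 [_ [_ [E0 [E1 _]]]]]].
    assert (NV : nonvanishing (fun s => vsub (arc cur e s) (vtx v)) 0 1).
    { apply nonvanishing_vsub; [apply edge_pcont; auto |].
      intros s Hs; rewrite arc_in by lra; apply vertex_off_edge; auto. }
    unfold sweep; rewrite signed_change_le by (auto; lra).
    apply angle_change_dir; [lra | exact NV | |]; rewrite arc_in by lra.
    - rewrite E0; apply HA; auto; lia.
    - rewrite E1; apply HA; auto. }
  exists w; intros e f He Hf Hd; assert (Hd' := Hd); destruct Hd' as [N1 [N2 [N3 N4]]].
  assert (Hn : e <> f) by (intros ->; apply N1; reflexivity).
  destruct (proj1 (proj2 (proj2 G)) e He) as [Le [Le' [_ [_ [E0 [E1 _]]]]]].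
  destruct (proj1 (proj2 (proj2 G)) f Hf) as [Lf [Lf' [_ [_ [F0 [F1 _]]]]]].
  destruct (isect_parity e f 0 1 0 1) as [k [Hk Ok]]; auto; try lra.
  { intros s Hs; rewrite F0, F1; split; apply vertex_off_edge; auto; lia. }
  { intros s Hs; rewrite E0, E1; split; apply vertex_off_edge; auto; lia. }
  assert (Ok' : crs e f <-> Z.Odd k).
  { rewrite Ok; split; [intros Hc | tauto].
    split; [exact Hc |]; split; apply crossing_time_in; auto using crossing_sym. }
  rewrite Ok'.
  unfold isect in Hk; rewrite !arc_in in Hk by lra; rewrite E0, E1, F0, F1 in Hk.
  rewrite !Hw in Hk by (auto; lia).
  assert (B1 := AA (fst f) (snd e) ltac:(auto)); assert (B2 := AA (fst f) (fst e) ltac:(auto)).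
  assert (B3 := AA (snd f) (snd e) ltac:(auto)); assert (B4 := AA (snd f) (fst e) ltac:(auto)).
  (* The differences of opposite arguments occur twice with each sign, so the half turns -PI in [AA]
     cancel and division by 2 PI leaves an integer identity. *)
  assert (Ek : k = (w e (fst f) - w e (snd f) + w f (snd e) - w f (fst e) + below (fst f) (snd e)
     - below (fst f) (fst e) - below (snd f) (snd e) + below (snd f) (fst e))%Z).
  { apply eq_IZR; repeat rewrite ?plus_IZR, ?minus_IZR.
    assert (HP := PI_RGT_0); apply Rmult_eq_reg_r with (2 * PI); [lra | lra]. }
  rewrite Ek; split; intros [m Hm].
  - exists (m + w e (snd f) + w f (fst e) + below (fst f) (fst e) + below (snd f) (snd e))%Z; lia.
  - exists (m - w e (snd f) - w f (fst e) - below (fst f) (fst e) - below (snd f) (snd e))%Z; lia.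
Qed.

End Graph.

Local Open Scope nat_scope.

(* The crossing parities of the 18 pairs of independent edges of K_{3,3}, written as in
   [crossing_parity], sum to 1, while the products on the left sum to 0. *)
Lemma K33_odd (ca cb : nat -> bool) (wa wb : nat -> nat -> nat -> bool)
    (laa lab lba lbb : nat -> nat -> bool) :
  (forall i j k l, i < 3 -> j < 3 -> k < 3 -> l < 3 -> i <> k -> j <> l ->
     andb (xorb (ca i) (cb j)) (xorb (ca k) (cb l)) =
     xorb (wa i j k) (xorb (wb i j l) (xorb (wa k l i) (xorb (wb k l j)
       (xorb (laa k i) (xorb (lab k j) (xorb (lba l i) (lbb l j)))))))) ->
  (forall j l, j < 3 -> l < 3 -> j <> l -> lbb l j = negb (lbb j l)) -> False.
Proof.
  intros H A.
  set (L := fun i j k l => andb (xorb (ca i) (cb j)) (xorb (ca k) (cb l))).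
  set (M := fun i j k l => xorb (wa i j k) (xorb (wb i j l) (xorb (wa k l i) (xorb (wb k l j)
       (xorb (laa k i) (xorb (lab k j) (xorb (lba l i) (lbb l j)))))))).
  assert (HL : forall i j k l, i < 3 -> j < 3 -> k < 3 -> l < 3 -> i <> k -> j <> l ->
     L i j k l = M i j k l) by exact H.
  (* All ordered pairs of distinct j, l; with the three pairs i < k they make up the 18 pairs of
     independent edges. *)
  set (six := fun (F : nat -> nat -> nat -> nat -> bool) i k =>
     xorb (F i 0 k 1) (xorb (F i 0 k 2) (xorb (F i 1 k 0) (xorb (F i 1 k 2)
       (xorb (F i 2 k 0) (F i 2 k 1)))))).
  assert (E : xorb (six L 0 1) (xorb (six L 0 2) (six L 1 2)) =
              xorb (six M 0 1) (xorb (six M 0 2) (six M 1 2))).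
  { unfold six; rewrite !HL by auto; reflexivity. }
  assert (EL : xorb (six L 0 1) (xorb (six L 0 2) (six L 1 2)) = false).
  { unfold six, L; ring. }
  (* For fixed j and l, [lbb l j] occurs once for each of the three pairs i < k. Every other term
     occurs an even number of times: a [wa] or [wb] term, for instance, once for each of two choices
     of the remaining index. *)
  assert (EM : xorb (six M 0 1) (xorb (six M 0 2) (six M 1 2)) =
     xorb (xorb (lbb 1 0) (lbb 0 1)) (xorb (xorb (lbb 2 0) (lbb 0 2)) (xorb (lbb 2 1) (lbb 1 2)))).
  { unfold six, M; ring. }
  rewrite EL, EM, (A 0 1), (A 0 2), (A 1 2) in E by auto.
  destruct (lbb 0 1), (lbb 0 2), (lbb 1 2); discriminate E.
Qed.

Local Close Scope nat_scope.

Module Expanders.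

Import structures all_boot all_order all_algebra zify mathcomp.algebra_tactics.ring mathcomp.algebra_tactics.lra.
Set Implicit Arguments.
Unset Strict Implicit.
Unset Printing Implicit Defensive.
Import Order.TTheory GRing.Theory Num.Theory.
Local Open Scope nat_scope.

(** * Poincare inequality and mixing of the lazy random walk *)

Local Open Scope ring_scope.

Section RandomWalk.

Variables (R : realFieldType) (V I : finType) (src dst : I -> V).

Definition dart := (I * bool)%type.
Definition tail (d : dart) : V := if d.2 then dst d.1 else src d.1.
Definition head (d : dart) : V := if d.2 then src d.1 else dst d.1.
Definition rev_dart (d : dart) : dart := (d.1, ~~ d.2).

Lemma rev_dartK : involutive rev_dart.
Proof. by case=> e b; rewrite /rev_dart /= negbK. Qed.

Lemma tail_rev d : tail (rev_dart d) = head d.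
Proof. by case: d => e []. Qed.

Lemma head_rev d : head (rev_dart d) = tail d.
Proof. by case: d => e []. Qed.

Lemma sum_rev (F : dart -> R) : \sum_d F (rev_dart d) = \sum_d F d.
Proof. by rewrite [RHS](reindex_inj (inv_inj rev_dartK)). Qed.

Definition deg (x : V) : nat := #|[set d | tail d == x]|.

Lemma deg_tail d : (0 < deg (tail d))%N.
Proof. by apply/card_gt0P; exists d; rewrite inE. Qed.

Lemma deg_head d : (0 < deg (head d))%N.
Proof. by rewrite -tail_rev deg_tail. Qed.

Lemma natdeg_neq0 x : (0 < deg x)%N -> (deg x)%:R != 0 :> R.
Proof. by move=> h; rewrite pnatr_eq0 -lt0n. Qed.

Lemma sum_deg x (c : R) : \sum_(d | tail d == x) c = (deg x)%:R * c.
Proof. by rewrite sumr_const mulr_natl /deg cardsE. Qed.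

Definition avg (f : V -> R) (x : V) : R := (\sum_(d | tail d == x) f (head d)) / (deg x)%:R.

Lemma sum_avg (g f : V -> R) :
  \sum_d g (tail d) * avg f (tail d) = \sum_d g (tail d) * f (head d).
Proof.
under eq_bigr => d _ do rewrite /avg mulrA mulrAC big_distrr /=.
rewrite (exchange_big_dep xpredT) //=; apply: eq_bigr => d _.
rewrite (eq_bigl (fun d' => tail d' == tail d)); last by move=> d'; rewrite eq_sym.
under eq_bigr => d' /eqP -> do idtac.
by rewrite sum_deg; field; exact/natdeg_neq0/deg_tail.
Qed.

(** Summing over darts weighs each vertex by its degree: this is the inner product of the stationary
    measure, in which the walk is self-adjoint. *)
Definition dotp (f g : V -> R) : R := \sum_d f (tail d) * g (tail d).
Definition sqn (f : V -> R) : R := dotp f f.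

Lemma sum_head_tail (F : V -> R) : \sum_d F (head d) = \sum_d F (tail d).
Proof. by rewrite -[LHS]sum_rev; apply: eq_bigr => d _; rewrite head_rev. Qed.

Lemma sqn_avg f : sqn (avg f) <= sqn f.
Proof.
have E : sqn (avg f) = \sum_d avg f (tail d) * f (head d) by exact: sum_avg.
have H : sqn (avg f) <= \sum_d (avg f (tail d) * avg f (tail d) + f (head d) * f (head d)) / 2.
  rewrite E; apply: ler_sum => d _.
  have := sqr_ge0 (avg f (tail d) - f (head d)); nra.
move: H; rewrite -big_distrl big_split /= (sum_head_tail (fun x => f x * f x)).
rewrite -/(dotp _ _) -/(sqn _) -/(dotp _ _) -/(sqn _); lra.
Qed.

Definition lazy_avg (f : V -> R) (x : V) : R := (f x + avg f x) / 2.

Definition energy (f : V -> R) : R := \sum_d (f (tail d) - f (head d)) ^+ 2.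

Lemma dotp_avg f g : dotp g (avg f) = dotp (avg g) f.
Proof.
rewrite /dotp sum_avg -sum_rev.
under eq_bigr => d _ do rewrite tail_rev head_rev mulrC.
by rewrite -sum_avg; apply: eq_bigr => d _; rewrite mulrC.
Qed.

Lemma dotp_lazy f g : dotp g (lazy_avg f) = dotp (lazy_avg g) f.
Proof.
have E1 : dotp g (lazy_avg f) = (dotp g f + dotp g (avg f)) / 2.
  by rewrite /dotp -big_split /= big_distrl /=; apply: eq_bigr => d _; rewrite /lazy_avg; ring.
have E2 : dotp (lazy_avg g) f = (dotp g f + dotp (avg g) f) / 2.
  by rewrite /dotp -big_split /= big_distrl /=; apply: eq_bigr => d _; rewrite /lazy_avg; ring.
by rewrite E1 E2 dotp_avg.
Qed.

Lemma dotp_iter n f g : dotp g (iter n lazy_avg f) = dotp (iter n lazy_avg g) f.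
Proof. by elim: n f g => // n IH f g; rewrite iterS dotp_lazy IH -iterSr. Qed.

(** Expand the square, bound |avg f| by |f|, and use energy f = 2 |f|^2 - 2 <f, avg f>. Laziness
    removes the need for a separate argument about eigenvalues near -1. *)
Lemma sqn_lazy f : sqn (lazy_avg f) <= sqn f - energy f / 4.
Proof.
have E1 : sqn (lazy_avg f) = (sqn f + 2 * dotp f (avg f) + sqn (avg f)) / 4.
  rewrite /sqn /dotp big_distrr /= -!big_split /= big_distrl /=.
  by apply: eq_bigr => d _; rewrite /lazy_avg; field.
have E2 : energy f = 2 * sqn f - 2 * dotp f (avg f).
  rewrite /energy.
  have -> : \sum_d (f (tail d) - f (head d)) ^+ 2 = \sum_d (f (tail d) * f (tail d)
     + f (head d) * f (head d) - 2 * (f (tail d) * f (head d))).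
    by apply: eq_bigr => d _; ring.
  rewrite !big_split /= (sum_head_tail (fun x => f x * f x)) sumrN -big_distrr /=.
  rewrite /dotp sum_avg -/(dotp f f) -/(sqn f); ring.
have := sqn_avg f; rewrite E1 E2; lra.
Qed.

Definition vol (S : {set V}) : nat := #|[set d | tail d \in S]|.
Definition boundary (S : {set V}) : nat := #|[set d | (tail d \in S) && (head d \notin S)]|.

Variable K : nat.
Hypothesis K_gt0 : (0 < K)%N.
Hypothesis conductance : forall S : {set V}, (2 * vol S <= #|{: dart}|)%N -> (vol S <= K * boundary S)%N.

Let pp (x : R) := Num.max x 0.

Lemma sum_ind (P : pred dart) : \sum_d (P d)%:R = #|[set d | P d]|%:R :> R.
Proof. by rewrite -sum1dep_card natr_sum [RHS]big_mkcond /=; apply: eq_bigr => d _; case: (P d). Qed.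

Lemma vol_mono (A B : {set V}) : A \subset B -> (vol A <= vol B)%N.
Proof. by move=> /subsetP AB; apply/subset_leq_card/subsetP => d; rewrite !inE; exact: AB. Qed.

(** Induction on the support: subtracting the least positive value c from h on its support S lowers
    the two sums by c vol(S) and c boundary(S), which the conductance of S compares. *)
Lemma coarea (h : V -> R) : (forall x, 0 <= h x) ->
  (2 * vol [set x | (0 < h x)%R] <= #|{: dart}|)%N ->
  \sum_d h (tail d) <= K%:R * \sum_d pp (h (tail d) - h (head d)).
Proof.
have [n] := ubnP #|[set x | 0 < h x]|; elim: n h => // n IH h.
set S := [set x | 0 < h x] => /ltnSE leSn h0 volS.
have notS x : x \notin S -> h x = 0.
  by rewrite inE => ?; apply/eqP; rewrite eq_le h0 andbT leNgt.
have [S0 | /set0Pn [x0 x0S]] := eqVneq S set0.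
  have hz x : h x = 0 by apply: notS; rewrite S0 in_set0.
  rewrite big1 => [|d _]; last exact: hz.
  by rewrite mulr_ge0 ?ler0n //; apply: sumr_ge0 => d _; rewrite /pp le_max lexx orbT.
have [x1 x1S x1min] := @arg_minP _ _ _ x0 [in S] h x0S.
have {}x1S : x1 \in S := x1S.
set c := h x1; have c0 : 0 < c by move: x1S; rewrite inE.
pose h' x := if x \in S then h x - c else 0.
have h'0 x : 0 <= h' x by rewrite /h'; case: ifP => // xS; rewrite subr_ge0 x1min.
have subS' : [set x | 0 < h' x] \subset S :\ x1.
  apply/subsetP => x; rewrite !inE /h'; case: ifP => [xS | _]; last by rewrite ltxx.
  rewrite inE in xS; rewrite xS andbT; case: eqP => // ->; by rewrite subrr ltxx.
have {}IH := IH h' _ h'0 _.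
have /IH {}IH : (#|[set x | (0 < h' x)%R]| < n)%N.
  apply: leq_ltn_trans (subset_leq_card subS') _.
  by move: leSn; rewrite (cardsD1 x1 S) x1S add1n.
have /IH {}IH : (2 * vol [set x | (0 < h' x)%R] <= #|{: dart}|)%N.
  apply: leq_trans volS; rewrite leq_mul2l /= vol_mono //.
  by apply: subset_trans subS' _; exact: subsetDl.
have hE x : h x = h' x + c * (x \in S)%:R.
  by rewrite /h'; case: ifPn => [_|/notS ->]; rewrite ?mulr1 ?mulr0 ?addr0 ?subrK.
have ppE d : pp (h (tail d) - h (head d)) =
    pp (h' (tail d) - h' (head d)) + c * ((tail d \in S) && (head d \notin S))%:R.
  rewrite !hE; have := h'0 (tail d); have := h'0 (head d).
  rewrite /h' /pp; case: (boolP (tail d \in S)) => tS; case: (boolP (head d \in S)) => hS /=;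
    rewrite ?mulr1 ?mulr0 ?addr0 ?subr0 ?sub0r ?addrK ?subrK.
  - by move=> _ _; congr (Num.max _ _); ring.
  - by move=> _ A; rewrite !max_l //; lra.
  - by move=> A _; rewrite !max_r //; lra.
  - by [].
have sumE : \sum_d h (tail d) = \sum_d h' (tail d) + c * (vol S)%:R.
  under eq_bigr => d _ do rewrite hE.
  by rewrite big_split /= -big_distrr /= sum_ind.
have sumE' : \sum_d pp (h (tail d) - h (head d)) =
    \sum_d pp (h' (tail d) - h' (head d)) + c * (boundary S)%:R.
  under eq_bigr => d _ do rewrite ppE.
  by rewrite big_split /= -big_distrr /= sum_ind.
have := conductance volS; rewrite -(ler_nat R) natrM => H.
rewrite sumE sumE'; nra.
Qed.

(** Apply [coarea] to g^2 and estimate x^2 - y^2 <= 2 K (x - y)^2 + (x^2 + y^2) / (4 K). After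
    multiplication by K the last term sums to half of sqn g and is absorbed on the left. *)
Lemma cheeger_pos (g : V -> R) : (forall x, 0 <= g x) ->
  (2 * vol [set x | (0 < g x)%R] <= #|{: dart}|)%N ->
  sqn g <= 4 * K%:R ^+ 2 * energy g.
Proof.
move=> g0 volg.
have k0 : 0 < K%:R :> R by rewrite ltr0n.
have H : sqn g <= K%:R * \sum_d pp (g (tail d) * g (tail d) - g (head d) * g (head d)).
  apply: (@coarea (fun x => g x * g x)); first by move=> x; rewrite mulr_ge0.
  apply: leq_trans volg; rewrite leq_mul2l /= vol_mono //; apply/subsetP => x; rewrite !inE.
  by move=> gg; rewrite lt_def g0 andbT; apply: contraTneq gg => ->; rewrite mul0r ltxx.
have H2 : \sum_d pp (g (tail d) * g (tail d) - g (head d) * g (head d)) <=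
   \sum_d (2 * K%:R * (g (tail d) - g (head d)) ^+ 2
     + (4 * K%:R)^-1 * (g (tail d) * g (tail d) + g (head d) * g (head d))).
  apply: ler_sum => d _; set x := g (tail d); set y := g (head d).
  have kK : K%:R * (K%:R)^-1 = 1 :> R by rewrite divff // gt_eqF.
  have ki : 0 < (K%:R)^-1 :> R by rewrite invr_gt0.
  have x0 : 0 <= x := g0 _; have y0 : 0 <= y := g0 _.
  rewrite invfM; set k := K%:R in kK k0 ki *; set i := k^-1 in kK ki *.
  rewrite /pp ge_max; apply/andP; split; last first.
    have P1 : 0 <= 2 * k * (x - y) ^+ 2 by apply: mulr_ge0 (sqr_ge0 _); lra.
    have P2 : 0 <= i * (x * x + y * y) by apply: mulr_ge0; [exact: ltW | apply: addr_ge0; exact: mulr_ge0].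
    by rewrite -mulrA; lra.
  have A : 0 <= i * (4 * k * (x - y) - (x + y)) ^+ 2 by rewrite mulr_ge0 ?sqr_ge0 // ltW.
  have B : i * (4 * k * (x - y) - (x + y)) ^+ 2 =
     16 * k * (k * i) * (x - y) ^+ 2 - 8 * (k * i) * (x - y) * (x + y) + i * (x + y) ^+ 2 by ring.
  rewrite B kK in A.
  have C : 0 <= i * (x - y) ^+ 2 by rewrite mulr_ge0 ?sqr_ge0 // ltW.
  have -> : 4^-1 * i * (x * x + y * y) = i * (x + y) ^+ 2 / 8 + i * (x - y) ^+ 2 / 8 by field.
  nra.
move: H2; rewrite big_split /= -!big_distrr /= -/(energy g) big_split /=.
rewrite (sum_head_tail (fun x => g x * g x)) -/(dotp g g) -/(sqn g) => H2.
have H3 : sqn g <= K%:R * (2 * K%:R * energy g + (4 * K%:R)^-1 * (sqn g + sqn g)).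
  by apply: le_trans H _; rewrite ler_pM2l.
have E : K%:R * (2 * K%:R * energy g + (4 * K%:R)^-1 * (sqn g + sqn g)) =
   2 * K%:R ^+ 2 * energy g + sqn g / 2 by field; rewrite gt_eqF.
rewrite E in H3; lra.
Qed.

(** Take the least value above which at most half of the volume lies. The next smaller value y fails
    this condition, so more than half of the volume lies above y and less than half at or below
    it. *)
Lemma median (f : V -> R) : #|V| != 0 ->
  exists c, (2 * vol [set x | c < f x]%R <= #|{: dart}|)%N /\
            (2 * vol [set x | f x < c]%R <= #|{: dart}|)%N.
Proof.
rewrite -lt0n => /card_gt0P [v0 _].
have [M _ Mmax] := arg_maxP f (erefl : xpredT v0).
have PM : (2 * vol [set x | f M < f x]%R <= #|{: dart}|)%N.
  suff -> : [set x | f M < f x]%R = set0.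
    by rewrite /vol (_ : [set d | _] = set0) ?cards0 //; apply/setP => d; rewrite !inE.
  by apply/setP => x; rewrite !inE ltNge; apply/negbTE; rewrite negbK; exact: Mmax.
have [x Px xmin] := arg_minP (P := fun x => 2 * vol [set y | f x < f y]%R <= #|{: dart}|)%N f PM.
exists (f x); split => //.
have [A0 | /set0Pn [y0 y0A]] := eqVneq [set y | f y < f x]%R set0.
  by rewrite A0 /vol (_ : [set d | _] = set0) ?cards0 //; apply/setP => d; rewrite !inE.
have [y yA ymax] := @arg_maxP _ _ _ y0 [in [set y | f y < f x]%R] f y0A.
have {}yA : y \in [set y | f y < f x]%R := yA.
have nPy : ~~ (2 * vol [set z | f y < f z]%R <= #|{: dart}|)%N.
  by apply: contraTN yA => /xmin; rewrite inE -leNgt.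
have volC : (vol [set y | f y < f x]%R + vol [set z | f y < f z]%R <= #|{: dart}|)%N.
  rewrite /vol -cardsUI (_ : _ :&: _ = set0) ?cards0 ?addn0 ?max_card //.
  apply/setP => d; rewrite !inE; apply/negP => /andP [A].
  by rewrite ltNge => /negP; apply; apply: ymax; rewrite inE.
lia.
Qed.

(** [cheeger_pos] is applied to the positive and negative parts of f - c with c a median, each
    supported on at most half of the volume. As f has mean 0, the shift by c does not decrease the
    norm. *)
Lemma poincare (f : V -> R) : \sum_d f (tail d) = 0 -> sqn f <= 4 * K%:R ^+ 2 * energy f.
Proof.
move=> f0; have [V0 | Vn0] := eqVneq #|V| 0%N.
  have noD (d : dart) : False by have := fintype0 (tail d) V0.
  by rewrite /sqn /dotp /energy !big1 ?mulr0 // => d _; case: (noD d).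
have [c [c1 c2]] := median f Vn0.
pose g x := pp (f x - c); pose g' x := pp (c - f x).
have g0 x : 0 <= g x by rewrite le_max lexx orbT.
have g'0 x : 0 <= g' x by rewrite le_max lexx orbT.
have G : sqn g <= 4 * K%:R ^+ 2 * energy g.
  apply: cheeger_pos => //; rewrite (_ : [set x | _] = [set x | c < f x]%R) //.
  by apply/setP => x; rewrite !inE lt_max ltxx orbF subr_gt0.
have G' : sqn g' <= 4 * K%:R ^+ 2 * energy g'.
  apply: cheeger_pos => //; rewrite (_ : [set x | _] = [set x | f x < c]%R) //.
  by apply/setP => x; rewrite !inE lt_max ltxx orbF subr_gt0.
have En : energy g + energy g' <= energy f.
  rewrite -big_split /=; apply: ler_sum => d _; rewrite /g /g' /pp.
  by case: (leP (f (tail d) - c) 0); case: (leP (c - f (tail d)) 0);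
    case: (leP (f (head d) - c) 0); case: (leP (c - f (head d)) 0) => *; nra.
have Sq : sqn f <= sqn g + sqn g'.
  have -> : sqn g + sqn g' = \sum_d (f (tail d) - c) ^+ 2.
    rewrite -big_split /=; apply: eq_bigr => d _; rewrite /g /g' /pp.
    by case: (leP (f (tail d) - c) 0); case: (leP (c - f (tail d)) 0) => *; nra.
  have -> : \sum_d (f (tail d) - c) ^+ 2 =
     sqn f - 2 * c * (\sum_d f (tail d)) + \sum_(d : dart) c ^+ 2.
    rewrite /sqn /dotp big_distrr -sumrB -big_split /=.
    by apply: eq_bigr => d _; ring.
  rewrite f0 mulr0 subr0 lerDl; apply: sumr_ge0 => d _; exact: sqr_ge0.
have : 0 <= 4 * K%:R ^+ 2 :> R by rewrite mulr_ge0 ?sqr_ge0.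
move: (energy g) (energy g') (energy f) (sqn g) (sqn g') (sqn f) G G' En Sq.
move=> e1 e2 e3 s1 s2 s3; nra.
Qed.

End RandomWalk.

Lemma sum_product_measure (R : realFieldType) (J T : finType) (mu : J -> T -> R) :
  (forall j, \sum_t mu j t = 1) -> \sum_(x : {ffun J -> T}) \prod_j mu j (x j) = 1.
Proof. by move=> mu1; rewrite -bigA_distr_bigA big1. Qed.

Lemma product_marginal (R : realFieldType) (J T : finType) (mu : J -> T -> R) (i j : J)
    (H : T -> T -> R) : (forall j, \sum_t mu j t = 1) -> i != j ->
  \sum_(x : {ffun J -> T}) (\prod_k mu k (x k)) * H (x i) (x j) =
  \sum_s \sum_t mu i s * mu j t * H s t.
Proof.
move=> mu1 ij.
(* Indicators of x i = s and x j = t are put into the factors i and j, so that for fixed s and t the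
   sum is again a product over all coordinates. *)
pose nu s t k u := mu k u * ((k == i) ==> (u == s))%:R * ((k == j) ==> (u == t))%:R.
have E (x : {ffun J -> T}) : (\prod_k mu k (x k)) * H (x i) (x j) =
   \sum_s \sum_t (\prod_k nu s t k (x k)) * H s t.
  rewrite (bigD1 (x i)) //= [X in _ + X]big1 ?addr0; last first.
    move=> s si; rewrite big1 // => t _.
    by rewrite (bigD1 i) //= /nu eqxx /= [x i == s]eq_sym (negPf si) mulr0 !mul0r.
  rewrite (bigD1 (x j)) //= [X in _ + X]big1 ?addr0; last first.
    move=> t tj.
    by rewrite (bigD1 j) //= /nu eqxx /= [x j == t]eq_sym (negPf tj) mulr0 !mul0r.
  congr (_ * _); apply: eq_bigr => k _; rewrite /nu.
  have -> : (k == i) ==> (x k == x i) by apply/implyP => /eqP ->.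
  have -> : (k == j) ==> (x k == x j) by apply/implyP => /eqP ->.
  by rewrite !mulr1.
under eq_bigr => x _ do rewrite E.
rewrite exchange_big /=; apply: eq_bigr => s _.
rewrite exchange_big /=; apply: eq_bigr => t _.
rewrite -big_distrl /= -bigA_distr_bigA; congr (_ * _).
rewrite (bigD1 i) //= (bigD1 j) //=; last by rewrite eq_sym.
rewrite [X in _ * (_ * X)]big1 ?mulr1; last first.
  move=> k /andP [ki kj]; rewrite /nu (negPf ki) (negPf kj) /=.
  by under eq_bigr => u _ do rewrite !mulr1; exact: mu1.
congr (_ * _).
- rewrite /nu (bigD1 s) //= big1 ?addr0 => [|u us].
    by rewrite !eqxx (negPf ij) /= !mulr1.
  by rewrite eqxx (negPf us) /= mulr0 mul0r.
- rewrite /nu (bigD1 t) //= big1 ?addr0 => [|u ut].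
    by rewrite !eqxx [j == i]eq_sym (negPf ij) /= !mulr1.
  by rewrite eqxx (negPf ut) /= mulr0.
Qed.

Section Mixing.

Variables (R : realFieldType) (V I : finType) (src dst : I -> V).
Variable K : nat.
Hypothesis K_gt0 : (0 < K)%N.
Hypothesis conductance : forall S : {set V},
  (2 * vol src dst S <= #|{: dart I}|)%N -> (vol src dst S <= K * boundary src dst S)%N.

Local Notation tl := (tail src dst).
Local Notation hd := (head src dst).
Local Notation deg := (deg src dst).
Local Notation dotp := (@dotp R V I src dst).
Local Notation sqn := (@sqn R V I src dst).
Local Notation avg := (@avg R V I src dst).
Local Notation lazy_avg := (@lazy_avg R V I src dst).

Definition delta (b x : V) : R := (x == b)%:R.

Lemma avg_subc f c x : (0 < deg x)%N -> avg (fun y => f y - c) x = avg f x - c.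
Proof.
move=> x0; rewrite /avg sumrB sum_deg.
by field; exact: natdeg_neq0.
Qed.

Lemma iter_lazy_subc n f c x : (0 < deg x)%N ->
  iter n lazy_avg (fun y => f y - c) x = iter n lazy_avg f x - c.
Proof.
elim: n x => // n IH x x0; rewrite !iterS /lazy_avg IH //.
have -> : avg (iter n lazy_avg (fun y => f y - c)) x = avg (fun y => iter n lazy_avg f y - c) x.
  rewrite /avg; congr (_ / _); apply: eq_bigr => d _; apply: IH; exact: deg_head.
by rewrite avg_subc //; field.
Qed.

Lemma sum_lazy f : \sum_d lazy_avg f (tl d) = \sum_d f (tl d).
Proof.
rewrite /lazy_avg -big_distrl big_split /=.
have -> : \sum_d avg f (tl d) = \sum_d f (tl d).
  rewrite -[RHS](sum_head_tail src dst f).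
  have := sum_avg src dst (fun=> 1) f.
  by under eq_bigr do rewrite mul1r; move=> ->; under eq_bigr do rewrite mul1r.
by field.
Qed.

Lemma sum_iter_lazy n f : \sum_d iter n lazy_avg f (tl d) = \sum_d f (tl d).
Proof. by elim: n => // n IH; rewrite iterS sum_lazy. Qed.

(** [poincare] loses a factor 4 K^2, and [sqn_lazy] gains a quarter of the energy. *)
Definition decay : R := 1 - (16 * K%:R ^+ 2)^-1.

Lemma decay_ge0 : 0 <= decay.
Proof.
rewrite subr_ge0 invf_le1 ?mulr_gt0 ?exprn_gt0 ?ltr0n // -natrX -natrM.
by rewrite -[1]/(1%:R) ler_nat muln_gt0 expn_gt0 K_gt0.
Qed.

Lemma sqn_decay n f : \sum_d f (tl d) = 0 ->
  sqn (iter n lazy_avg f) <= decay ^+ n * sqn f.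
Proof.
move=> f0; elim: n => [|n IH]; first by rewrite expr0 mul1r.
rewrite iterS exprS -mulrA; set g := iter n lazy_avg f in IH *.
have g0 : \sum_d g (tl d) = 0 by rewrite sum_iter_lazy.
have P := poincare K_gt0 conductance g0.
have L := sqn_lazy src dst g.
have k0 : 0 < 16 * K%:R ^+ 2 :> R by rewrite mulr_gt0 // exprn_gt0 // ltr0n.
have P' : (16 * K%:R ^+ 2)^-1 * sqn g <= energy src dst g / 4.
  rewrite -(ler_pM2l k0) mulVKf ?gt_eqF //; move: P; set e := energy _ _ _; lra.
have Q : sqn (lazy_avg g) <= decay * sqn g.
  by rewrite /decay mulrBl mul1r; lra.
by apply: le_trans Q _; rewrite ler_wpM2l ?decay_ge0.
Qed.

Local Notation N := (#|{: dart I}|%:R : R).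

Lemma sum_delta b : \sum_d delta b (tl d) = (deg b)%:R.
Proof. by rewrite /delta (sum_ind R (fun d => tl d == b)). Qed.

Lemma sum_const_dart (c : R) : \sum_(d : dart I) c = N * c.
Proof. by rewrite sumr_const mulr_natl cardT. Qed.

Lemma dotp_delta a f : dotp (delta a) f = (deg a)%:R * f a.
Proof.
rewrite -sum_delta big_distrl /=; apply: eq_bigr => d _; rewrite /delta.
by case: eqVneq => [-> | _]; rewrite ?mul0r.
Qed.

(** By self-adjointness the 2n steps are split into n from each end. Without its mean deg/N, each
    half has squared norm at most decay^n deg, so the main term deg a deg b / N loses at most half
    of itself; here degrees are at least 1. *)
Lemma mixing n a b : (0 < deg a)%N -> (0 < deg b)%N -> decay ^+ n <= (2 * N)^-1 ->
  (deg b)%:R / (2 * N) <= iter (n + n) lazy_avg (delta b) a.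
Proof.
move=> a0 b0 dn.
have N0 : 0 < N.
  have /card_gt0P [d _] := a0; rewrite ltr0n; by apply/card_gt0P; exists d.
have Nn0 : N != 0 by rewrite gt_eqF.
set A := (deg a)%:R : R; set B := (deg b)%:R : R.
have A1 : 1 <= A by rewrite -[1]/(1%:R) ler_nat.
have B1 : 1 <= B by rewrite -[1]/(1%:R) ler_nat.
have mean c : \sum_d (fun x => delta c x - (deg c)%:R / N) (tl d) = 0.
  by rewrite sumrB sum_delta sum_const_dart; field.
pose u c := iter n lazy_avg (fun x => delta c x - (deg c)%:R / N).
have u0 c : \sum_d u c (tl d) = 0 by rewrite sum_iter_lazy mean.
have un c : sqn (u c) <= decay ^+ n * (deg c)%:R.
  apply: le_trans (sqn_decay n (mean c)) _; rewrite ler_wpM2l ?exprn_ge0 ?decay_ge0 //.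
  have -> : sqn (fun x => delta c x - (deg c)%:R / N) = (deg c)%:R - (deg c)%:R ^+ 2 / N.
    rewrite /sqn /dotp.
    have E d : (delta c (tl d) - (deg c)%:R / N) * (delta c (tl d) - (deg c)%:R / N) =
       delta c (tl d) * (1 - 2 * (deg c)%:R / N) + ((deg c)%:R / N) ^+ 2.
      by rewrite /delta; case: eqP => _; rewrite /=; ring.
    under eq_bigr => d _ do rewrite E.
    by rewrite big_split /= -big_distrl /= sum_delta sum_const_dart; field.
  by rewrite gerBl divr_ge0 ?sqr_ge0 // ltW.
have uE c d : iter n lazy_avg (delta c) (tl d) = u c (tl d) + (deg c)%:R / N.
  by rewrite /u iter_lazy_subc ?deg_tail // subrK.
have key : A * iter (n + n) lazy_avg (delta b) a = dotp (u a) (u b) + A * B / N.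
  rewrite -dotp_delta iterD dotp_iter /dotp.
  under eq_bigr => d _ do rewrite !uE.
  have E d : (u a (tl d) + A / N) * (u b (tl d) + B / N) =
     u a (tl d) * u b (tl d) + (A / N * u b (tl d) + (B / N * u a (tl d) + A / N * (B / N))) by ring.
  under eq_bigr => d _ do rewrite E.
  rewrite !big_split /= -!big_distrr /= !u0 sum_const_dart !mulr0 !add0r.
  by rewrite -/(dotp _ _); congr (_ + _); field.
have AM : 0 <= B ^+ 2 * sqn (u a) + 2 * (A * B) * dotp (u a) (u b) + A ^+ 2 * sqn (u b).
  have -> : B ^+ 2 * sqn (u a) + 2 * (A * B) * dotp (u a) (u b) + A ^+ 2 * sqn (u b) =
    \sum_d (B * u a (tl d) + A * u b (tl d)) ^+ 2.
    rewrite /sqn /dotp !big_distrr -!big_split /=; apply: eq_bigr => d _; ring.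
  by apply: sumr_ge0 => d _; exact: sqr_ge0.
have D0 : 0 <= decay ^+ n by rewrite exprn_ge0 // decay_ge0.
have low : - (A * B / (2 * N)) <= dotp (u a) (u b).
  have Ua : B ^+ 2 * sqn (u a) <= B ^+ 2 * (decay ^+ n * A) by rewrite ler_wpM2l ?sqr_ge0.
  have Ub : A ^+ 2 * sqn (u b) <= A ^+ 2 * (decay ^+ n * B) by rewrite ler_wpM2l ?sqr_ge0.
  have AB0 : 0 < A * B by rewrite mulr_gt0 //; lra.
  have H1 : - (decay ^+ n * (A + B) / 2) <= dotp (u a) (u b).
    rewrite -(ler_pM2l (mulr_gt0 (ltr0n R 2) AB0)).
    have -> : 2 * (A * B) * - (decay ^+ n * (A + B) / 2) =
      - (B ^+ 2 * (decay ^+ n * A) + A ^+ 2 * (decay ^+ n * B)) by field.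
    lra.
  apply: le_trans H1; rewrite lerN2.
  have H2 : decay ^+ n * (A + B) / 2 <= decay ^+ n * (A * B).
    rewrite -mulrA ler_wpM2l //; nra.
  apply: le_trans H2 _; rewrite [X in _ <= X]mulrC ler_wpM2r // ltW //.
have A0 : 0 < A by lra.
rewrite -(ler_pM2l A0) key.
have -> : A * (B / (2 * N)) = A * B / N - A * B / (2 * N) by field.
lra.
Qed.

End Mixing.

(** * The lazy random walk as a weight on sequences of steps *)

Section Walks.

Variables (R : realFieldType) (V I : finType) (src dst : I -> V).

Local Notation tl := (tail src dst).
Local Notation hd := (head src dst).
Local Notation deg := (deg src dst).
Local Notation lazy_avg := (@lazy_avg R V I src dst).

(* A step [(d, true)] moves along the dart [d]; the lazy step [(d, false)] stays at its tail. *)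
Definition step := (dart I * bool)%type.
Definition step_src (s : step) : V := tl s.1.
Definition step_tgt (s : step) : V := if s.2 then hd s.1 else tl s.1.

Fixpoint is_walk (a : V) (p : seq step) (b : V) : bool :=
  if p is s :: p' then (step_src s == a) && is_walk (step_tgt s) p' b else a == b.

(** Nested pairs make sums over walks split off one step at a time. Consecutive steps need not fit
    together; [weight] vanishes on those that do not. *)
Fixpoint walk (n : nat) : finType :=
  if n is n'.+1 then ((step * walk n')%type : finType) else (unit : finType).

Fixpoint steps (n : nat) : walk n -> seq step :=
  match n with
  | 0 => fun=> [::]
  | n'.+1 => fun w => w.1 :: steps w.2
  end.

(** The probability that the lazy walk from a makes exactly these steps and ends in b. Staying at a
    is spread evenly over the darts leaving a, so that every step, moving or not, has probability 1
    / (2 deg a). *)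
Fixpoint weight (n : nat) : V -> walk n -> V -> R :=
  match n with
  | 0 => fun a _ b => (a == b)%:R
  | n'.+1 => fun a w b => (step_src w.1 == a)%:R / (2 * (deg a)%:R) * weight (step_tgt w.1) w.2 b
  end.

Lemma size_steps n (w : walk n) : size (steps w) = n.
Proof. by elim: n w => //= n IH w; rewrite IH. Qed.

Lemma weight_ge0 n a (w : walk n) b : 0 <= weight a w b.
Proof. by elim: n a w => [|n IH] a w /=; rewrite ?ler0n // !mulr_ge0 ?invr_ge0 ?mulr_ge0 ?ler0n. Qed.

Lemma weight_is_walk n a (w : walk n) b : weight a w b != 0 -> is_walk a (steps w) b.
Proof.
elim: n a w => [|n IH] a w /=; first by rewrite pnatr_eq0 eqb0 negbK.
by rewrite !mulf_eq0 !negb_or pnatr_eq0 eqb0 negbK -andbA => /and3P [-> _ /IH].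
Qed.

Lemma step_tgt_deg s : (0 < deg (step_tgt s))%N.
Proof. by rewrite /step_tgt; case: s.2; rewrite ?deg_head ?deg_tail. Qed.

Lemma sum_step (F : step -> R) : \sum_s F s = \sum_d (F (d, true) + F (d, false)).
Proof.
rewrite (eq_bigr (fun s => F (s.1, s.2))); last by case.
rewrite -(pair_bigA _ (fun d b => F (d, b))) /=; apply: eq_bigr => d _.
by rewrite big_bool.
Qed.

Lemma sum_walkS n (F : walk n.+1 -> R) : \sum_w F w = \sum_s \sum_(w : walk n) F (s, w).
Proof.
rewrite (pair_bigA _ (fun s w => F (s, w))) /=.
by apply: eq_bigr => -[].
Qed.

Lemma sum_from a (G : V -> R) : (0 < deg a)%N ->
  \sum_s (step_src s == a)%:R / (2 * (deg a)%:R) * G (step_tgt s) = lazy_avg G a.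
Proof.
move=> a0; rewrite sum_step /lazy_avg /avg /step_tgt /step_src /=.
have na := natdeg_neq0 R a0.
have -> : \sum_d ((tl d == a)%:R / (2 * (deg a)%:R) * G (hd d) + (tl d == a)%:R / (2 * (deg a)%:R) * G (tl d))
   = \sum_(d | tl d == a) (G (hd d) + G a) / (2 * (deg a)%:R).
  rewrite [RHS]big_mkcond /=; apply: eq_bigr => d _.
  by case: eqP => [-> | _] /=; [field | rewrite !mul0r addr0].
rewrite -big_distrl big_split /= sum_deg; set X := \sum_(d | _) _.
by field.
Qed.

Lemma sum_weight n a b : (0 < deg a)%N -> \sum_(w : walk n) weight a w b = iter n lazy_avg (delta R b) a.
Proof.
elim: n a => [|n IH] a a0.
  by rewrite /= (eq_bigr (fun=> (a == b)%:R)) // sumr_const card_unit mulr1n.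
rewrite sum_walkS iterS -sum_from //=; apply: eq_bigr => s _.
by rewrite -big_distrr /= IH // step_tgt_deg.
Qed.

Lemma sum_weight_end n a : (0 < deg a)%N -> \sum_(w : walk n) \sum_b weight a w b = 1.
Proof.
elim: n a => [|n IH] a a0.
  rewrite (eq_bigr (fun=> 1)) => [|w _]; first by rewrite sumr_const card_unit mulr1n.
  by rewrite /= (bigD1 a) //= eqxx big1 ?addr0 // => b; rewrite eq_sym => /negPf ->.
rewrite sum_walkS.
have -> : \sum_s \sum_(w : walk n) \sum_b weight a ((s, w) : walk n.+1) b =
   \sum_s (step_src s == a)%:R / (2 * (deg a)%:R) * 1.
  apply: eq_bigr => s _ /=; under eq_bigr => w _ do rewrite -big_distrr /=.
  by rewrite -big_distrr /= IH // step_tgt_deg.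
rewrite (sum_from (fun=> 1)) // /lazy_avg /avg sum_deg mulr1 divff ?natdeg_neq0 //.
by field.
Qed.

Definition cnt n (w : walk n) (phi : step -> R) : R := \sum_(s <- steps w) phi s.

(* Every step of the stationary walk is uniformly distributed among all steps. *)
Lemma sum_cnt n phi : \sum_d \sum_(w : walk n) \sum_b weight (tl d) w b * cnt w phi =
  n%:R / 2 * \sum_s phi s.
Proof.
pose Z n x := \sum_(w : walk n) \sum_b weight x w b * cnt w phi.
rewrite -[LHS]/(\sum_d Z n (tl d)); elim: n => [|n IH].
  rewrite mul0r mul0r big1 // => d _; rewrite /Z big1 // => w _; rewrite big1 // => b _.
  by rewrite /cnt big_nil mulr0.
pose G s := phi s + Z n (step_tgt s).
have ZS x : (0 < deg x)%N -> Z n.+1 x = \sum_s (step_src s == x)%:R / (2 * (deg x)%:R) * G s.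
  move=> x0; rewrite /Z sum_walkS; apply: eq_bigr => s _.
  have phiE : phi s = phi s * \sum_(w : walk n) \sum_b weight (step_tgt s) w b.
    by rewrite sum_weight_end ?step_tgt_deg // mulr1.
  rewrite /G [X in _ * (X + _)]phiE /Z.
  rewrite big_distrr -big_split /= big_distrr /=; apply: eq_bigr => w _.
  rewrite big_distrr -big_split /= big_distrr /=; apply: eq_bigr => b _.
  rewrite /cnt /= big_cons; ring.
under eq_bigr => d _ do rewrite ZS ?deg_tail //.
rewrite exchange_big /=.
have -> : \sum_s \sum_d (step_src s == tl d)%:R / (2 * (deg (tl d))%:R) * G s = \sum_s G s / 2.
  apply: eq_bigr => s _; rewrite -big_distrl mulrC /=; congr (_ * _).
  have -> : \sum_d (step_src s == tl d)%:R / (2 * (deg (tl d))%:R) =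
     \sum_(d | tl d == step_src s) (2 * (deg (step_src s))%:R)^-1 :> R.
    rewrite [RHS]big_mkcond /=; apply: eq_bigr => d _; rewrite eq_sym.
    by case: eqP => [-> | _]; rewrite ?mul0r ?mul1r.
  rewrite sum_deg; field; exact/natdeg_neq0/deg_tail.
rewrite -big_distrl big_split /= mulrDl.
have -> : (\sum_s Z n (step_tgt s)) / 2 = \sum_d Z n (tl d).
  rewrite sum_step /step_tgt /= big_split /= (sum_head_tail src dst (Z n)); by field.
rewrite IH -natr1; by field.
Qed.

End Walks.

(** * Random bridges in an expander and the union bound over K_{3,3} *)

Section Expander.

Variables (R : realFieldType) (V I : finType) (src dst : I -> V) (K l : nat) (B : rel I).
Hypothesis K_gt0 : (0 < K)%N.
Hypothesis conductance : forall S : {set V},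
  (2 * vol src dst S <= #|{: dart I}|)%N -> (vol src dst S <= K * boundary src dst S)%N.
Hypothesis l_large : (2 * #|{: dart I}| <= 2 ^ l)%N.

Definition bad_walks (p q : seq (step I)) : bool :=
  has (fun s => has (fun s' => B s.1.1 s'.1.1) q) p.

Hypothesis nonplanar : forall (a b : 'I_3 -> V) (p : 'I_3 -> 'I_3 -> seq (step I)),
  (forall i j, p i j != [::] /\ is_walk src dst (a i) (p i j) (b j)) ->
  exists i j i' j', [/\ i != i', j != j' & bad_walks (p i j) (p i' j')].

Local Notation tl := (tail src dst).
Local Notation deg := (deg src dst).
Local Notation N := (#|{: dart I}|%:R : R).
Local Notation lazy_avg := (@lazy_avg R V I src dst).
Local Notation weight := (weight R src dst).

Let n := (16 * K ^ 2 * l)%N.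
Let T := (n + n)%N.

(** With k = 16 K^2, the inverse of 1 - 1/k is 1 + 1/(k - 1), whose k-th power is at least 2 by
    Bernoulli's inequality. *)
Lemma half_decay : decay R K ^+ (16 * K ^ 2) <= 2^-1.
Proof.
set k := (16 * K ^ 2)%N; have k0 : (0 < k)%N by rewrite muln_gt0 expn_gt0 K_gt0.
have kE : 16 * K%:R ^+ 2 = k%:R :> R by rewrite /k natrM natrX.
rewrite /decay kE.
have k1 : (1 < k)%N by rewrite /k; move: (expn_gt0 K 2); rewrite K_gt0 /=; lia.
have kR : 1 < k%:R :> R by rewrite -[1]/(1%:R) ltr_nat.
pose y : R := 1 - k%:R^-1.
have y0 : 0 < y by rewrite subr_gt0 invf_lt1 //; lra.
have bern m (x : R) : 0 <= x -> 1 + m%:R * x <= (1 + x) ^+ m.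
  move=> x0; elim: m => [|m IH]; first by rewrite mul0r addr0 expr0.
  rewrite exprS -natr1; have : 0 <= m%:R :> R := ler0n _ _; nra.
have yV : y^-1 = 1 + (k%:R - 1)^-1 by rewrite /y; field; rewrite ?gt_eqF //; lra.
have H := bern k (k%:R - 1)^-1.
rewrite -yV in H.
have H2 : 2 <= (y ^+ k)^-1.
  rewrite -exprVn; apply: le_trans (H _); last by rewrite invr_ge0; lra.
  have : 1 <= k%:R * (k%:R - 1)^-1 :> R.
    by rewrite ler_pdivlMr ?mul1r; lra.
  lra.
by rewrite -(invrK (y ^+ k)) lef_pV2 // posrE ?invr_gt0 ?exprn_gt0.
Qed.

Lemma N_gt0 (d : dart I) : 0 < N.
Proof. by rewrite ltr0n; apply/card_gt0P; exists d. Qed.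

Lemma weight_total_ge (a b : V) : (0 < deg a)%N -> (0 < deg b)%N ->
  (deg b)%:R / (2 * N) <= \sum_(w : walk I T) weight a w b.
Proof.
move=> a0 b0; rewrite sum_weight //; apply: (mixing K_gt0 conductance) => //.
have /card_gt0P [d _] := a0; have Np := N_gt0 d.
rewrite /n exprM.
apply: (@le_trans _ _ (2^-1 ^+ l)).
  by apply: lerXn2r half_decay; rewrite ?nnegrE ?exprn_ge0 ?decay_ge0 ?invr_ge0.
by rewrite exprVn lef_pV2 ?posrE ?exprn_gt0 ?mulr_gt0 // -natrX -natrM ler_nat.
Qed.

(** The random bridge: a walk of length T from the tail of d, conditioned to end at the tail of
    d'. *)
Let mu (d d' : dart I) (w : walk I T) : R :=
  weight (tl d) w (tl d') / \sum_(w : walk I T) weight (tl d) w (tl d').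

Lemma weight_total_gt0 (d d' : dart I) : 0 < \sum_(w : walk I T) weight (tl d) w (tl d').
Proof.
apply: lt_le_trans (weight_total_ge (deg_tail _ _ d) (deg_tail _ _ d')).
by rewrite divr_gt0 ?mulr_gt0 ?(N_gt0 d) // ltr0n deg_tail.
Qed.

Lemma mu_ge0 d d' w : 0 <= mu d d' w.
Proof. by rewrite divr_ge0 ?weight_ge0 // ltW // weight_total_gt0. Qed.

Lemma mu_sum1 d d' : \sum_w mu d d' w = 1.
Proof. by rewrite -big_distrl /= divff // gt_eqF // weight_total_gt0. Qed.

Let bw (w w' : walk I T) : R := (bad_walks (steps w) (steps w'))%:R.

Let beta d1 d2 d3 d4 : R := \sum_w \sum_w' mu d1 d2 w * mu d3 d4 w' * bw w w'.

(** Nine independent bridges draw a K_{3,3}, so some bad pair of walks is certain, and the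
    probabilities of the pairs sum to at least 1. *)
Lemma union_bound (x y : 'I_3 -> dart I) : (0 < T)%N ->
  1 <= \sum_(p : 'I_3 * 'I_3) \sum_(q | (p.1 != q.1) && (p.2 != q.2))
    beta (x p.1) (y p.2) (x q.1) (y q.2).
Proof.
move=> T0.
pose nu (p : 'I_3 * 'I_3) := mu (x p.1) (y p.2).
have nu1 p : \sum_w nu p w = 1 by exact: mu_sum1.
rewrite -(sum_product_measure nu1).
apply: (@le_trans _ _ (\sum_(W : {ffun 'I_3 * 'I_3 -> walk I T}) \sum_(p : 'I_3 * 'I_3)
   \sum_(q | (p.1 != q.1) && (p.2 != q.2)) (\prod_p nu p (W p)) * bw (W p) (W q))).
  apply: ler_sum => W _; set X := \prod_p _.
  have X0 : 0 <= X by apply: prodr_ge0 => p _; exact: mu_ge0.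
  have terms p q : 0 <= X * bw (W p) (W q) by rewrite mulr_ge0 ?ler0n.
  (* Only outcomes of positive probability consist of genuine walks, as [nonplanar] requires. *)
  have [XE | Xn] := eqVneq X 0.
    by rewrite [X in X <= _]XE; apply: sumr_ge0 => p _; apply: sumr_ge0.
  have [i [j [i' [j' [ii jj bd]]]]] : exists i j i' j',
      [/\ i != i', j != j' & bad_walks (steps (W (i, j))) (steps (W (i', j')))].
    apply: (@nonplanar (fun i => tl (x i)) (fun j => tl (y j)) (fun i j => steps (W (i, j)))).
    move=> i j; split; first by rewrite -size_eq0 size_steps -lt0n.
    apply: (@weight_is_walk R); apply: contraNneq Xn => Z.
    by rewrite /X (bigD1 (i, j)) //= /nu /mu /= Z !mul0r.
  rewrite (bigD1 (i, j)) //= (bigD1 (i', j')) /=; last by rewrite ii jj.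
  rewrite {1}/bw bd mulr1 -addrA lerDl addr_ge0 //; last by apply: sumr_ge0 => p _; exact: sumr_ge0.
  by apply: sumr_ge0 => q _.
rewrite exchange_big /=; apply: ler_sum => p _.
rewrite exchange_big /=; apply: ler_sum => q /andP [p1 p2].
rewrite (product_marginal bw nu1) //.
by apply: contraNneq p1 => ->.
Qed.

(** [union_bound] averaged over independent uniform darts as ends: each pair of bridges in it sees
    four independent uniform darts. The factor 81 counts all ordered pairs of the nine bridges. *)
Lemma average_beta : (0 < #|{: dart I}|)%N -> (0 < T)%N ->
  N ^+ 4 <= 81 * \sum_d1 \sum_d2 \sum_d3 \sum_d4 beta d1 d2 d3 d4.
Proof.
move=> D0 T0; have Np : 0 < N by rewrite ltr0n.
pose u (i : 'I_3) (d : dart I) := N^-1.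
have u1 i : \sum_d u i d = 1.
  by rewrite /u sum_const_dart divff // gt_eqF.
set S := (X in _ <= 81 * X).
have H : 1 <= \sum_(p : 'I_3 * 'I_3) \sum_(q | (p.1 != q.1) && (p.2 != q.2)) N ^- 4 * S.
  have one : 1 = \sum_(x : {ffun 'I_3 -> dart I}) \sum_(y : {ffun 'I_3 -> dart I})
      (\prod_i u i (x i)) * (\prod_i u i (y i)).
    rewrite -[LHS](sum_product_measure u1); apply: eq_bigr => x _.
    by rewrite -big_distrr /= (sum_product_measure u1) mulr1.
  rewrite [X in X <= _]one.
  apply: (@le_trans _ _ (\sum_(x : {ffun 'I_3 -> dart I}) \sum_(y : {ffun 'I_3 -> dart I})
     \sum_(p : 'I_3 * 'I_3) \sum_(q | (p.1 != q.1) && (p.2 != q.2))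
     (\prod_i u i (x i)) * ((\prod_i u i (y i)) * beta (x p.1) (y p.2) (x q.1) (y q.2)))).
    apply: ler_sum => x _; apply: ler_sum => y _.
    have P0 (z : {ffun 'I_3 -> dart I}) : 0 <= \prod_i u i (z i).
      by apply: prodr_ge0 => i _; rewrite invr_ge0 ltW.
    have -> : \sum_(p : 'I_3 * 'I_3) \sum_(q | (p.1 != q.1) && (p.2 != q.2))
        (\prod_i u i (x i)) * ((\prod_i u i (y i)) * beta (x p.1) (y p.2) (x q.1) (y q.2)) =
      (\prod_i u i (x i)) * ((\prod_i u i (y i)) * \sum_(p : 'I_3 * 'I_3)
         \sum_(q | (p.1 != q.1) && (p.2 != q.2)) beta (x p.1) (y p.2) (x q.1) (y q.2)).
      rewrite 2!big_distrr /=; apply: eq_bigr => p _.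
      by rewrite 2!big_distrr.
    rewrite ler_wpM2l // ler_peMr //; exact: union_bound.
  rewrite (eq_bigr _ (fun x _ => exchange_big _ _ _ _ _ _)) /= exchange_big /=.
  apply: ler_sum => p _.
  rewrite (eq_bigr _ (fun x _ => exchange_big _ _ _ _ _ _)) /= exchange_big /=.
  apply: ler_sum => q /andP [p1 p2].
  under eq_bigr => x _ do rewrite -big_distrr /=.
  under eq_bigr => x _ do rewrite
    (product_marginal (fun d2 d4 => beta (x p.1) d2 (x q.1) d4) u1 p2).
  rewrite (product_marginal
    (fun d1 d3 => \sum_s \sum_t u p.2 s * u q.2 t * beta d1 s d3 t) u1 p1).
  rewrite /S big_distrr /= le_eqVlt; apply/orP; left; apply/eqP; apply: eq_bigr => d1 _.
  rewrite [in RHS]exchange_big /= big_distrr /=; apply: eq_bigr => d3 _.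
  rewrite !big_distrr /=; apply: eq_bigr => d2 _.
  rewrite !big_distrr /=; apply: eq_bigr => d4 _.
  by rewrite /u; field; rewrite gt_eqF.
have S0 : 0 <= S.
  apply: sumr_ge0 => d1 _; apply: sumr_ge0 => d2 _; apply: sumr_ge0 => d3 _.
  apply: sumr_ge0 => d4 _; apply: sumr_ge0 => w _; apply: sumr_ge0 => w' _.
  by apply: mulr_ge0; [apply: mulr_ge0; exact: mu_ge0 | exact: ler0n].
have NS0 : 0 <= N ^- 4 * S by rewrite mulr_ge0 // invr_ge0 exprn_ge0 // ltW.
have H2 : 1 <= \sum_(p : 'I_3 * 'I_3) \sum_(q : 'I_3 * 'I_3) N ^- 4 * S.
  apply: le_trans H _; apply: ler_sum => p _; rewrite big_mkcond /=; apply: ler_sum => q _.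
  by case: ifP.
have E81 (c : R) : \sum_(p : 'I_3 * 'I_3) \sum_(q : 'I_3 * 'I_3) c = 81 * c.
  by rewrite !sumr_const card_prod !card_ord -mulrnA mulr_natl.
rewrite E81 in H2.
have N4 : 0 < N ^+ 4 by rewrite exprn_gt0.
have -> : 81 * S = N ^+ 4 * (81 * (N ^- 4 * S)) by field; rewrite gt_eqF.
by rewrite ler_peMr // ltW.
Qed.

Definition rho (w : walk I T) : R := \sum_d \sum_b weight (tl d) w b.

(** Bridges between uniform ends are dominated by the stationary walk. Conditioning on the end b
    divides by at least deg b / (2 N), and b is the tail of deg b darts, so the degrees cancel. *)
Lemma sum_mu (w : walk I T) : \sum_d \sum_d' mu d d' w <= 2 * N * rho w.
Proof.
rewrite /rho big_distrr /=; apply: ler_sum => d _.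
have Np := N_gt0 d; have D0 : (0 < #|{: dart I}|)%N by rewrite -(ltr0n R).
apply: (@le_trans _ _ (\sum_d' weight (tl d) w (tl d') * (2 * N / (deg (tl d'))%:R))).
  apply: ler_sum => d' _; rewrite ler_wpM2l ?weight_ge0 //.
  rewrite -[X in _ <= X]invrK lef_pV2 ?posrE ?weight_total_gt0 ?invr_gt0 ?divr_gt0 ?mulr_gt0 ?ltr0n ?deg_tail //.
  by rewrite invf_div; apply: weight_total_ge; exact: deg_tail.
rewrite (partition_big tl xpredT) //= big_distrr /=; apply: ler_sum => b _.
rewrite (eq_bigr (fun=> weight (tl d) w b * (2 * N / (deg b)%:R))); last by move=> d' /eqP ->.
rewrite sum_deg; have [b0 | b0] := posnP (deg b).
  by rewrite b0 mul0r !mulr_ge0 ?weight_ge0 // ltW.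
rewrite le_eqVlt; apply/orP; left; apply/eqP; field; exact: natdeg_neq0.
Qed.

(** Each edge carries four steps: two directions, moving or staying. *)
Lemma sum_bad_steps :
  \sum_(s : step I) \sum_(s' : step I) (B s.1.1 s'.1.1)%:R = 16 * #|[set z | B z.1 z.2]|%:R :> R.
Proof.
have four (F : I -> R) : \sum_(s : step I) F s.1.1 = 4 * \sum_e F e.
  rewrite sum_step /= (eq_bigr (fun d : dart I => 2 * F d.1)); last by move=> d _; ring.
  rewrite -big_distrr /= (eq_bigr (fun d : dart I => F (d.1, d.2).1)) //.
  rewrite -(pair_bigA _ (fun e (b : bool) => F (e, b).1)) /=.
  rewrite (eq_bigr (fun e => 2 * F e)); last by move=> e _; rewrite big_bool /=; ring.
  by rewrite -big_distrr /=; ring.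
rewrite (four (fun e => \sum_(s' : step I) (B e s'.1.1)%:R)).
under eq_bigr => e _ do rewrite (four (fun e' => (B e e')%:R)).
rewrite -big_distrr /= mulrA pair_bigA /= -sum1dep_card natr_sum [in RHS]big_mkcond /=.
congr (_ * _); first by ring.
by apply: eq_bigr => z _; case: (B _ _).
Qed.

(** Union bound over pairs of steps. By [sum_cnt] each walk contributes T/2 times a sum over all
    steps, which gives (T/2)^2 * 16 = 4 T^2. *)
Lemma sum_bad_walks : \sum_w \sum_w' rho w * rho w' * bw w w' <=
  4 * T%:R ^+ 2 * #|[set z | B z.1 z.2]|%:R.
Proof.
pose b (s s' : step I) : R := (B s.1.1 s'.1.1)%:R.
have rho0 w : 0 <= rho w by apply: sumr_ge0 => d _; apply: sumr_ge0 => ? _; exact: weight_ge0.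
have bwle w w' : bw w w' <= cnt w (fun s => cnt w' (b s)).
  rewrite /bw /cnt; case: (boolP (bad_walks _ _)) => [/hasP [s sw /hasP [s' sw' bss']] | _].
    rewrite (big_rem s) //= (big_rem s') //= {1}/b bss' -addrA lerDl addr_ge0 //.
      by apply: sumr_ge0.
    by apply: sumr_ge0 => ? _; apply: sumr_ge0.
  by apply: sumr_ge0 => ? _; apply: sumr_ge0.
apply: (@le_trans _ _ (\sum_w \sum_w' rho w * rho w' * cnt w (fun s => cnt w' (b s)))).
  by apply: ler_sum => w _; apply: ler_sum => w' _; rewrite ler_wpM2l ?mulr_ge0.
have Ecnt phi : \sum_w rho w * cnt w phi = T%:R / 2 * \sum_s phi s.
  rewrite -(sum_cnt src dst) exchange_big /=; apply: eq_bigr => w _.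
  by rewrite /rho big_distrl /=; apply: eq_bigr => d _; rewrite big_distrl.
have -> : \sum_w \sum_w' rho w * rho w' * cnt w (fun s => cnt w' (b s)) =
   \sum_w rho w * cnt w (fun s => \sum_w' rho w' * cnt w' (b s)).
  apply: eq_bigr => w _; rewrite /cnt exchange_big /= big_distrr /=; apply: eq_bigr => w' _.
  by rewrite -mulrA -big_distrr.
rewrite Ecnt; under eq_bigr => s _ do rewrite Ecnt.
rewrite -big_distrr /= sum_bad_steps le_eqVlt; apply/orP; left; apply/eqP; by field.
Qed.

(* [T = 32 K^2 l] is the length of the walks, which mix in [T / 2] steps. *)
Theorem expander_bad_pairs : (0 < l)%N ->
  (#|I| ^ 2 <= 324 * (32 * K ^ 2 * l) ^ 2 * #|[set z : I * I | B z.1 z.2]|)%N.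
Proof.
move=> l0.
have T0 : (0 < T)%N by rewrite addn_gt0 !muln_gt0 ?expn_gt0 K_gt0 l0.
have TE : (32 * K ^ 2 * l)%N = T by rewrite /T /n; lia.
have DE : #|{: dart I}| = (2 * #|I|)%N by rewrite card_prod card_bool mulnC.
have [I0 | I0] := posnP #|I|; first by rewrite I0.
have D0 : (0 < #|{: dart I}|)%N by rewrite DE; lia.
have Np : 0 < N by rewrite ltr0n.
have H := average_beta D0 T0.
have rho0 w : 0 <= rho w by apply: sumr_ge0 => d _; apply: sumr_ge0 => ? _; exact: weight_ge0.
pose nu w := \sum_d \sum_d' mu d d' w.
have nu0 w : 0 <= nu w by apply: sumr_ge0 => d _; apply: sumr_ge0 => ? _; exact: mu_ge0.
have E : \sum_d1 \sum_d2 \sum_d3 \sum_d4 beta d1 d2 d3 d4 = \sum_w \sum_w' nu w * nu w' * bw w w'.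
  have -> : \sum_w \sum_w' nu w * nu w' * bw w w' =
     \sum_w \sum_w' \sum_d1 \sum_d2 \sum_d3 \sum_d4 mu d1 d2 w * mu d3 d4 w' * bw w w'.
    apply: eq_bigr => w _; apply: eq_bigr => w' _; rewrite /nu !big_distrl /=.
    apply: eq_bigr => d1 _; rewrite !big_distrl /=; apply: eq_bigr => d2 _.
    rewrite big_distrr big_distrl /=; apply: eq_bigr => d3 _.
    by rewrite big_distrr big_distrl /=.
  rewrite /beta.
  have push (A1 A2 A3 : finType) (F : A1 -> A2 -> A3 -> R) :
     \sum_a \sum_w \sum_w' F a w w' = \sum_w \sum_w' \sum_a F a w w'.
    by rewrite exchange_big /=; apply: eq_bigr => w _; exact: exchange_big.
  rewrite -[RHS]push; apply: eq_bigr => d1 _; rewrite -[RHS]push; apply: eq_bigr => d2 _.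
  by rewrite -[RHS]push; apply: eq_bigr => d3 _; rewrite -[RHS]push.
have H2 : \sum_w \sum_w' nu w * nu w' * bw w w' <=
   4 * N ^+ 2 * \sum_w \sum_w' rho w * rho w' * bw w w'.
  rewrite big_distrr /=; apply: ler_sum => w _; rewrite big_distrr /=; apply: ler_sum => w' _.
  have -> : 4 * N ^+ 2 * (rho w * rho w' * bw w w') = (2 * N * rho w) * (2 * N * rho w') * bw w w'.
    by ring.
  rewrite ler_wpM2r ?ler0n //; apply: ler_pM => //; exact: sum_mu.
have H3 := sum_bad_walks.
have N2 : 0 < N ^+ 2 by rewrite exprn_gt0.
(* 1296 = 81 * 4 * 4, from [average_beta], twice [sum_mu], and [sum_bad_walks]. As N is twice the
   number of edges, 324 remains. *)
have H4 : N ^+ 2 <= 1296 * T%:R ^+ 2 * #|[set z | B z.1 z.2]|%:R.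
  rewrite -(ler_pM2l N2) -exprD; apply: le_trans H _; rewrite E.
  apply: (@le_trans _ _ (81 * (4 * N ^+ 2 * (4 * T%:R ^+ 2 * #|[set z | B z.1 z.2]|%:R)))).
    rewrite ler_pM2l //; apply: le_trans H2 _; rewrite ler_pM2l ?mulr_gt0 //.
  rewrite le_eqVlt; apply/orP; left; apply/eqP; ring.
move: H4; rewrite -!natrX -!natrM ler_nat TE DE.
rewrite expnMn -!mulnA; move: (_ * #|[set z | B z.1 z.2]|)%N (#|I| ^ 2)%N => x y; lia.
Qed.

End Expander.

Local Close Scope ring_scope.

End Expanders.

Module Combinatorics.

Import structures all_boot all_order all_algebra zify Expanders.
Set Implicit Arguments.
Unset Strict Implicit.
Unset Printing Implicit Defensive.
Local Open Scope nat_scope.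

(** * Crossing parities of K33 and expanders *)

Section K33.

Variables (V I : finType) (src dst : I -> V) (lt : rel V) (w : I -> V -> bool) (x B : rel I).
Variable c : V -> bool.

Definition vdisj (e f : I) : bool :=
  [&& src e != src f, src e != dst f, dst e != src f & dst e != dst f].

Hypothesis lt_anti : forall u v, u != v -> lt v u = ~~ lt u v.
Hypothesis x_formula : forall e f, vdisj e f ->
  x e f = (w e (src f) (+) w e (dst f)) (+) ((w f (src e) (+) w f (dst e))
     (+) ((lt (src f) (src e) (+) lt (src f) (dst e)) (+) (lt (dst f) (src e) (+) lt (dst f) (dst e)))).
Hypothesis good : forall e f, ~~ B e f -> vdisj e f /\
  x e f = (c (src e) (+) c (dst e)) && (c (src f) (+) c (dst f)).

Local Notation tl := (tail src dst).
Local Notation hd := (head src dst).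

(** Integration mod 2 along a walk; lazy steps are dropped, since they do not move the end point. *)
Definition parity (phi : I -> bool) (p : seq (step I)) : bool :=
  \big[addb/false]_(s <- p | s.2) phi s.1.1.

Lemma parity_telescope (h : V -> bool) a p b : is_walk src dst a p b ->
  parity (fun e => h (src e) (+) h (dst e)) p = h a (+) h b.
Proof.
rewrite /parity; elim: p a => [|[[e o] m] p IH] a /=.
  by move/eqP ->; rewrite big_nil addbb.
case/andP => /eqP tl_a /IH; rewrite big_cons /=.
have E : h (src e) (+) h (dst e) = h (tl (e, o)) (+) h (hd (e, o)).
  by rewrite /tail /head; case: (o) => /=; rewrite // addbC.
move: tl_a; rewrite /step_src /step_tgt /= => tl_a; case: m => /= -> //.
  by rewrite E tl_a addbA addbK.
by rewrite tl_a.
Qed.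

Lemma parityD phi psi p : parity (fun e => phi e (+) psi e) p = parity phi p (+) parity psi p.
Proof. exact: big_split. Qed.

Lemma eq_parity phi psi p : {in p, forall s : step I, phi s.1.1 = psi s.1.1} -> parity phi p = parity psi p.
Proof.
by move=> E; rewrite /parity big_seq_cond [RHS]big_seq_cond; apply: eq_bigr => s /andP [/E].
Qed.

Lemma parity_exchange (F : I -> I -> bool) p q :
  parity (fun e => parity (F e) q) p = parity (fun f => parity (fun e => F e f) p) q.
Proof. exact: exchange_big. Qed.

Lemma parity_and phi b p : parity (fun e => phi e && b) p = parity phi p && b.
Proof. by rewrite /parity big_distrl. Qed.

Lemma and_parity b phi p : parity (fun e => b && phi e) p = b && parity phi p.
Proof. by rewrite /parity big_distrr. Qed.

(** Both sides of the parity formula are coboundaries in each edge, so summing over the steps of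
    both walks telescopes: the two walks satisfy the formula of two single edges ab and a'b'. *)
Lemma walk_pair_parity a p b a' q b' : is_walk src dst a p b -> is_walk src dst a' q b' ->
  ~~ bad_walks B p q ->
  (c a (+) c b) && (c a' (+) c b') =
  (parity (w^~ a') p (+) parity (w^~ b') p) (+) ((parity (w^~ a) q (+) parity (w^~ b) q) (+)
    ((lt a' a (+) lt a' b) (+) (lt b' a (+) lt b' b))).
Proof.
move=> wp wq nb.
have gd s t : s \in p -> t \in q -> ~~ B s.1.1 t.1.1.
  move=> sp tq; apply: contra nb => Bst; apply/hasP; exists s => //; apply/hasP; by exists t.
transitivity (parity (fun e => parity (x e) q) p).
  rewrite -(parity_telescope c wp) -parity_and; apply: eq_parity => s sp.
  rewrite -(parity_telescope c wq) -and_parity; apply: eq_parity => t tq.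
  by have [_ ->] := good (gd _ _ sp tq).
have E : parity (fun e => parity (x e) q) p = parity (fun e => parity (fun f =>
   (w e (src f) (+) w e (dst f)) (+) ((w f (src e) (+) w f (dst e))
     (+) ((lt (src f) (src e) (+) lt (src f) (dst e)) (+) (lt (dst f) (src e) (+) lt (dst f) (dst e))))) q) p.
  apply: eq_parity => s sp; apply: eq_parity => t tq.
  by rewrite x_formula //; have [] := good (gd _ _ sp tq).
rewrite E.
have E1 : parity (fun e => parity (fun f => w e (src f) (+) w e (dst f)) q) p =
    parity (w^~ a') p (+) parity (w^~ b') p.
  rewrite -parityD; apply: eq_parity => s _; exact: (parity_telescope (w s.1.1) wq).
have E2 : parity (fun e => parity (fun f => w f (src e) (+) w f (dst e)) q) p =
    parity (w^~ a) q (+) parity (w^~ b) q.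
  rewrite parity_exchange -parityD; apply: eq_parity => s _; exact: (parity_telescope (w s.1.1) wp).
have E3 : parity (fun e => parity (fun f => (lt (src f) (src e) (+) lt (src f) (dst e)) (+)
     (lt (dst f) (src e) (+) lt (dst f) (dst e))) q) p =
    (lt a' a (+) lt a' b) (+) (lt b' a (+) lt b' b).
  rewrite -(parity_telescope (fun v => lt v a (+) lt v b) wq) parity_exchange.
  apply: eq_parity => s _; rewrite parityD.
  by rewrite (parity_telescope (lt (src s.1.1)) wp) (parity_telescope (lt (dst s.1.1)) wp).
rewrite -E1 -E2 -E3 -!parityD; apply: eq_parity => s _.
by rewrite -!parityD.
Qed.

Lemma is_walk_end a p b : p != [::] -> is_walk src dst a p b -> exists2 s, s \in p & src s.1.1 = b \/ dst s.1.1 = b.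
Proof.
elim: p a => // s p IH a _ /= /andP [_].
case: p IH => [|t p] IH.
  move=> /= /eqP <-; exists s; first by rewrite mem_head.
  by rewrite /step_tgt /tail /head; case: s.2; case: s.1.2; rewrite /=; auto.
move=> /(IH (step_tgt src dst s) isT) [u up H]; exists u => //; by rewrite inE up orbT.
Qed.

Lemma not_bad_neq p q s t u v : ~~ bad_walks B p q -> s \in p -> t \in q ->
  src s.1.1 = u \/ dst s.1.1 = u -> src t.1.1 = v \/ dst t.1.1 = v -> u != v.
Proof.
move=> nb sp tq.
have nB : ~~ B s.1.1 t.1.1.
  by apply: contra nb => Bst; apply/hasP; exists s => //; apply/hasP; exists t.
have [/and4P [h1 h2 h3 h4] _] := good nB.
by move=> [] <- [] <-.
Qed.

Lemma nonplanar_K33 (a b : 'I_3 -> V) (p : 'I_3 -> 'I_3 -> seq (step I)) :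
  (forall i j, p i j != [::] /\ is_walk src dst (a i) (p i j) (b j)) ->
  exists i j i' j', [/\ i != i', j != j' & bad_walks B (p i j) (p i' j')].
Proof.
move=> H.
have [/existsP [i /existsP [j /existsP [i' /existsP [j' /and3P [h1 h2 h3]]]]] | no] :=
  boolP [exists i, exists j, exists i', exists j',
    [&& i != i', j != j' & bad_walks B (p i j) (p i' j')]].
  by exists i, j, i', j'.
have nb i j i' j' : i != i' -> j != j' -> ~~ bad_walks B (p i j) (p i' j').
  move=> ii jj; apply: contra no => bd; apply/existsP; exists i; apply/existsP; exists j.
  by apply/existsP; exists i'; apply/existsP; exists j'; rewrite ii jj.
exfalso.
have ioE (m n : nat) : (m < 3)%coq_nat -> (n < 3)%coq_nat -> m <> n ->
    (inord m : 'I_3) != inord n.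
  by move=> /ltP m3 /ltP n3 mn; apply/eqP => /(congr1 val); rewrite /= !inordK.
have xE u v : xorb u v = u (+) v by case: u; case: v.
apply: (@K33_odd (fun i => c (a (inord i))) (fun j => c (b (inord j)))
  (fun i j k => parity (w^~ (a (inord k))) (p (inord i) (inord j)))
  (fun i j k => parity (w^~ (b (inord k))) (p (inord i) (inord j)))
  (fun k i => lt (a (inord k)) (a (inord i))) (fun k j => lt (a (inord k)) (b (inord j)))
  (fun l i => lt (b (inord l)) (a (inord i))) (fun l j => lt (b (inord l)) (b (inord j)))).
- move=> i j k l i3 j3 k3 l3 ik jl; rewrite !xE.
  have [_ w1] := H (inord i) (inord j); have [_ w2] := H (inord k) (inord l).
  rewrite (walk_pair_parity w1 w2); last by apply: nb; exact: ioE.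
  by rewrite !addbA.
(* That b_j and b_l are distinct follows from the walks to them from a_0 and a_1: these have edges
   ending there, and edges of walks that are not bad share no vertex. *)
- move=> j l j3 l3 jl; apply: lt_anti.
  have i01 : (inord 0 : 'I_3) != inord 1 by apply: ioE => //; apply/ltP.
  have [n1 w1] := H (inord 0) (inord j); have [n2 w2] := H (inord 1) (inord l).
  have [s sp hs] := is_walk_end n1 w1; have [t tq ht] := is_walk_end n2 w2.
  exact: (not_bad_neq (nb _ _ _ _ i01 (ioE _ _ j3 l3 jl)) sp tq hs ht).
Qed.

End K33.

(** The shift by 2 keeps the logarithm at least 2 for every n, so that 2^j is at most its j-th
    power. *)
Definition lg (n : nat) : nat := trunc_log 2 n + 2.

Lemma lg_ge2 n : 2 <= lg n.
Proof. by rewrite /lg addn2. Qed.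

Lemma lg_mono m n : m <= n -> lg m <= lg n.
Proof. by move=> mn; rewrite leq_add2r leq_trunc_log. Qed.

Lemma lg_half m n : 0 < m -> 2 * m <= n -> lg m < lg n.
Proof.
move=> m0 mn; rewrite ltn_add2r; apply: leq_trans (leq_trunc_log 2 mn).
by rewrite mul2n trunc_log2_double.
Qed.

Lemma lg_sqr n : 4 * n ^ 2 <= 2 ^ (2 * lg n).
Proof.
have := trunc_log_ltn n (ltnSn 1) => h.
have -> : 2 ^ (2 * lg n) = 4 * (2 ^ (trunc_log 2 n).+1) ^ 2.
  by rewrite -expnM -[4]/(2 ^ 2) -expnD /lg; congr (2 ^ _); lia.
by rewrite leq_mul2l /= leq_exp2r // ltnW.
Qed.

(** Halving the vertex set lowers the logarithm by at least 1 and thereby the density bound by at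
    least a 1/L fraction. This is the source of the conductance. *)
Lemma lg_gap L B : 0 < L -> 0 < B -> L ^ B <= L * (L ^ B - L.-1 ^ B).
Proof.
case: B => // B; case: L => // L _ _ /=.
have h : L.+1 * L ^ B.+1 <= L * L.+1 ^ B.+1.
  rewrite !expnS !mulnA [L.+1 * L]mulnC leq_mul2l; apply/orP; right.
  by case: (B) => // b; rewrite leq_exp2r ?leqnSn.
rewrite mulnBr; move: h; set x := L.+1 ^ B.+1; set y := L ^ B.+1.
by rewrite [L.+1 * x]mulSn; lia.
Qed.

Lemma card_subset_type (T : finType) (A : {set T}) : #|{: {x in A}}| = #|A|.
Proof. by rewrite card_sig; apply: eq_card => x; rewrite inE. Qed.

(** * Dense induced subgraphs; minimal ones are expanders *)

Section Dense.

Variables (V I : finType) (src dst : I -> V).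
Hypothesis simple : forall e f, src e = src f -> dst e = dst f -> e = f.

Definition induced (J : {set I}) (U : {set V}) : {set I} :=
  [set e in J | (src e \in U) && (dst e \in U)].

Lemma card_induced_sqr (J : {set I}) (U : {set V}) : #|induced J U| <= #|U| ^ 2.
Proof.
rewrite -(card_in_imset (f := fun e => (src e, dst e))); last first.
  by move=> e f _ _ [] /simple h /h.
rewrite -[_ ^ 2]/(#|U| * #|U|) -cardsX; apply/subset_leq_card/subsetP => z /imsetP [e].
by rewrite inE => /and3P [_ h1 h2] ->; rewrite inE h1 h2.
Qed.

Lemma card_same_end (A : {set I}) (U : {set V}) (h h' : I -> V) v :
  (forall e f, h e = h f -> h' e = h' f -> e = f) -> (forall e, e \in A -> h' e \in U) ->
  #|[set f in A | h f == v]| <= #|U|.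
Proof.
move=> inj hU; rewrite -(card_in_imset (f := h')); last first.
  move=> e f; rewrite !inE => /andP [_ /eqP e1] /andP [_ /eqP f1] ef.
  by apply: inj => //; rewrite e1 f1.
apply/subset_leq_card/subsetP => z /imsetP [e].
by rewrite inE => /andP [/hU h1 _] ->.
Qed.

(** Pairs of edges sharing a vertex count as bad in the expander argument; this bound makes them
    negligible once the edges far outnumber the vertices. *)
Lemma card_touching (J : {set I}) (U : {set V}) :
  #|[set z in setX (induced J U) (induced J U) | ~~ vdisj src dst z.1 z.2]|
  <= #|induced J U| * (4 * #|U|).
Proof.
set A := induced J U.
have AU e : e \in A -> src e \in U /\ dst e \in U by rewrite inE => /and3P [].
pose T e := [set f in A | ~~ vdisj src dst e f].
have le e : #|T e| <= 4 * #|U|.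
  have sub : T e \subset ([set f in A | src f == src e] :|: [set f in A | src f == dst e]) :|:
     ([set f in A | dst f == src e] :|: [set f in A | dst f == dst e]).
    apply/subsetP => f; rewrite !inE /vdisj !negb_and !negbK => /andP [-> /=].
    by rewrite [src e == src f]eq_sym [src e == _]eq_sym ![dst e == _]eq_sym => /or4P [] ->;
      rewrite ?orbT.
  have b1 v : #|[set f in A | src f == v]| <= #|U|.
    by apply: (@card_same_end A U src dst) => // e' /AU [].
  have b2 v : #|[set f in A | dst f == v]| <= #|U|.
    apply: (@card_same_end A U dst src) => [e' f' h1 h2 | e' /AU [] //]; exact: simple.
  apply: leq_trans (subset_leq_card sub) _.
  apply: leq_trans (leq_card_setU _ _) _.
  have [c1 _] := leq_card_setU [set f in A | src f == src e] [set f in A | src f == dst e].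
  have [c2 _] := leq_card_setU [set f in A | dst f == src e] [set f in A | dst f == dst e].
  have := b1 (src e); have := b1 (dst e); have := b2 (src e); have := b2 (dst e).
  lia.
rewrite -sum1dep_card (eq_bigl (fun z => (z.1 \in A) && (z.2 \in T z.1))); last first.
  by case=> e f; rewrite in_setX [f \in T _]inE andbA.
rewrite -(pair_big_dep (fun e => e \in A) (fun e f => f \in T e) (fun _ _ => 1)) /=.
under eq_bigr => e _ do rewrite sum1_card.
rewrite -sum_nat_const; apply: leq_sum => e _; exact: le.
Qed.

Lemma sum_dart_nat (F : dart I -> nat) : \sum_d F d = \sum_e (F (e, true) + F (e, false)).
Proof.
rewrite (eq_bigr (fun d => F (d.1, d.2))); last by case.
rewrite -(pair_bigA _ (fun e b => F (e, b))) /=; apply: eq_bigr => e _.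
by rewrite big_bool.
Qed.

End Dense.

Section Conductance.

Variables (V I : finType) (src dst : I -> V) (J : {set I}) (U : {set V}) (B : nat).
Hypothesis B_gt0 : 0 < B.
Hypothesis smaller : forall U' : {set V}, U' \proper U ->
  #|induced src dst J U'| <= #|U'| * lg #|U'| ^ B.
Hypothesis large : #|U| * lg #|U| ^ B < #|induced src dst J U|.

Local Notation A := (induced src dst J U).
Local Notation src' := (fun e : {x in A} => src (val e)).
Local Notation dst' := (fun e : {x in A} => dst (val e)).

Lemma dart_count (P : V -> V -> bool) :
  #|[set d | P (tail src' dst' d) (head src' dst' d)]| =
  \sum_(e in A) (P (dst e) (src e) + P (src e) (dst e)).
Proof.
rewrite -sum1dep_card big_mkcond sum_dart_nat /= [RHS]big_sub /=.
by apply: eq_bigr => e _; rewrite /tail /head /=; do 2!case: (P _ _).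
Qed.

Lemma induced_count (S : {set V}) :
  #|induced src dst J (U :&: S)| = \sum_(e in A) ((src e \in S) && (dst e \in S)).
Proof.
rewrite -sum1_card big_mkcond [RHS]big_mkcond /=; apply: eq_bigr => e _.
rewrite !inE; case: (e \in J) => //=; case: (src e \in U); case: (dst e \in U);
  case: (src e \in S); case: (dst e \in S) => //.
Qed.

(** Both sides of a cut obey the density bound, and the one with at most half of the vertices obeys
    it with a smaller logarithm. The excess of U over the bound must lie in the cut, which by
    [lg_gap] has at least a 1/L fraction of the edges inside the smaller side; the volume is 2 e1 +
    cu <= 3 L cu. *)
Lemma minimal_conductance (S : {set V}) :
  2 * vol src' dst' S <= #|{: dart {x in A}}| ->
  vol src' dst' S <= 3 * lg #|U| * boundary src' dst' S.
Proof.
have volE (S' : {set V}) : vol src' dst' S' = 2 * #|induced src dst J (U :&: S')| +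
    boundary src' dst' S'.
  rewrite /vol (dart_count (fun x y => x \in S')) /boundary.
  rewrite (dart_count (fun x y => (x \in S') && (y \notin S'))) induced_count.
  rewrite big_distrr -big_split /=; apply: eq_bigr => e _.
  by case: (src e \in S'); case: (dst e \in S').
have bC : boundary src' dst' (~: S) = boundary src' dst' S.
  rewrite /boundary (dart_count (fun x y => (x \in ~: S) && (y \notin ~: S))).
  rewrite (dart_count (fun x y => (x \in S) && (y \notin S))).
  apply: eq_bigr => e _; rewrite !inE !negbK.
  by case: (src e \in S); case: (dst e \in S).
have mE : #|A| = #|induced src dst J (U :&: S)| + #|induced src dst J (U :&: ~: S)|
    + boundary src' dst' S.
  rewrite /boundary (dart_count (fun x y => (x \in S) && (y \notin S))) !induced_count.
  rewrite -!big_split -sum1_card /=; apply: eq_bigr => e _; rewrite !inE.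
  by case: (src e \in S); case: (dst e \in S).
have DE : #|{: dart {x in A}}| = 2 * #|A|.
  by rewrite card_prod card_bool card_subset_type mulnC.
have v1 := volE S; have v2 := volE (~: S); rewrite bC in v2.
set cu := boundary _ _ S in v1 v2 mE *; set L := lg #|U|.
have L2 : 2 <= L by exact: lg_ge2.
rewrite DE v1 => half.
set e1 := #|induced src dst J (U :&: S)| in v1 mE half *.
set e2 := #|induced src dst J (U :&: ~: S)| in v2 mE.
have cardU : #|U| = #|U :&: S| + #|U :&: ~: S| by rewrite -(cardsID S U) setDE.
have empty (X : {set V}) : X = set0 -> #|induced src dst J X| = 0.
  by move=> ->; apply/eqP; rewrite cards_eq0; apply/eqP/setP => e; rewrite !inE /= andbF.
have [S0 | S0] := posnP #|U :&: S|.
  have e10 : e1 = 0 by apply: empty; apply/eqP; rewrite -cards_eq0 S0.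
  rewrite e10; nia.
have [C0 | C0] := posnP #|U :&: ~: S|.
  have e20 : e2 = 0 by apply: empty; apply/eqP; rewrite -cards_eq0 C0.
  nia.
have p1 : e1 <= #|U :&: S| * lg #|U :&: S| ^ B.
  by apply: smaller; rewrite properEcard subsetIl /=; lia.
have p2 : e2 <= #|U :&: ~: S| * lg #|U :&: ~: S| ^ B.
  by apply: smaller; rewrite properEcard subsetIl /=; lia.
have gap := lg_gap (ltnW L2) B_gt0.
have wide u : u <= #|U| -> lg u ^ B <= L ^ B by move=> h; rewrite leq_exp2r // lg_mono.
have narrow u : 0 < u -> 2 * u <= #|U| -> lg u ^ B <= L.-1 ^ B.
  by move=> u0 h; rewrite leq_exp2r //; have := lg_half u0 h; rewrite -/L; lia.
have predL : L.-1 ^ B <= L ^ B by rewrite leq_exp2r // leq_pred.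
have key u1 u2 x1 x2 : #|U| = u1 + u2 -> 0 < u1 -> 2 * u1 <= #|U| -> #|A| = x1 + x2 + cu ->
    x1 <= u1 * lg u1 ^ B -> x2 <= u2 * lg u2 ^ B -> x1 <= L * cu.
  move=> Uu u10 hu mx h1 h2.
  have n1 := narrow u1 u10 hu; have w2 : lg u2 ^ B <= L ^ B by apply: wide; lia.
  have h1' : x1 <= u1 * L.-1 ^ B by apply: leq_trans h1 _; rewrite leq_mul2l n1 orbT.
  have h2' : x2 <= u2 * L ^ B by apply: leq_trans h2 _; rewrite leq_mul2l w2 orbT.
  have c1 : u1 * (L ^ B - L.-1 ^ B) <= cu.
    move: large; rewrite -/L mx Uu mulnDl mulnBr; lia.
  have c2 : u1 * L ^ B <= L * cu.
    apply: (@leq_trans (u1 * (L * (L ^ B - L.-1 ^ B)))); first by rewrite leq_mul2l gap orbT.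
    by rewrite mulnCA leq_mul2l c1 orbT.
  by apply: leq_trans h1' _; apply: leq_trans c2; rewrite leq_mul2l predL orbT.
have [s1 | s2] := leqP (2 * #|U :&: S|) #|U|.
  have := key _ _ _ _ cardU S0 s1 mE p1 p2; nia.
(* Now S has more than half of the vertices but at most half of the volume, so e1 <= e2, and the
   bound for the complement suffices. *)
have s2' : 2 * #|U :&: ~: S| <= #|U| by lia.
have := key _ _ e2 e1 (etrans cardU (addnC _ _)) C0 s2' _ p2 p1.
rewrite mE [e1 + e2]addnC => /(_ erefl); nia.
Qed.

End Conductance.

Section Minimal.

Variables (V I : finType) (src dst : I -> V) (lt : rel V) (w : I -> V -> bool) (x : rel I).
Hypothesis simple : forall e f, src e = src f -> dst e = dst f -> e = f.
Hypothesis lt_anti : forall u v, u != v -> lt v u = ~~ lt u v.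
Hypothesis x_formula : forall e f, vdisj src dst e f ->
  x e f = (w e (src f) (+) w e (dst f)) (+) ((w f (src e) (+) w f (dst e))
     (+) ((lt (src f) (src e) (+) lt (src f) (dst e)) (+) (lt (dst f) (src e) (+) lt (dst f) (dst e)))).

Variables (J : {set I}) (c : V -> bool) (conf : rel I) (B : nat).
Hypothesis B_large : 38 <= B.
Hypothesis good : forall e f, e \in J -> f \in J -> vdisj src dst e f -> ~~ conf e f ->
  x e f = (c (src e) (+) c (dst e)) && (c (src f) (+) c (dst f)).

Definition conflicts (U : {set V}) : {set I * I} :=
  [set z in setX (induced src dst J U) (induced src dst J U) | conf z.1 z.2].

(** [expander_bad_pairs] with K = 3 L from [minimal_conductance] and l = 2 L from [lg_sqr]. Pairs
    sharing a vertex make up at most half of the resulting bound, so the other half consists of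
    conflicts. *)
Lemma minimal_conflicts (U : {set V}) :
  (forall U' : {set V}, U' \proper U -> #|induced src dst J U'| <= #|U'| * lg #|U'| ^ B) ->
  #|U| * lg #|U| ^ B < #|induced src dst J U| ->
  #|induced src dst J U| ^ 2 <= lg #|U| ^ 36 * #|conflicts U|.
Proof.
move=> smaller large; set A := induced src dst J U in large *; set L := lg #|U|.
have L2 : 2 <= L by exact: lg_ge2.
pose src' (e : {x in A}) := src (val e); pose dst' (e : {x in A}) := dst (val e).
pose bad (e f : {x in A}) := ~~ vdisj src dst (val e) (val f) || conf (val e) (val f).
have cardA : #|{: {x in A}}| = #|A| by exact: card_subset_type.
have DE : #|{: dart {x in A}}| = 2 * #|A| by rewrite card_prod card_bool cardA mulnC.
have AJ (e : {x in A}) : val e \in J by have := valP e; rewrite inE => /andP [].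
have nonpl := @nonplanar_K33 V {x in A} src' dst' lt (fun e => w (val e))
   (fun e f => x (val e) (val f)) bad c lt_anti (fun e f h => x_formula h).
have {}nonpl := nonpl _.
have {}nonpl : forall (a b : 'I_3 -> V) (p : 'I_3 -> 'I_3 -> seq (step {x in A})),
  (forall i j, p i j != [::] /\ is_walk src' dst' (a i) (p i j) (b j)) ->
  exists i j i' j', [/\ i != i', j != j' & bad_walks bad (p i j) (p i' j')].
  apply: nonpl => e f; rewrite /bad negb_or negbK => /andP [h1 h2]; split => //.
  exact: good.
have cond := minimal_conductance (leq_trans (isT : 0 < 38) B_large) smaller large.
have ex := @expander_bad_pairs rat V {x in A} src' dst' (3 * L) (2 * L) bad _ cond _ nonpl _.
have {}ex := ex _ _ _.
have K0 : 0 < 3 * L by lia.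
have l0 : 0 < 2 * L by lia.
have lbig : 2 * #|{: dart {x in A}}| <= 2 ^ (2 * L).
  rewrite DE; apply: leq_trans (lg_sqr #|U|).
  by have := card_induced_sqr simple J U; rewrite -/A; lia.
have {ex K0 l0 lbig} := ex K0 lbig l0; rewrite cardA.
have walkE : 324 * (32 * (3 * L) ^ 2 * (2 * L)) ^ 2 <= 2 ^ 29 * L ^ 6.
  have -> : 32 * (3 * L) ^ 2 * (2 * L) = 576 * L ^ 3 by rewrite !expnS !expn0 !muln1; lia.
  rewrite expnMn -expnM mulnA leq_mul2r; apply/orP; right.
  rewrite -[29]/(9 + 10 * 2) expnD expnM; apply: leq_mul; first by [].
  by rewrite leq_exp2r.
set bads := #|[set z | bad z.1 z.2]| => H.
have badsE : bads <= #|A| * (4 * #|U|) + #|conflicts U|.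
  apply: leq_trans (leq_add (card_touching simple J U) (leqnn _)).
  apply: leq_trans (leq_card_setU _ _).
  pose vals (z : {x in A} * {x in A}) := (val z.1, val z.2).
  have vals_inj : injective vals by move=> [e f] [e' f'] [] /val_inj -> /val_inj ->.
  rewrite /bads -(card_imset [set z | bad z.1 z.2] vals_inj).
  apply/subset_leq_card/subsetP => z /imsetP [[e f]]; rewrite !inE /= /bad => h ->.
  have := valP e; have := valP f; rewrite !inE /= => -> ->; rewrite !andTb.
  by case/orP: h => ->; rewrite ?orbT.
have pow2 (i j : nat) : 2 ^ i * 2 ^ j * L ^ 6 <= L ^ (i + j + 6).
  by rewrite -expnD (expnD L (i + j) 6) leq_mul2r; case: (i + j) => [|k]; rewrite ?orbT // leq_exp2r // L2 orbT.
(* 8 * 2^29 = 2^32, and 32 + 6 = 38 is the assumed lower bound for B. The exponent 36 below is 1 +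
   29 + 6 in the same way. *)
have big : 8 * (2 ^ 29 * L ^ 6) <= L ^ B.
  rewrite mulnA; apply: leq_trans (pow2 3 29) _.
  by rewrite leq_pexp2l // ltnW.
have L36 : 2 * (2 ^ 29 * L ^ 6) <= L ^ 36 by rewrite mulnA; exact: (pow2 1 29).
have {}H : #|A| ^ 2 <= 2 ^ 29 * L ^ 6 * (#|A| * (4 * #|U|) + #|conflicts U|).
  by apply: leq_trans H _; apply: leq_mul.
move: (2 ^ 29 * L ^ 6) big L36 H {walkE pow2} => l big L36 H.
have mbig : 8 * l * #|U| <= #|A|.
  by apply: leq_trans (ltnW large); rewrite mulnC leq_mul2l big orbT.
apply: (@leq_trans (2 * l * #|conflicts U|)); last by rewrite leq_mul2r L36 orbT.
move: mbig H; rewrite -mulnn; move: #|A| #|U| #|conflicts U| => a u k mbig H.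
have h : l * (a * (4 * u)) * 2 <= a * a.
  apply: leq_trans (leq_mul (leqnn a) mbig); lia.
nia.
Qed.

(* Recursion on vertex subsets: a minimal violating subset is an expander. *)
Lemma induced_bound :
  (forall U : {set V}, #|U| * lg #|U| ^ B < #|induced src dst J U| ->
     #|induced src dst J U| ^ 2 <= lg #|U| ^ 36 * #|conflicts U| -> False) ->
  forall U : {set V}, #|induced src dst J U| <= #|U| * lg #|U| ^ B.
Proof.
move=> contra U; have [n] := ubnP #|U|; elim: n U => // n IH U /ltnSE leUn.
rewrite leqNgt; apply/negP => large; apply: (contra U large); apply: minimal_conflicts => //.
move=> U' /proper_card lt'; apply: IH; exact: leq_trans lt' leUn.
Qed.

End Minimal.

(** * Complete bipartite crossing patterns *)

Lemma sum_card_swap (P Y : finType) (A : {set P}) (D : {set Y}) (Q : P -> Y -> bool) :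
  \sum_(t in D) #|[set p in A | Q p t]| = \sum_(p in A) #|[set t in D | Q p t]|.
Proof.
under eq_bigr => t _ do rewrite -sum1dep_card.
rewrite (exchange_big_dep (fun p => p \in A)) /=; last by move=> t p _ /andP [].
apply: eq_bigr => p pA; rewrite -sum1dep_card.
by apply: eq_bigl => t; rewrite pA.
Qed.

(** Double counting. Each pigeonhole step of the biclique argument, and the choice of a bipartition,
    is an instance. *)
Lemma popular_choice (P Y : finType) (A : {set P}) (D : {set Y}) (Q : P -> Y -> bool) (c : nat) :
  0 < #|D| -> (forall p, p \in A -> #|D| <= c * #|[set t in D | Q p t]|) ->
  exists2 t, t \in D & #|A| <= c * #|[set p in A | Q p t]|.
Proof.
move=> D0 H.
have [/existsP [t /andP [tD ht]] | /existsPn no] :=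
  boolP [exists t, (t \in D) && (#|A| <= c * #|[set p in A | Q p t]|)]; first by exists t.
exfalso.
have lt1 : \sum_(t in D) (c * #|[set p in A | Q p t]|).+1 <= \sum_(t in D) #|A|.
  by apply: leq_sum => t tD; have := no t; rewrite tD /= -ltnNge.
have le2 : \sum_(p in A) #|D| <= \sum_(p in A) c * #|[set t in D | Q p t]|.
  by apply: leq_sum => p; exact: H.
set s := \sum_(t in D) #|[set p in A | Q p t]|.
have E1 : \sum_(t in D) (c * #|[set p in A | Q p t]|).+1 = c * s + #|D|.
  under eq_bigr => t _ do rewrite -addn1.
  by rewrite big_split /= -big_distrr /= sum_nat_const muln1.
have E2 : \sum_(p in A) c * #|[set t in D | Q p t]| = c * s.
  by rewrite -big_distrr /= -sum_card_swap.
move: lt1 le2; rewrite E1 E2 !sum_nat_const mulnC; lia.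
Qed.

Lemma card_fibers (Z W : finType) (h : Z -> W) (P : {set Z}) (X : {set W}) :
  (forall z, z \in P -> h z \in X) -> #|P| = \sum_(x in X) #|[set z in P | h z == x]|.
Proof.
move=> hX; rewrite -sum1_card (partition_big h [in X]) //=.
by apply: eq_bigr => x _; rewrite -sum1dep_card.
Qed.

Lemma low_degree_count (Z W : finType) (h : Z -> W) (P : {set Z}) (X : {set W}) (c : nat) :
  (forall z, z \in P -> h z \in X) ->
  c * #|[set z in P | c * #|[set z' in P | h z' == h z]| < #|X|]| <= #|X| * #|X|.
Proof.
move=> hX; set low := [set z in P | _ < _].
rewrite (@card_fibers _ _ h low X); last by move=> z; rewrite inE => /andP [/hX].
rewrite big_distrr /= -sum_nat_const; apply: leq_sum => x _.
have [lo | hi] := ltnP (c * #|[set z in P | h z == x]|) #|X|.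
  apply: leq_trans (ltnW lo); rewrite leq_mul2l subset_leq_card ?orbT //.
  by apply/subsetP => z; rewrite !inE => /andP [/andP [-> _] ->].
rewrite (_ : [set z in low | h z == x] = set0) ?cards0 ?muln0 //.
apply/setP => z; rewrite !inE; apply/negbTE/negP => /andP [/andP [_ lo] /eqP hz].
by move: lo; rewrite hz ltnNge hi.
Qed.

(** Pairs in rows with fewer than |X| / (3 Q) elements number at most |X|^2 / (3 Q), at most a third
    of P; the same holds for columns, so some pair avoids both kinds. *)
Lemma good_pair (T : finType) (X : {set T}) (P : {set T * T}) (Q : nat) :
  P \subset setX X X -> 0 < #|P| -> #|X| ^ 2 <= Q * #|P| ->
  exists z, [/\ z \in P, #|X| <= 3 * Q * #|[set f | (z.1, f) \in P]| &
                #|X| <= 3 * Q * #|[set e | (e, z.2) \in P]|].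
Proof.
move=> PX P0 dens.
have XP (z : T * T) : z \in P -> z.1 \in X /\ z.2 \in X.
  by case: z => e f /(subsetP PX); rewrite in_setX => /andP.
have rE e : #|[set z in P | z.1 == e]| = #|[set f | (e, f) \in P]|.
  have inj : injective (fun f : T => (e, f)) by move=> f f' [].
  rewrite -(card_imset _ inj).
  apply: eq_card => -[a b]; rewrite !inE /=; apply/andP/imsetP => [[aP /eqP <-] | [f]].
    by exists b; rewrite ?inE.
  by rewrite inE => fP [-> ->].
have lE f : #|[set z in P | z.2 == f]| = #|[set e | (e, f) \in P]|.
  have inj : injective (fun e : T => (e, f)) by move=> e e' [].
  rewrite -(card_imset _ inj).
  apply: eq_card => -[a b]; rewrite !inE /=; apply/andP/imsetP => [[aP /eqP <-] | [e]].
    by exists a; rewrite ?inE.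
  by rewrite inE => eP [-> ->].
pose lowr := [set z in P | 3 * Q * #|[set z' in P | z'.1 == z.1]| < #|X|].
pose lowl := [set z in P | 3 * Q * #|[set z' in P | z'.2 == z.2]| < #|X|].
have [/existsP [z /and3P [h1 h2 h3]] | /existsPn no] :=
  boolP [exists z, [&& z \in P, #|X| <= 3 * Q * #|[set f | (z.1, f) \in P]| &
    #|X| <= 3 * Q * #|[set e | (e, z.2) \in P]|]].
  by exists z.
exfalso.
have cover : P \subset lowr :|: lowl.
  by apply/subsetP => z zP; have := no z; rewrite !inE zP /= !negb_and -!ltnNge rE lE.
have cr := @low_degree_count _ _ fst P X (3 * Q) (fun z h => (XP z h).1).
have cl := @low_degree_count _ _ snd P X (3 * Q) (fun z h => (XP z h).2).
rewrite -/lowr in cr; rewrite -/lowl in cl.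
have [c1 _] := leq_card_setU lowr lowl.
have c2 := leq_trans (subset_leq_card cover) c1.
have /card_gt0P [z /XP [zX _]] := P0.
have X0 : 0 < #|X| by apply/card_gt0P; exists z.1.
have c3 := leq_mul (leqnn (3 * Q)) c2; rewrite mulnDr in c3.
have XX : 0 < #|X| * #|X| by rewrite muln_gt0 X0.
move: dens cr cl c3; rewrite -mulnn -!mulnA; lia.
Qed.

Lemma card_setX_dep (T W : finType) (X : {set T}) (Y : {set W}) (R : T -> W -> bool) :
  #|[set z in setX X Y | R z.1 z.2]| = \sum_(e in X) #|[set f in Y | R e f]|.
Proof.
rewrite -sum1dep_card (eq_bigl (fun z => (z.1 \in X) && (z.2 \in [set f in Y | R z.1 f]))).
  rewrite -(pair_big_dep (fun e => e \in X) (fun e f => f \in [set f in Y | R e f])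
    (fun _ _ => 1)) /=.
  by apply: eq_bigr => e _; rewrite sum1_card.
by case=> e f; rewrite in_setX inE andbA.
Qed.

(** All elements counted are below the largest of them, where fewer than d elements lie, or tied
    with it. *)
Lemma rank_low (T : finType) (S : {set T}) (v : T -> nat) (d h : nat) :
  (forall y, y \in S -> #|[set z in S | v z == v y]| <= h) ->
  #|[set y in S | #|[set z in S | v z < v y]| < d]| <= d + h.
Proof.
move=> H; set L := [set y in S | _].
have [-> | /set0Pn [y0 y0L]] := eqVneq L set0; first by rewrite cards0.
have [y yL ymax] := @arg_maxnP _ y0 [in L] v y0L.
have {}yL : y \in L := yL.
have := yL; rewrite inE => /andP [yS cy].
have sub : L \subset [set z in S | v z < v y] :|: [set z in S | v z == v y].
  apply/subsetP => z zL; have := ymax z zL; have := zL.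
  by rewrite !inE => /andP [-> _] /=; rewrite leq_eqVlt orbC.
apply: leq_trans (subset_leq_card sub) _; apply: leq_trans (leq_card_setU _ _) _.
by rewrite leq_add // ?H // ltnW.
Qed.

Lemma rank_high (T : finType) (S : {set T}) (v : T -> nat) (d h : nat) :
  (forall y, y \in S -> #|[set z in S | v z == v y]| <= h) ->
  #|[set y in S | #|[set z in S | v y < v z]| < d]| <= d + h.
Proof.
move=> H; pose N := \max_z v z.
have leN z : v z <= N by exact: leq_bigmax.
have ltE y z : (N - v z < N - v y) = (v y < v z) by have := leN z; have := leN y; lia.
have eqE y z : (N - v z == N - v y) = (v z == v y).
  by have := leN z; have := leN y; move=> *; apply/eqP/eqP; lia.
have := @rank_low T S (fun z => N - v z) d h.
have -> : [set y in S | #|[set z in S | N - v z < N - v y]| < d] =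
   [set y in S | #|[set z in S | v y < v z]| < d].
  apply/setP => y; rewrite !inE; congr (_ && (_ < d)); apply: eq_card => z.
  by rewrite !inE ltE.
apply=> y yS; apply: leq_trans (H y yS); apply: eq_leq; apply: eq_card => z.
by rewrite !inE eqE.
Qed.

Definition hulln (a b x : nat) : bool := (a <= x <= b) || (b <= x <= a).
Definition btw (a t b : nat) : bool := (a < t < b) || (b < t < a).

Section Biclique.

Variables (I : finType) (cr : rel I) (pos : I -> I -> nat).
Hypothesis cr_sym : symmetric cr.
Hypothesis concurrent : forall w e f, cr w e -> cr w f -> e != f -> pos w e = pos w f ->
  cr e f /\ pos e f = pos e w.

Definition innerb (w1 w2 w3 w4 e f : I) : bool :=
  [&& cr e f, pos e w1 < pos e f < pos e w2 & pos f w3 < pos f e < pos f w4].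

Hypothesis four : forall e e' f f' w1 w2 w3 w4 : I,
  (forall g, g = e \/ g = e' -> [/\ cr g w1, cr g w2 & pos g w1 < pos g w2]) ->
  (forall g, g = f \/ g = f' -> [/\ cr g w3, cr g w4 & pos g w3 < pos g w4]) ->
  (forall g g', g = e \/ g = e' -> g' = f \/ g' = f' -> g != g') ->
  (forall g w, g = f \/ g = f' -> w = w1 \/ w = w2 ->
     g != w /\ (cr w g -> ~~ hulln (pos w e) (pos w e') (pos w g))) ->
  (forall g w, g = e \/ g = e' -> w = w3 \/ w = w4 ->
     g != w /\ (cr w g -> ~~ hulln (pos w f) (pos w f') (pos w g))) ->
  (forall w v, w = w1 \/ w = w2 -> v = w3 \/ v = w4 ->
     cr w v -> hulln (pos w e) (pos w e') (pos w v) -> ~~ hulln (pos v f) (pos v f') (pos v w)) ->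
  innerb w1 w2 w3 w4 e f (+) innerb w1 w2 w3 w4 e f' (+)
  innerb w1 w2 w3 w4 e' f (+) innerb w1 w2 w3 w4 e' f' = false.

Variable X : {set I}.
Let m := #|X|.

Definition crossings : {set I * I} := [set z in setX X X | cr z.1 z.2].

Section Counting.

Variables (q d d' : nat).
Hypothesis q_gt0 : 0 < q.
Hypothesis d_gt0 : 0 < d.
Hypothesis d_small : 32 * q * d <= m.
Hypothesis d'_small : 64 * q * d' <= d.
Hypothesis dense : m ^ 2 <= q * #|crossings|.
Hypothesis light : forall w e, w \in X -> e \in X -> cr w e ->
  #|[set f in X | cr w f && (pos w f == pos w e)]| <= d'.

Definition before (e f : I) : bool := d <= #|[set w in X | cr e w && (pos e w < pos e f)]|.
Definition after (e f : I) : bool := d <= #|[set w in X | cr e w && (pos e f < pos e w)]|.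
(** Too few edges cross w between e and f to serve as separators; compare [sep_count]. *)
Definition close (w e f : I) : bool :=
  [&& cr w e, cr w f & #|[set t in X | cr w t && btw (pos w e) (pos w t) (pos w f)]| < d'].
Definition rarely_close (e f : I) : bool := 2 * #|[set w in X | close w e f]| <= d.

Definition good_pairs : {set I * I} :=
  [set z in crossings | [&& before z.1 z.2, after z.1 z.2, before z.2 z.1, after z.2 z.1
     & rarely_close z.1 z.2]].

Lemma d'_le_d : d' <= d.
Proof. by apply: leq_trans d'_small; rewrite leq_pmull // muln_gt0. Qed.

Lemma not_before_le e : e \in X -> #|[set f in X | cr e f && ~~ before e f]| <= 2 * d.
Proof.
move=> eX; rewrite mul2n -addnn.
have := @rank_low I [set f in X | cr e f] (pos e) d d'; set A := [set y in _ | _] => H.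
apply: leq_trans (leq_trans (H _) (leq_add (leqnn d) d'_le_d)).
  apply: subset_leq_card; apply/subsetP => f; rewrite !inE -ltnNge => /and3P [-> -> /=].
  by congr (_ < d); apply: eq_card => z; rewrite !inE andbA.
move=> y; rewrite inE => /andP [yX cy]; apply: leq_trans (light eX yX cy).
by apply: eq_leq; apply: eq_card => z; rewrite !inE andbA.
Qed.

Lemma not_after_le e : e \in X -> #|[set f in X | cr e f && ~~ after e f]| <= 2 * d.
Proof.
move=> eX; rewrite mul2n -addnn.
have := @rank_high I [set f in X | cr e f] (pos e) d d'; set A := [set y in _ | _] => H.
apply: leq_trans (leq_trans (H _) (leq_add (leqnn d) d'_le_d)).
  apply: subset_leq_card; apply/subsetP => f; rewrite !inE -ltnNge => /and3P [-> -> /=].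
  by congr (_ < d); apply: eq_card => z; rewrite !inE andbA.
move=> y; rewrite inE => /andP [yX cy]; apply: leq_trans (light eX yX cy).
by apply: eq_leq; apply: eq_card => z; rewrite !inE andbA.
Qed.

(** At most 2 d' on each side of e by the rank lemmas, where ties are bounded by [light], and d'
    tied with e itself. *)
Lemma close_le w e : w \in X -> e \in X -> #|[set f in X | close w e f]| <= 5 * d'.
Proof.
move=> wX eX; have [we | nwe] := boolP (cr w e); last first.
  rewrite (_ : [set f in X | _] = set0) ?cards0 //.
  by apply/setP => f; rewrite !inE /close (negPf nwe) andbF.
pose Up := [set f in X | cr w f && (pos w e < pos w f)].
pose Dn := [set f in X | cr w f && (pos w f < pos w e)].
have lightS (S : {set I}) : S \subset [set f in X | cr w f] ->
    forall y, y \in S -> #|[set z in S | pos w z == pos w y]| <= d'.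
  move=> /subsetP SX y /SX; rewrite inE => /andP [yX cy]; apply: leq_trans (light wX yX cy).
  apply: subset_leq_card; apply/subsetP => z; rewrite !inE => /andP [/SX].
  by rewrite inE => /andP [-> ->] ->.
have uS : Up \subset [set f in X | cr w f].
  by apply/subsetP => f; rewrite !inE => /and3P [-> ->].
have dS : Dn \subset [set f in X | cr w f].
  by apply/subsetP => f; rewrite !inE => /and3P [-> ->].
have hU := rank_low d' (lightS _ uS).
have hD := rank_high d' (lightS _ dS).
have hE := light wX eX we.
set SU := [set y in Up | _] in hU; set SD := [set y in Dn | _] in hD.
set SE := [set f in X | _ && (_ == _)] in hE.
have sub : [set f in X | close w e f] \subset SU :|: SD :|: SE.
  apply/subsetP => f; rewrite inE => /andP [fX /and3P [_ wf cf]].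
  have [lt | gt | eq] := ltngtP (pos w e) (pos w f).
  - apply/setUP; left; apply/setUP; left; rewrite !inE fX wf lt /=.
    apply: leq_ltn_trans cf; apply: subset_leq_card; apply/subsetP => z; rewrite !inE /btw.
    by case/andP => /and3P [-> -> ->] ->.
  - apply/setUP; left; apply/setUP; right; rewrite !inE fX wf gt /=.
    apply: leq_ltn_trans cf; apply: subset_leq_card; apply/subsetP => z; rewrite !inE /btw.
    by case/andP => /and3P [-> -> ->] ->; rewrite orbT.
  - by apply/setUP; right; rewrite inE fX wf eq eqxx.
have c0 := subset_leq_card sub.
have [c1 _] := leq_card_setU (SU :|: SD) SE; have [c2 _] := leq_card_setU SU SD.
lia.
Qed.

(** At most 8 m d crossings fail one of the four order conditions, and at most 10 m^2 d' / d pairs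
    fail to be rarely close. By the choice of 32 and 64 in [d_small] and [d'_small], each count is
    at most m^2 / (4 q). *)
Lemma good_pairs_dense : m ^ 2 <= 2 * q * #|good_pairs|.
Proof.
pose nb (R : rel I) := [set z in setX X X | cr z.1 z.2 && ~~ R z.1 z.2].
pose nc := [set z in setX X X | ~~ rarely_close z.1 z.2].
have sumd (F : I -> nat) : (forall e, e \in X -> F e <= 2 * d) -> \sum_(e in X) F e <= m * (2 * d).
  by move=> h; rewrite -sum_nat_const; apply: leq_sum.
have n1 : #|nb before| <= m * (2 * d).
  rewrite /nb (card_setX_dep X X (fun e f => cr e f && ~~ before e f)).
  by apply: sumd => e; exact: not_before_le.
have n2 : #|nb after| <= m * (2 * d).
  rewrite /nb (card_setX_dep X X (fun e f => cr e f && ~~ after e f)).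
  by apply: sumd => e; exact: not_after_le.
have n3 : #|nb (fun e f => before f e)| <= m * (2 * d).
  rewrite /nb (card_setX_dep X X (fun e f => cr e f && ~~ before f e)) -sum_card_swap.
  apply: sumd => e eX; apply: leq_trans (not_before_le eX); apply: eq_leq; apply: eq_card => f.
  by rewrite !inE cr_sym.
have n4 : #|nb (fun e f => after f e)| <= m * (2 * d).
  rewrite /nb (card_setX_dep X X (fun e f => cr e f && ~~ after f e)) -sum_card_swap.
  apply: sumd => e eX; apply: leq_trans (not_after_le eX); apply: eq_leq; apply: eq_card => f.
  by rewrite !inE cr_sym.
have n5 : d * #|nc| <= 10 * d' * (m * m).
  have -> : d * #|nc| = \sum_(z in nc) d by rewrite sum_nat_const mulnC.
  apply: (@leq_trans (\sum_(z in setX X X) 2 * #|[set w in X | close w z.1 z.2]|)).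
    rewrite [X in _ <= X](big_setID nc) /=.
    apply: leq_trans (leq_addr _ _).
    rewrite (setIidPr _); last by apply/subsetP => z; rewrite inE => /andP [].
    by apply: leq_sum => z; rewrite inE => /andP [_]; rewrite /rarely_close -ltnNge => /ltnW.
  rewrite -big_distrr /= -(sum_card_swap (setX X X) X (fun z w => close w z.1 z.2)).
  have -> : 10 * d' * (m * m) = 2 * (m * (m * (5 * d'))) by lia.
  rewrite leq_mul2l /= -sum_nat_const; apply: leq_sum => w wX.
  rewrite (card_setX_dep X X (close w)) -sum_nat_const; apply: leq_sum => e eX.
  exact: close_le.
have cover : crossings \subset good_pairs :|: ((nb before :|: nb after) :|:
    ((nb (fun e f => before f e) :|: nb (fun e f => after f e)) :|: nc)).
  apply/subsetP => z zC; have := zC; rewrite inE => /andP [zX cz].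
  move: zX; rewrite inE => /andP [zX1 zX2].
  rewrite /good_pairs /nb /nc !in_setU !in_set zX1 zX2 cz /=.
  case: (before z.1 z.2); case: (after z.1 z.2); case: (before z.2 z.1); case: (after z.2 z.1);
    by rewrite /= ?orbT //; case: (rarely_close _ _).
have U0 := subset_leq_card cover.
have [U1 _] := leq_card_setU good_pairs ((nb before :|: nb after) :|:
    ((nb (fun e f => before f e) :|: nb (fun e f => after f e)) :|: nc)).
have [U2 _] := leq_card_setU (nb before :|: nb after)
    ((nb (fun e f => before f e) :|: nb (fun e f => after f e)) :|: nc).
have [U3 _] := leq_card_setU (nb before) (nb after).
have [U4 _] := leq_card_setU (nb (fun e f => before f e) :|: nb (fun e f => after f e)) nc.
have [U5 _] := leq_card_setU (nb (fun e f => before f e)) (nb (fun e f => after f e)).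
have tot : #|crossings| <= #|good_pairs| + (8 * (m * d) + #|nc|).
  apply: leq_trans U0 _; apply: leq_trans U1 _; rewrite leq_add2l.
  apply: leq_trans U2 _; apply: leq_trans (leq_add U3 U4) _.
  apply: leq_trans (leq_add (leq_add n1 n2) (leq_add (leq_trans U5 (leq_add n3 n4)) (leqnn _))) _.
  lia.
have q1 : 4 * q * (8 * (m * d)) <= m * m.
  by have := leq_mul (leqnn m) d_small; lia.
have q2 : 4 * q * #|nc| <= m * m.
  rewrite -(leq_pmul2l d_gt0).
  have := leq_mul (leqnn (4 * q)) n5; have := leq_mul d'_small (leqnn (m * m)).
  move: (m * m) #|nc| => mm c; lia.
have := leq_mul (leqnn (4 * q)) tot.
move: dense q1 q2; rewrite -mulnn !mulnDr; lia.
Qed.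

(* How the crossings of [w] with the [e] are separated from those with the [f]: either no [f] crosses
   [w] ([o = 0]), or the edge [t] crosses [w] between them. *)
Definition near_side (o : 'I_3) (w t e : I) : bool :=
  match nat_of_ord o with 0 => true | 1 => pos w e < pos w t | _ => pos w t < pos w e end.

Definition far_side (o : 'I_3) (w t f : I) : bool :=
  match nat_of_ord o with
  | 0 => ~~ cr w f
  | 1 => cr w f && (pos w t < pos w f)
  | _ => cr w f && (pos w f < pos w t)
  end.

(** Fixing the side of v on which the e cross w keeps the crossing of w and v out of the part of w
    between two such e, except in mode 1, where e, v and w pass through one point. *)
Definition order_mode (o : 'I_3) (w v e : I) : bool :=
  match nat_of_ord o with 0 => pos w e < pos w v | 1 => pos w e == pos w v | _ => pos w v < pos w e end.

Lemma near_far_side_hull o w t e e' f : near_side o w t e -> near_side o w t e' -> far_side o w t f -> cr w f ->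
  ~~ hulln (pos w e) (pos w e') (pos w f).
Proof.
rewrite /near_side /far_side /hulln; case: (nat_of_ord o) => [|[|k]].
- by move=> _ _ /negPf ->.
- by move=> h1 h2 /andP [_ h3] _; lia.
- by move=> h1 h2 /andP [_ h3] _; lia.
Qed.

Lemma near_far_side_neq o w t e f : cr w e -> near_side o w t e -> far_side o w t f -> e != f.
Proof.
move=> we; rewrite /near_side /far_side; case: (nat_of_ord o) => [|[|k]] => [_ | h1 /andP [_ h2] | h1 /andP [_ h2]].
- by apply: contraNneq => <-.
- by apply/eqP => ef; subst f; lia.
- by apply/eqP => ef; subst f; lia.
Qed.

Lemma order_mode_hull r w v e e' : order_mode r w v e -> order_mode r w v e' ->
  hulln (pos w e) (pos w e') (pos w v) -> pos w e = pos w v.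
Proof. by rewrite /order_mode /hulln; case: (nat_of_ord r) => [|[|k]]; lia. Qed.

Lemma btwC a t b : btw a t b = btw b t a.
Proof. by rewrite /btw orbC. Qed.

Lemma closeC w e f : close w e f = close w f e.
Proof.
rewrite /close andbCA; congr [&& _, _ & _ < d']; apply: eq_card => t.
by rewrite !inE btwC.
Qed.

Hypothesis d'_gt0 : 0 < d'.
Hypothesis m_le : m <= 64 * q * d.
Hypothesis d_le : d <= 128 * q * d'.

Let modes : {set 'I_3 * I} := setX setT X.

Lemma d'_le_m : d' <= m.
Proof.
apply: leq_trans d'_le_d _; apply: leq_trans d_small; by rewrite leq_pmull // muln_gt0.
Qed.

(** If f misses w, mode 0 works with every t in X; otherwise each of the at least d' edges crossing
    w between e and f is a separator. *)
Lemma sep_count w e f : cr w e -> ~~ close w e f ->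
  d' <= #|[set y in modes | near_side y.1 w y.2 e && far_side y.1 w y.2 f]|.
Proof.
move=> we nclose.
have inj (o : 'I_3) : injective (fun t : I => (o, t)) by move=> t t' [].
have [wf | nwf] := boolP (cr w f); last first.
  apply: leq_trans d'_le_m _; rewrite /m -(card_imset _ (inj ord0)).
  apply: subset_leq_card; apply/subsetP => y /imsetP [t tX ->].
  by rewrite !inE tX /near_side /far_side /= nwf.
move: nclose; rewrite /close we wf /= -leqNgt => h; apply: leq_trans h _.
have sel (o : 'I_3) : (forall t, btw (pos w e) (pos w t) (pos w f) -> near_side o w t e && far_side o w t f) ->
    #|[set t in X | cr w t && btw (pos w e) (pos w t) (pos w f)]| <=
    #|[set y in modes | near_side y.1 w y.2 e && far_side y.1 w y.2 f]|.
  move=> ho; rewrite -(card_imset _ (inj o)); apply: subset_leq_card; apply/subsetP => y.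
  by case/imsetP => t; rewrite !inE => /and3P [tX _ /ho h] ->; rewrite /= tX.
have [lt | gt] := leqP (pos w e) (pos w f).
  apply: (sel (inord 1)) => t; rewrite /near_side /far_side inordK // wf /btw; lia.
apply: (sel (inord 2)) => t; rewrite /near_side /far_side inordK // wf /btw; lia.
Qed.

(** At least d - d/2 candidates remain after removal of the close ones, and d/2 is at least m / (128
    q). *)
Lemma popular_count (R : I -> bool) e f : rarely_close e f -> d <= #|[set w in X | R w]| ->
  #|X| <= 128 * q * #|[set w in X | R w && ~~ close w e f]|.
Proof.
rewrite /rarely_close => hc hR.
have sub : [set w in X | R w] \subset [set w in X | R w && ~~ close w e f] :|:
    [set w in X | close w e f].
  apply/subsetP => w; rewrite !inE => /andP [-> ->] /=; by case: (close w e f).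
have h0 := subset_leq_card sub.
have [h1 _] := leq_card_setU [set w in X | R w && ~~ close w e f] [set w in X | close w e f].
apply: leq_trans m_le _.
have -> : 128 = 64 * 2 by [].
rewrite -!mulnA leq_mul2l /= mulnCA leq_mul2l; apply/orP; right.
move: hR h0 h1 hc; move: #|_ :|: _| #|[set w in X | R w]| => u v; lia.
Qed.

(** One factor for each restriction of the set of pairs: good pairs, the edges w1 to w4, their four
    separators with modes, and the four order modes. *)
Definition loss : nat := 2 * q * (128 * q) ^ 4 * (3 * (64 * q) * (128 * q)) ^ 4 * 3 ^ 4.

(** After twelve pigeonhole choices the surviving edges satisfy all assumptions of [four]. A
    surviving pair (e0, f0) with large row and column is fixed; if (e0, f0), (e0, f) and (e, f0)
    cross on the inner parts, parity forces the same for (e, f). *)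
Lemma biclique_light : exists A B : {set I}, [/\ A \subset X, B \subset X,
  forall e f, e \in A -> f \in B -> cr e f, m <= 3 * loss * #|A| & m <= 3 * loss * #|B|].
Proof.
have m_gt0 : 0 < m by apply: leq_trans d'_gt0 d'_le_m.
have dens0 := good_pairs_dense.
pose Q1 (z : I * I) w := (cr z.1 w && (pos z.1 w < pos z.1 z.2)) && ~~ close w z.1 z.2.
pose Q2 (z : I * I) w := (cr z.1 w && (pos z.1 z.2 < pos z.1 w)) && ~~ close w z.1 z.2.
pose Q3 (z : I * I) w := (cr z.2 w && (pos z.2 w < pos z.2 z.1)) && ~~ close w z.1 z.2.
pose Q4 (z : I * I) w := (cr z.2 w && (pos z.2 z.1 < pos z.2 w)) && ~~ close w z.1 z.2.
have G0 z : z \in good_pairs -> [/\ z.1 \in X, z.2 \in X, cr z.1 z.2 &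
   [/\ before z.1 z.2, after z.1 z.2, before z.2 z.1, after z.2 z.1 & rarely_close z.1 z.2]].
  by rewrite !inE => /andP [/andP [/andP [h1 h2] h3] /and5P [h4 h5 h6 h7 h8]].
have [w1 w1X dens1] := @popular_choice _ _ good_pairs X Q1 (128 * q) m_gt0
  (fun z zG => let: And4 _ _ _ (And5 h4 h5 h6 h7 h8) := G0 z zG in popular_count h8 h4).
set P1 := [set p in good_pairs | Q1 p w1] in dens1.
have S1 z : z \in P1 -> z \in good_pairs by rewrite inE => /andP [].
have [w2 w2X dens2] := @popular_choice _ _ P1 X Q2 (128 * q) m_gt0
  (fun z zG => let: And4 _ _ _ (And5 h4 h5 h6 h7 h8) := G0 z (S1 z zG) in popular_count h8 h5).
set P2 := [set p in P1 | Q2 p w2] in dens2.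
have S2 z : z \in P2 -> z \in P1 by rewrite inE => /andP [].
have [w3 w3X dens3] := @popular_choice _ _ P2 X Q3 (128 * q) m_gt0
  (fun z zG => let: And4 _ _ _ (And5 h4 h5 h6 h7 h8) := G0 z (S1 z (S2 z zG)) in popular_count h8 h6).
set P3 := [set p in P2 | Q3 p w3] in dens3.
have S3 z : z \in P3 -> z \in P2 by rewrite inE => /andP [].
have [w4 w4X dens4] := @popular_choice _ _ P3 X Q4 (128 * q) m_gt0
  (fun z zG => let: And4 _ _ _ (And5 h4 h5 h6 h7 h8) := G0 z (S1 z (S2 z (S3 z zG))) in popular_count h8 h7).
set P4 := [set p in P3 | Q4 p w4] in dens4.
have H4 z : z \in P4 -> [/\ z \in good_pairs, Q1 z w1, Q2 z w2, Q3 z w3 & Q4 z w4].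
  rewrite inE => /andP [z3 q4]; have := z3; rewrite inE => /andP [z2 q3].
  have := z2; rewrite inE => /andP [z1 q2]; have := z1; rewrite inE => /andP [z0 q1].
  by split.
have chain0 c k : k <= c ^ 0 * k by rewrite mul1n.
have chain c n k1 k2 k3 : k1 <= c * k2 -> k2 <= c ^ n * k3 -> k1 <= c ^ n.+1 * k3.
  by move=> h1 h2; apply: leq_trans h1 _; rewrite expnS -mulnA leq_mul2l h2 orbT.
have {}dens4 : m ^ 2 <= 2 * q * (128 * q) ^ 4 * #|P4|.
  apply: leq_trans dens0 _; rewrite -[X in _ <= X]mulnA leq_mul2l; apply/orP; right.
  exact: (chain _ _ _ _ _ dens1 (chain _ _ _ _ _ dens2 (chain _ _ _ _ _ dens3
    (chain _ _ _ _ _ dens4 (chain0 _ _))))).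
set c2 := 3 * (64 * q) * (128 * q).
have modes_card k : d' <= k -> #|modes| <= c2 * k.
  move=> hk; rewrite cardsX cardsT card_ord -/m; apply: (@leq_trans (c2 * d')).
    rewrite /c2 -!mulnA leq_mul2l /=; apply: leq_trans m_le _.
    by rewrite -mulnA leq_mul2l /= leq_mul2l mulnA d_le orbT.
  by rewrite leq_mul2l hk orbT.
have modes_gt0 : 0 < #|modes| by rewrite cardsX cardsT card_ord muln_gt0.
have h5 z : z \in P4 ->
    #|modes| <= c2 * #|[set y in modes | near_side y.1 w1 y.2 z.1 && far_side y.1 w1 y.2 z.2]|.
  move=> /H4 [zG /andP [/andP [h1 h2] h3] _ _ _]; apply: modes_card; apply: sep_count => //.
  by rewrite cr_sym.
have [[o1 t1] _ dens5] := @popular_choice _ _ P4 modes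
  (fun z y => near_side y.1 w1 y.2 z.1 && far_side y.1 w1 y.2 z.2) c2 modes_gt0 h5.
set P5 := [set p in P4 | _] in dens5.
have D5 z (h : z \in P5) := andP (etrans (esym (in_set _ z)) h).
have h6 z : z \in P5 ->
    #|modes| <= c2 * #|[set y in modes | near_side y.1 w2 y.2 z.1 && far_side y.1 w2 y.2 z.2]|.
  move=> /D5 [/H4 [zG _ /andP [/andP [h1 h2] h3] _ _] _].
  by apply: modes_card; apply: sep_count => //; rewrite cr_sym.
have [[o2 t2] _ dens6] := @popular_choice _ _ P5 modes
  (fun z y => near_side y.1 w2 y.2 z.1 && far_side y.1 w2 y.2 z.2) c2 modes_gt0 h6.
set P6 := [set p in P5 | _] in dens6.
have D6 z (h : z \in P6) := andP (etrans (esym (in_set _ z)) h).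
have h7 z : z \in P6 ->
    #|modes| <= c2 * #|[set y in modes | near_side y.1 w3 y.2 z.2 && far_side y.1 w3 y.2 z.1]|.
  move=> /D6 [/D5 [/H4 [zG _ _ /andP [/andP [h1 h2] h3] _] _] _].
  by apply: modes_card; apply: sep_count; [rewrite cr_sym | rewrite closeC].
have [[o3 t3] _ dens7] := @popular_choice _ _ P6 modes
  (fun z y => near_side y.1 w3 y.2 z.2 && far_side y.1 w3 y.2 z.1) c2 modes_gt0 h7.
set P7 := [set p in P6 | _] in dens7.
have D7 z (h : z \in P7) := andP (etrans (esym (in_set _ z)) h).
have h8 z : z \in P7 ->
    #|modes| <= c2 * #|[set y in modes | near_side y.1 w4 y.2 z.2 && far_side y.1 w4 y.2 z.1]|.
  move=> /D7 [/D6 [/D5 [/H4 [zG _ _ _ /andP [/andP [h1 h2] h3]] _] _] _].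
  by apply: modes_card; apply: sep_count; [rewrite cr_sym | rewrite closeC].
have [[o4 t4] _ dens8] := @popular_choice _ _ P7 modes
  (fun z y => near_side y.1 w4 y.2 z.2 && far_side y.1 w4 y.2 z.1) c2 modes_gt0 h8.
set P8 := [set p in P7 | _] in dens8.
have D8 z (h : z \in P8) := andP (etrans (esym (in_set _ z)) h).
have order_mode_count w v e : #|[set: 'I_3]| <= 3 * #|[set o in [set: 'I_3] | order_mode o w v e]|.
  rewrite cardsT card_ord -[X in X <= _]muln1 leq_mul2l /=; apply/card_gt0P.
  have [lt | gt | eq] := ltngtP (pos w e) (pos w v).
  - by exists (inord 0); rewrite !inE /order_mode inordK.
  - by exists (inord 2); rewrite !inE /order_mode inordK.
  - by exists (inord 1); rewrite !inE /order_mode inordK // eq eqxx.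
have I3 : 0 < #|[set: 'I_3]| by rewrite cardsT card_ord.
have [r13 _ dens9] := @popular_choice _ _ P8 [set: 'I_3] (fun z o => order_mode o w1 w3 z.1) 3 I3
  (fun z _ => order_mode_count w1 w3 z.1).
set P9 := [set p in P8 | _] in dens9.
have D9 z (h : z \in P9) := andP (etrans (esym (in_set _ z)) h).
have [r14 _ dens10] := @popular_choice _ _ P9 [set: 'I_3] (fun z o => order_mode o w1 w4 z.1) 3 I3
  (fun z _ => order_mode_count w1 w4 z.1).
set P10 := [set p in P9 | _] in dens10.
have D10 z (h : z \in P10) := andP (etrans (esym (in_set _ z)) h).
have [r23 _ dens11] := @popular_choice _ _ P10 [set: 'I_3] (fun z o => order_mode o w2 w3 z.1) 3 I3
  (fun z _ => order_mode_count w2 w3 z.1).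
set P11 := [set p in P10 | _] in dens11.
have D11 z (h : z \in P11) := andP (etrans (esym (in_set _ z)) h).
have [r24 _ dens12] := @popular_choice _ _ P11 [set: 'I_3] (fun z o => order_mode o w2 w4 z.1) 3 I3
  (fun z _ => order_mode_count w2 w4 z.1).
set P12 := [set p in P11 | _] in dens12.
have D12 z (h : z \in P12) := andP (etrans (esym (in_set _ z)) h).
have dens : m ^ 2 <= loss * #|P12|.
  have -> : loss * #|P12| = 2 * q * (128 * q) ^ 4 * (c2 ^ 4 * (3 ^ 4 * #|P12|)).
    by rewrite /loss -/c2 !mulnA.
  apply: leq_trans dens4 _; rewrite leq_mul2l; apply/orP; right.
  apply: leq_trans (chain _ _ _ _ _ dens5 (chain _ _ _ _ _ dens6 (chain _ _ _ _ _ dens7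
    (chain _ _ _ _ _ dens8 (chain0 _ _))))) _.
  rewrite leq_mul2l; apply/orP; right.
  exact: (chain _ _ _ _ _ dens9 (chain _ _ _ _ _ dens10 (chain _ _ _ _ _ dens11
    (chain _ _ _ _ _ dens12 (chain0 _ _))))).
pose alpha e := [&& e \in X, [&& cr e w1, cr e w2, pos e w1 < pos e w2, e != w3 & e != w4],
  [&& near_side o1 w1 t1 e, near_side o2 w2 t2 e, far_side o3 w3 t3 e & far_side o4 w4 t4 e] &
  [&& order_mode r13 w1 w3 e, order_mode r14 w1 w4 e, order_mode r23 w2 w3 e & order_mode r24 w2 w4 e]].
pose beta f := [&& f \in X, [&& cr f w3, cr f w4, pos f w3 < pos f w4, f != w1 & f != w2] &
  [&& far_side o1 w1 t1 f, far_side o2 w2 t2 f, near_side o3 w3 t3 f & near_side o4 w4 t4 f]].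
have ab z : z \in P12 -> [/\ alpha z.1, beta z.2 & innerb w1 w2 w3 w4 z.1 z.2].
  move=> /D12 [/D11 [/D10 [/D9 [/D8 [/D7 [/D6 [/D5 [/H4 [zG q1 q2 q3 q4]
    /andP [s1 s1']] /andP [s2 s2']] /andP [s3 s3']] /andP [s4 s4']] tr1] tr2] tr3] tr4].
  have [z1X z2X cz _] := G0 z zG.
  move: q1 q2 q3 q4 => /andP [/andP [c1 p1] _] /andP [/andP [c2' p2] _] /andP [/andP [c3 p3] _]
    /andP [/andP [c4 p4] _].
  split.
  - rewrite /alpha z1X c1 c2' (ltn_trans p1 p2) s1 s2 s3' s4' tr1 tr2 tr3 tr4 /= !andbT.
    by apply/andP; split; apply/eqP => E; [move: p3; rewrite -E ltnn | move: p4; rewrite -E ltnn].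
  - rewrite /beta z2X c3 c4 (ltn_trans p3 p4) s3 s4 s1' s2' /= !andbT.
    by apply/andP; split; apply/eqP => E; [move: p1; rewrite -E ltnn | move: p2; rewrite -E ltnn].
  - by rewrite /innerb cz p1 p2 p3 p4.
have P12X : P12 \subset setX X X.
  apply/subsetP => -[e f] /ab [/= /and4P [eX _ _ _] /and3P [fX _ _] _].
  by rewrite in_setX eX fX.
have P0 : 0 < #|P12|.
  by rewrite lt0n; apply/negP => /eqP E; move: dens; rewrite E muln0 leqn0 expn_eq0 /= andbT => /eqP E'; move: m_gt0; rewrite E'.
have [[e0 f0] [zP hr hl]] := good_pair P12X P0 dens.
have [/= ae0 bf0 in0] := ab _ zP.
pose A := [set e | alpha e && innerb w1 w2 w3 w4 e f0].
pose B := [set f | beta f && innerb w1 w2 w3 w4 e0 f].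
exists A, B; split.
- by apply/subsetP => e; rewrite inE => /andP [/and4P []].
- by apply/subsetP => f; rewrite inE => /andP [/and3P []].
- move=> e f; rewrite !inE => /andP [ae ie] /andP [bf jf].
  suff : innerb w1 w2 w3 w4 e f by case/and3P.
  have par : innerb w1 w2 w3 w4 e0 f0 (+) innerb w1 w2 w3 w4 e0 f (+)
     innerb w1 w2 w3 w4 e f0 (+) innerb w1 w2 w3 w4 e f = false.
    have aE g : g = e0 \/ g = e -> alpha g by case=> ->.
    have bF g : g = f0 \/ g = f -> beta g by case=> ->.
    apply: four.
    + by move=> g /aE /and4P [_ /and5P [h1 h2 h3 _ _] _ _].
    + by move=> g /bF /and3P [_ /and5P [h1 h2 h3 _ _] _].
    + move=> g g' /aE /and4P [_ /and5P [h1 _ _ _ _] /and4P [h2 _ _ _] _]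
        /bF /and3P [_ _ /and4P [h3 _ _ _]].
      by apply: (near_far_side_neq _ h2 h3); rewrite cr_sym.
    + move: ae0 ae => /and4P [_ _ /and4P [x1 x2 _ _] _] /and4P [_ _ /and4P [y1 y2 _ _] _].
      move=> g w /bF /and3P [_ /and5P [_ _ _ h1 h2] /and4P [h3 h4 _ _]] [-> | ->]; split => //.
        exact: (near_far_side_hull x1 y1 h3).
      exact: (near_far_side_hull x2 y2 h4).
    + move: bf0 bf => /and3P [_ _ /and4P [_ _ x3 x4]] /and3P [_ _ /and4P [_ _ y3 y4]].
      move=> g w /aE /and4P [_ /and5P [_ _ _ h1 h2] /and4P [_ _ h3 h4] _] [-> | ->]; split => //.
        exact: (near_far_side_hull x3 y3 h3).
      exact: (near_far_side_hull x4 y4 h4).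
    (* If w crosses v between e0 and e, the order mode makes e0, v and w concurrent. So w crosses v
       where e0 does, and there v has been separated from the crossings with f0 and f. *)
    + have key r w v o t : cr w e0 -> e0 != v -> order_mode r w v e0 -> order_mode r w v e -> far_side o v t e0 ->
          near_side o v t f0 -> near_side o v t f -> cr w v ->
          hulln (pos w e0) (pos w e) (pos w v) -> ~~ hulln (pos v f0) (pos v f) (pos v w).
        move=> we0 nv tr0 tr1 sb0 sa0 sa1 wv hl0.
        have eqp := order_mode_hull tr0 tr1 hl0.
        rewrite eq_sym in nv; have [ve0 pv] := concurrent wv we0 nv (esym eqp).
        by rewrite -pv; exact: (near_far_side_hull sa0 sa1 sb0 ve0).
      move: ae0 ae => /and4P [_ /and5P [a1 a2 _ a3 a4] /and4P [_ _ b3 b4] /and4P [u1 u2 u3 u4]].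
      move=> /and4P [_ _ _ /and4P [v1 v2 v3 v4]].
      move: bf0 bf => /and3P [_ _ /and4P [_ _ x3 x4]] /and3P [_ _ /and4P [_ _ y3 y4]].
      rewrite cr_sym in a1; rewrite cr_sym in a2.
      move=> w v [-> | ->] [-> | ->].
      * exact: (key r13 w1 w3 o3 t3).
      * exact: (key r14 w1 w4 o4 t4).
      * exact: (key r23 w2 w3 o3 t3).
      * exact: (key r24 w2 w4 o4 t4).
  by move: par; rewrite in0 jf ie; case: (innerb _ _ _ _ _ _).
- apply: leq_trans hl _; rewrite leq_mul2l; apply/orP; right; apply: subset_leq_card.
  by apply/subsetP => e; rewrite in_set => eP; rewrite in_set; have [/= -> _ ->] := ab _ eP.
- apply: leq_trans hr _; rewrite leq_mul2l; apply/orP; right; apply: subset_leq_card.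
  by apply/subsetP => f; rewrite in_set => fP; rewrite in_set; have [/= _ -> ->] := ab _ fP.
Qed.

End Counting.

Lemma loss_ge q : 0 < q -> 64 * q * (128 * q) <= loss q.
Proof.
move=> q0; have a0 : 0 < 64 * q by lia. have b0 : 0 < 128 * q by lia.
rewrite /loss; set c := 3 * (64 * q) * (128 * q).
have c0 : 0 < c by rewrite /c !muln_gt0 q0.
apply: (@leq_trans c).
  by rewrite /c -[X in _ <= X]mulnA leq_pmull.
apply: (@leq_trans (c ^ 4)); first by rewrite -[X in X <= _]expn1 leq_pexp2l.
rewrite mulnAC leq_pmull // muln_gt0 !expn_gt0 /= muln_gt0 expn_gt0 b0 !muln_gt0 q0 //.
Qed.

Lemma half_split (H : {set I}) : exists2 A : {set I}, A \subset H & #|A| = #|H|./2.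
Proof.
exists [set x in take #|H|./2 (enum H)].
  by apply/subsetP => x; rewrite inE => /mem_take; rewrite mem_enum.
rewrite cardsE; have /card_uniqP -> : uniq (take #|H|./2 (enum H)).
  by rewrite take_uniq // enum_uniq.
by rewrite size_take -cardE; case: ltnP => //; lia.
Qed.

(** If d' <= 1, then m is at most [loss q] and one crossing pair is enough. If more than d' edges
    cross some w at a single point, they cross pairwise, and the two halves of this clique serve.
    Otherwise [biclique_light] applies. *)
Theorem biclique q : 0 < q -> 0 < m -> m ^ 2 <= q * #|crossings| ->
  exists A B : {set I}, [/\ A \subset X, B \subset X,
    forall e f, e \in A -> f \in B -> cr e f, m <= 3 * loss q * #|A| & m <= 3 * loss q * #|B|].
Proof.
move=> q0 m0 dense.
pose d := m %/ (32 * q); pose d' := d %/ (64 * q).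
have a0 : 0 < 32 * q by lia. have b0 : 0 < 64 * q by lia.
have ds : 32 * q * d <= m by rewrite mulnC leq_divM.
have d's : 64 * q * d' <= d by rewrite mulnC leq_divM.
have dl : m < 32 * q * d.+1 by rewrite mulnC ltn_ceil.
have d'l : d < 64 * q * d'.+1 by rewrite mulnC ltn_ceil.
have lossq := loss_ge q0.
have [d'1 | d'2] := leqP d' 1.
  have : 0 < #|crossings|.
    rewrite lt0n; apply/negP => /eqP E; move: dense; rewrite E muln0 leqn0 expn_eq0 /= andbT.
    by move/eqP => E'; rewrite E' in m0.
  case/card_gt0P => -[e f]; rewrite !inE /= => /andP [/andP [eX fX] cef].
  have small : m <= 3 * loss q * 1.
    rewrite muln1; apply: leq_trans (leq_pmull _ (isT : 0 < 3)); apply: leq_trans lossq.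
    have h1 : d.+1 <= 64 * q * 2 by apply: leq_trans d'l _; rewrite leq_mul2l ltnS d'1 orbT.
    apply: leq_trans (ltnW dl) _; apply: leq_trans (leq_mul (leqnn (32 * q)) h1) _.
    by rewrite -!mulnA; lia.
  exists [set e], [set f]; rewrite !sub1set !cards1; split=> //.
  by move=> e' f' /set1P -> /set1P ->.
have d0 : 0 < d by case: (posnP d) d'2 => // E; rewrite /d' E div0n.
have ml : m <= 64 * q * d.
  apply: leq_trans (ltnW dl) _; have -> : 64 * q * d = 32 * q * (2 * d) by lia.
  by rewrite leq_mul2l; apply/orP; right; lia.
have dl2 : d <= 128 * q * d'.
  apply: leq_trans (ltnW d'l) _; have -> : 128 * q * d' = 64 * q * (2 * d') by lia.
  by rewrite leq_mul2l; apply/orP; right; lia.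
have [light | heavy] := boolP [forall w in X, forall e in X, cr w e ==>
   (#|[set f in X | cr w f && (pos w f == pos w e)]| <= d')].
  apply: (@biclique_light q d d') => //; last exact: ltnW.
  by move=> w e wX eX we; move/forall_inP: light => /(_ w wX) /forall_inP /(_ e eX); rewrite we.
move: heavy; rewrite negb_forall_in => /exists_inP [w wX]; rewrite negb_forall_in.
case/exists_inP => e eX; rewrite negb_imply -ltnNge => /andP [we].
set H := [set f in X | _] => hH.
have HX : H \subset X by apply/subsetP => f; rewrite inE => /andP [].
have clique f g : f \in H -> g \in H -> f != g -> cr f g.
  rewrite !inE => /and3P [_ wf /eqP pf] /and3P [_ wg /eqP pg] fg.
  by have [] := concurrent wf wg fg (etrans pf (esym pg)).
have [A AH cA] := half_split H.
have cB : #|H :\: A| = #|H| - #|A| by rewrite cardsD (setIidPr AH).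
have big k : d' <= 3 * k -> m <= 3 * loss q * k.
  move=> hk; apply: leq_trans ml _; apply: (@leq_trans (64 * q * (128 * q) * (3 * k))).
    rewrite -[X in _ <= X]mulnA leq_mul2l; apply/orP; right; apply: leq_trans dl2 _.
    by rewrite leq_mul2l hk orbT.
  by rewrite mulnCA mulnA leq_mul2r; apply/orP; right; rewrite leq_mul2l lossq orbT.
exists A, (H :\: A); split.
- exact: subset_trans AH HX.
- by apply: subset_trans HX; exact: subsetDl.
- move=> f g fA; rewrite inE => /andP [gA gH]; apply: clique => //; first exact: (subsetP AH).
  by apply: contraNneq gA => <-.
- by apply: big; rewrite cA; lia.
- by apply: big; rewrite cB cA; lia.
Qed.

End Biclique.

(** * Recursion on the clique number *)

(** In [loss] the argument q = L^36 has total degree 1 + 4 + 8 = 13, and the numerical factors are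
    at most 2^98; 13 * 36 + 98 = 566. *)
Lemma loss_bound L : 2 <= L -> 3 * loss (L ^ 36) <= L ^ 566.
Proof.
move=> L2; have L0 : 0 < L by exact: ltnW.
have two n c : c <= 2 ^ n -> c <= L ^ n.
  by move=> h; apply: leq_trans h _; case: n => // n; rewrite leq_exp2r.
have c3 : 3 <= L ^ 2 by exact: two.
have c2 : 2 <= L ^ 1 by exact: two.
have c128 : 128 <= L ^ 7 by exact: two.
have c64 : 64 <= L ^ 6 by exact: two.
have c81 : 3 ^ 4 <= L ^ 7 by exact: two.
have lin n c : c <= L ^ n -> c * L ^ 36 <= L ^ (n + 36).
  by move=> h; rewrite expnD leq_mul2r h orbT.
rewrite /loss -[566]/(2 + ((1 + 36) + (7 + 36) * 4 + ((2 + (6 + 36)) + (7 + 36)) * 4 + 7)).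
rewrite expnD; apply: (leq_mul c3).
rewrite expnD; apply: (fun h => leq_mul h c81).
rewrite expnD; apply: leq_mul.
  rewrite expnD; apply: leq_mul; first exact: lin.
  by rewrite expnM leq_exp2r //; exact: lin.
rewrite expnM leq_exp2r // expnD; apply: leq_mul; last exact: lin.
by rewrite expnD; apply: (leq_mul c3); exact: lin.
Qed.

(** Each edge is bichromatic in at least half of all colourings: flipping the colour of its source
    maps the remaining ones injectively to such. *)
Lemma half_bichromatic (V I : finType) (src dst : I -> V) : (forall e, src e != dst e) ->
  exists c : V -> bool, #|I| <= 2 * #|[set e | c (src e) != c (dst e)]|.
Proof.
move=> nl.
have D0 : 0 < #|[set: {ffun V -> bool}]|.
  by apply/card_gt0P; exists [ffun=> true]; rewrite inE.
have [|c _] := @popular_choice I {ffun V -> bool} [set: I] [set: {ffun V -> bool}]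
  (fun e c => c (src e) != c (dst e)) 2 D0; last first.
  rewrite cardsT => h; exists c; apply: leq_trans h _; rewrite leq_mul2l subset_leq_card //.
  by apply/subsetP => e; rewrite !inE.
move=> e _; pose Bi := [set c : {ffun V -> bool} in [set: {ffun V -> bool}] | c (src e) != c (dst e)].
pose flip (c : {ffun V -> bool}) := [ffun v => if v == src e then ~~ c v else c v].
have flipK : involutive flip.
  by move=> c; apply/ffunP => v; rewrite !ffunE; case: eqP => //; rewrite negbK.
have : #|~: Bi| <= #|Bi|.
  rewrite -(card_imset _ (inv_inj flipK)); apply: subset_leq_card; apply/subsetP => c.
  case/imsetP => c'; rewrite !inE negbK => /eqP E ->.
  by rewrite !ffunE eqxx [dst e == _]eq_sym (negPf (nl e)) E; case: (c' _).
move=> h; apply: (@leq_trans (2 * #|Bi|)); last by [].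
by rewrite cardsT -(cardsC Bi); lia.
Qed.

Section Drawing.

Variables (V I : finType) (src dst : I -> V) (lt : rel V) (w : I -> V -> bool) (cr : rel I).
Variable pos : I -> I -> nat.
Hypothesis loopless : forall e, src e != dst e.
Hypothesis simple : forall e f, src e = src f -> dst e = dst f -> e = f.
Hypothesis lt_anti : forall u v, u != v -> lt v u = ~~ lt u v.
Hypothesis cr_formula : forall e f, vdisj src dst e f ->
  cr e f = (w e (src f) (+) w e (dst f)) (+) ((w f (src e) (+) w f (dst e))
     (+) ((lt (src f) (src e) (+) lt (src f) (dst e)) (+) (lt (dst f) (src e) (+) lt (dst f) (dst e)))).
Hypothesis cr_sym : symmetric cr.
Hypothesis cr_irr : irreflexive cr.
Hypothesis concurrent : forall w e f, cr w e -> cr w f -> e != f -> pos w e = pos w f ->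
  cr e f /\ pos e f = pos e w.
Hypothesis four : forall e e' f f' w1 w2 w3 w4 : I,
  (forall g, g = e \/ g = e' -> [/\ cr g w1, cr g w2 & pos g w1 < pos g w2]) ->
  (forall g, g = f \/ g = f' -> [/\ cr g w3, cr g w4 & pos g w3 < pos g w4]) ->
  (forall g g', g = e \/ g = e' -> g' = f \/ g' = f' -> g != g') ->
  (forall g w, g = f \/ g = f' -> w = w1 \/ w = w2 ->
     g != w /\ (cr w g -> ~~ hulln (pos w e) (pos w e') (pos w g))) ->
  (forall g w, g = e \/ g = e' -> w = w3 \/ w = w4 ->
     g != w /\ (cr w g -> ~~ hulln (pos w f) (pos w f') (pos w g))) ->
  (forall w v, w = w1 \/ w = w2 -> v = w3 \/ v = w4 ->
     cr w v -> hulln (pos w e) (pos w e') (pos w v) -> ~~ hulln (pos v f) (pos v f') (pos v w)) ->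
  innerb cr pos w1 w2 w3 w4 e f (+) innerb cr pos w1 w2 w3 w4 e f' (+)
  innerb cr pos w1 w2 w3 w4 e' f (+) innerb cr pos w1 w2 w3 w4 e' f' = false.

Definition clique (F : {set I}) : bool := [forall e in F, forall f in F, (e != f) ==> cr e f].

Definition kfree (k : nat) (J : {set I}) : Prop :=
  forall F : {set I}, F \subset J -> clique F -> #|F| < k.

Lemma cliqueP (F : {set I}) :
  reflect (forall e f, e \in F -> f \in F -> e != f -> cr e f) (clique F).
Proof.
apply: (iffP idP) => [/forall_inP h e f eF fF ef | h].
  by have /forall_inP /(_ f fF) := h e eF; rewrite ef.
apply/forall_inP => e eF; apply/forall_inP => f fF; apply/implyP; exact: h.
Qed.

(* Cliques of the two sides of a biclique unite, so one side has clique number less than k/2. *)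
Lemma kfree_biclique k (A B J : {set I}) : A \subset J -> B \subset J ->
  (forall e f, e \in A -> f \in B -> cr e f) -> kfree k J ->
  kfree (uphalf k) A \/ kfree (uphalf k) B.
Proof.
move=> AJ BJ AB kJ.
have [/existsP [F /and3P [FA cF hF]] | no] :=
  boolP [exists F : {set I}, [&& F \subset A, clique F & uphalf k <= #|F|]]; last first.
  left=> F FA cF; rewrite ltnNge; apply: contra no => h; apply/existsP; exists F.
  by rewrite FA cF.
right=> F' F'B cF'; rewrite ltnNge; apply/negP => hF'.
have dis : [disjoint F & F'].
  rewrite -setI_eq0; apply/eqP/setP => e; rewrite !inE; apply/negbTE/negP => /andP [eF eF'].
  by have := AB _ _ (subsetP FA _ eF) (subsetP F'B _ eF'); rewrite cr_irr.
have : #|F :|: F'| < k.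
  apply: kJ; first by rewrite subUset (subset_trans FA AJ) (subset_trans F'B BJ).
  apply/cliqueP => e f; rewrite !inE => /orP [] eF /orP [] fF ef.
  - exact: (cliqueP _ cF).
  - by apply: AB; [exact: (subsetP FA) | exact: (subsetP F'B)].
  - by rewrite cr_sym; apply: AB; [exact: (subsetP FA) | exact: (subsetP F'B)].
  - exact: (cliqueP _ cF').
rewrite cardsU (disjoint_setI0 dis) cards0 subn0.
have := uphalf_half k; have := odd_double_half k; lia.
Qed.

(** Induction on k. For k = 1 the set J is empty. Otherwise a violating set contains one side of a
    biclique with clique number below the rounded-up half of k: this costs the factor L^566 of
    [loss_bound] and lowers [up_log 2 k] by exactly 1. *)
Lemma kfree_bound k J U : 0 < k -> kfree k J ->
  #|induced src dst J U| <= #|U| * lg #|U| ^ (566 * (up_log 2 k).+1).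
Proof.
have [n] := ubnP k; elim: n k J U => // n IH k J U /ltnSE kn k0 kJ.
have [k1 | k2] := leqP k 1.
  have /eqP k1' : k == 1 by rewrite eqn_leq k1.
  suff -> : induced src dst J U = set0 by rewrite cards0.
  apply/eqP; rewrite -subset0; apply/subsetP => e; rewrite inE => /andP [eJ _].
  have := kJ [set e]; rewrite sub1set eJ cards1 k1' => /(_ isT) h.
  have : clique [set e].
    by apply/cliqueP => a b /set1P -> /set1P ->; rewrite eqxx.
  by move=> /h.
set B := 566 * (up_log 2 k).+1.
have B38 : 38 <= B by rewrite /B mulnS; exact: (leq_trans (isT : 38 <= 566) (leq_addr _ _)).
have good e f : e \in J -> f \in J -> vdisj src dst e f -> ~~ cr e f ->
   cr e f = (false (+) false) && (false (+) false) by move=> _ _ _ /negPf.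
apply: (induced_bound (x := cr) (c := fun=> false) (conf := cr) simple lt_anti cr_formula B38 good).
move=> {}U large dense; set L := lg #|U| in large dense; set X := induced src dst J U in large dense.
have L2 : 2 <= L := lg_ge2 _.
have q0 : 0 < L ^ 36 by rewrite expn_gt0 (ltnW L2).
have X0 : 0 < #|X| by exact: leq_ltn_trans large.
have [A [A' [AX A'X AA' hA hA']]] :=
  biclique cr_sym concurrent four q0 X0 dense.
have XJ : X \subset J by apply/subsetP => e; rewrite inE => /andP [].
have key (C : {set I}) : C \subset X -> #|X| <= 3 * loss (L ^ 36) * #|C| -> kfree (uphalf k) C -> False.
  move=> CX hC kC.
  have k'k : uphalf k < k by rewrite -[k]prednK // uphalf_half; have := odd_double_half k.-1; lia.
  have k'0 : 0 < uphalf k by rewrite uphalf_half; have := odd_double_half k; lia.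
  have := IH _ C U (leq_trans k'k kn) k'0 kC.
  have -> : induced src dst C U = C.
    apply/setP => e; rewrite inE; case: (boolP (e \in C)) => //= eC.
    by have := subsetP CX _ eC; rewrite inE => /andP [_ ->].
  have -> : (up_log 2 (uphalf k)).+1 = up_log 2 k.
    rewrite -[k in RHS]prednK // up_log2S; last by lia.
    congr (up_log 2 _).+1; rewrite uphalf_half; have := odd_double_half k.
    have := odd_double_half k.-1; have : odd k = ~~ odd k.-1 by rewrite -[k in LHS]prednK //=.
    by move=> ->; case: (odd k.-1) => /=; lia.
  rewrite -/L => bC; move: large; rewrite ltnNge => /negP; apply.
  apply: leq_trans hC _; apply: leq_trans (leq_mul (loss_bound L2) bC) _.
  by rewrite mulnCA -expnD /B mulnS.
have [kA | kA'] := kfree_biclique (subset_trans AX XJ) (subset_trans A'X XJ) AA' kJ.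
  exact: key AX hA kA.
exact: key A'X hA' kA'.
Qed.

Definition apart (e : I) : {set I} := [set f | vdisj src dst e f && ~~ cr e f].

(** By [kfree_bound] each edge of X is apart from at most |U| L^B others, so the conflicts number at
    most |X| |U| L^B, against at least |X|^2 / L^36 in a minimal violating set. The last unit of 37
    pays for the factor 2 of [half_bichromatic]. *)
Theorem k1_bound k : 0 < k -> (forall g, kfree k (apart g)) ->
  #|I| <= #|V| * lg #|V| ^ (566 * (up_log 2 k).+1 + 37).
Proof.
move=> k0 kfr; have [c hc] := half_bichromatic loopless.
set J := [set e | c (src e) != c (dst e)] in hc.
set B := 566 * (up_log 2 k).+1.
have B38 : 38 <= B + 36.
  apply: leq_trans (leq_addr _ _); rewrite /B mulnS.
  exact: (leq_trans (isT : 38 <= 566) (leq_addr _ _)).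
suff bound : #|induced src dst J setT| <= #|[set: V]| * lg #|[set: V]| ^ (B + 36).
  have JE : induced src dst J setT = J by apply/setP => e; rewrite !inE !andbT.
  rewrite JE cardsT in bound; apply: leq_trans hc _.
  have -> : B + 37 = (B + 36).+1 by rewrite addnS.
  rewrite expnS mulnCA; apply: leq_mul => //; exact: lg_ge2.
have good e f : e \in J -> f \in J -> vdisj src dst e f -> ~~ (vdisj src dst e f && ~~ cr e f) ->
   cr e f = (c (src e) (+) c (dst e)) && (c (src f) (+) c (dst f)).
  rewrite !inE => he hf ->; rewrite negbK => ->.
  (* Both edges are bichromatic, so the product is 1, in agreement with their crossing. *)
  by move: he hf; do 4!case: (c _).
apply: (induced_bound (x := cr) (c := c) (conf := fun e f => vdisj src dst e f && ~~ cr e f)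
   simple lt_anti cr_formula B38 good).
move=> U large dense; set L := lg #|U| in large dense; set X := induced src dst J U in large dense.
have cle : #|conflicts src dst J (fun e f => vdisj src dst e f && ~~ cr e f) U| <=
    #|X| * (#|U| * L ^ B).
  rewrite /conflicts (card_setX_dep X X (fun e f => vdisj src dst e f && ~~ cr e f)).
  rewrite -sum_nat_const; apply: leq_sum => e _.
  apply: leq_trans (kfree_bound U k0 (kfr e)); apply: subset_leq_card; apply/subsetP => f.
  by rewrite !inE => /andP [/and3P [_ -> ->] ->].
have X0 : 0 < #|X| by exact: leq_ltn_trans large.
move: large; rewrite ltnNge => /negP; apply.
rewrite -(leq_pmul2l X0) mulnn; apply: leq_trans dense _.
apply: leq_trans (leq_mul (leqnn _) cle) _.
by rewrite mulnCA leq_mul2l mulnCA -expnD addnC leqnn orbT.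
Qed.

End Drawing.

(** * The drawing as a combinatorial structure *)

Definition pbool (P : Prop) : bool := if excluded_middle_informative P then true else false.

Lemma pboolP (P : Prop) : reflect P (pbool P).
Proof. by rewrite /pbool; case: excluded_middle_informative => h; constructor. Qed.

Lemma expn_pow m n : m ^ n = Nat.pow m n.
Proof. by elim: n => //= n <-; rewrite expnS. Qed.

Local Notation "x +z y" := (Z.add x y) (at level 50, left associativity).

Section Instance.

Variables (n : nat) (vtx : nat -> point) (E : list (nat * nat)) (cur : nat * nat -> R -> point).
Hypothesis G : simple_topological_graph n.+1 vtx E cur.

Local Notation edge_index := 'I_(length E).

Definition edge (i : edge_index) : nat * nat := List.nth i E (0, 0).

Lemma edge_in i : List.In (edge i) E.
Proof. by apply: List.nth_In; apply/ltP. Qed.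

Lemma edge_inj_index : injective edge.
Proof.
move=> i j ij; apply: val_inj => /=.
have [_ [nd _]] := G.
by apply: (proj1 (List.NoDup_nth E (0, 0)) nd) => //; apply/ltP.
Qed.

Lemma edge_lt i : (fst (edge i) < snd (edge i)) && (snd (edge i) < n.+1).
Proof.
have [_ [_ [h _]]] := G; have [/ltP h1 [/ltP h2 _]] := h _ (edge_in i).
by rewrite h1.
Qed.

Definition esrc (i : edge_index) : 'I_n.+1 := inord (fst (edge i)).
Definition edst (i : edge_index) : 'I_n.+1 := inord (snd (edge i)).

Lemma esrcE i : esrc i = fst (edge i) :> nat.
Proof. by rewrite /esrc inordK //; have /andP [] := edge_lt i; exact: ltn_trans. Qed.

Lemma edstE i : edst i = snd (edge i) :> nat.
Proof. by rewrite /edst inordK //; have /andP [] := edge_lt i. Qed.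

Definition ecr (i j : edge_index) : bool := pbool (crossing E cur (edge i) (edge j)).
Definition etime (i j : edge_index) : R := crossing_time cur (edge i) (edge j).
(** Only the order of the crossings along an edge matters, so times are replaced by ranks;
    simultaneous crossings get equal ranks. *)
Definition epos (i j : edge_index) : nat :=
  #|[set k | ecr i k && pbool (Rlt (etime i k) (etime i j))]|.

Lemma epos_mono i j k : Rle (etime i j) (etime i k) -> epos i j <= epos i k.
Proof.
move=> h; apply: subset_leq_card; apply/subsetP => l; rewrite !inE => /andP [-> /pboolP hl] /=.
by apply/pboolP; lra.
Qed.

(** As j crosses i, it is counted in the rank of k but not in its own, which makes the inequality
    strict. *)
Lemma epos_lt i j k : ecr i j -> (epos i j < epos i k) <-> Rlt (etime i j) (etime i k).
Proof.
move=> cij; split=> h.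
  by apply: Rnot_le_lt => /epos_mono; rewrite leqNgt h.
apply: proper_card; apply/properP; split.
  apply/subsetP => l; rewrite !inE => /andP [-> /pboolP hl] /=; apply/pboolP; lra.
exists j; first by rewrite inE cij; apply/pboolP.
by rewrite inE cij /=; apply/pboolP; lra.
Qed.

Lemma epos_eq i j k : ecr i j -> ecr i k -> epos i j = epos i k -> etime i j = etime i k.
Proof.
move=> cj ck h; apply: Rle_antisym; apply: Rnot_lt_le => /epos_lt.
  by rewrite h ltnn => /(_ ck).
by rewrite h ltnn => /(_ cj).
Qed.

Lemma ecr_sym : symmetric ecr.
Proof. by move=> i j; apply/pboolP/pboolP; apply: crossing_sym. Qed.

Lemma ecr_irr : irreflexive ecr.
Proof. by move=> i; apply/negbTE/negP => /pboolP [_ [_ [h _]]]; exact: h. Qed.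

Lemma evdisj i j : reflect (vertex_disjoint (edge i) (edge j)) (vdisj esrc edst i j).
Proof.
rewrite /vdisj -!val_eqE /= !esrcE !edstE.
apply: (iffP and4P) => [[/eqP h1 /eqP h2 /eqP h3 /eqP h4] | [h1 [h2 [h3 h4]]]].
  by split; [|split; [|split]].
by split; apply/eqP.
Qed.

Lemma econcurrent w e f : ecr w e -> ecr w f -> e != f -> epos w e = epos w f ->
  ecr e f /\ epos e f = epos e w.
Proof.
move=> we wf ef pe; have te := epos_eq we wf pe.
have nef : edge e <> edge f by move/edge_inj_index/eqP; rewrite (negPf ef).
have [c1 c2] := crossing_concurrent n.+1 vtx E cur G _ _ _ (elimT (pboolP _) we)
  (elimT (pboolP _) wf) nef te.
split; first exact/pboolP.
by rewrite /epos; apply: eq_card => k; rewrite !inE /etime c2.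
Qed.

Lemma hulln_hull w a b x : hull (etime w a) (etime w b) (etime w x) ->
  hulln (epos w a) (epos w b) (epos w x).
Proof.
by case=> -[h1 h2]; apply/orP; [left | right]; apply/andP; split; exact: epos_mono.
Qed.

Lemma innerP w1 w2 w3 w4 e f : ecr e w1 -> ecr f w3 ->
  reflect (inner E cur (edge w1) (edge w2) (edge w3) (edge w4) (edge e) (edge f))
    (innerb ecr epos w1 w2 w3 w4 e f).
Proof.
move=> c1 c3; apply: (iffP and3P).
  move=> [/[dup] cef /pboolP h /andP [h1 h2] /andP [h3 h4]]; split=> //.
  have cfe : ecr f e by rewrite ecr_sym.
  by split; split; apply/epos_lt.
move=> [h [[h1 h2] [h3 h4]]]; have cef : ecr e f by exact/pboolP.
have cfe : ecr f e by rewrite ecr_sym.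
by split=> //; apply/andP; split; apply/epos_lt.
Qed.

Lemma edge_cases (a b : edge_index) (P : nat * nat -> Prop) :
  (forall g, g = a \/ g = b -> P (edge g)) -> forall g, g = edge a \/ g = edge b -> P g.
Proof. by move=> h g [-> | ->]; apply: h; auto. Qed.

Lemma efour e e' f f' w1 w2 w3 w4 :
  (forall g, g = e \/ g = e' -> [/\ ecr g w1, ecr g w2 & epos g w1 < epos g w2]) ->
  (forall g, g = f \/ g = f' -> [/\ ecr g w3, ecr g w4 & epos g w3 < epos g w4]) ->
  (forall g g', g = e \/ g = e' -> g' = f \/ g' = f' -> g != g') ->
  (forall g w, g = f \/ g = f' -> w = w1 \/ w = w2 ->
     g != w /\ (ecr w g -> ~~ hulln (epos w e) (epos w e') (epos w g))) ->
  (forall g w, g = e \/ g = e' -> w = w3 \/ w = w4 ->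
     g != w /\ (ecr w g -> ~~ hulln (epos w f) (epos w f') (epos w g))) ->
  (forall w v, w = w1 \/ w = w2 -> v = w3 \/ v = w4 ->
     ecr w v -> hulln (epos w e) (epos w e') (epos w v) ->
     ~~ hulln (epos v f) (epos v f') (epos v w)) ->
  innerb ecr epos w1 w2 w3 w4 e f (+) innerb ecr epos w1 w2 w3 w4 e f' (+)
  innerb ecr epos w1 w2 w3 w4 e' f (+) innerb ecr epos w1 w2 w3 w4 e' f' = false.
Proof.
move=> He Hf Hef Hfw Hew Hww.
have neq (a b : edge_index) : a != b -> edge a <> edge b.
  by move=> ab /edge_inj_index /eqP; rewrite (negPf ab).
have [z1 [z2 [z3 [z4 [S [O1 [O2 [O3 O4]]]]]]]] :
  exists z1 z2 z3 z4 : Z, z1 +z z2 +z z3 +z z4 = Z0 /\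
    (Z.Odd z1 <-> inner E cur (edge w1) (edge w2) (edge w3) (edge w4) (edge e) (edge f)) /\
    (Z.Odd z2 <-> inner E cur (edge w1) (edge w2) (edge w3) (edge w4) (edge e) (edge f')) /\
    (Z.Odd z3 <-> inner E cur (edge w1) (edge w2) (edge w3) (edge w4) (edge e') (edge f)) /\
    (Z.Odd z4 <-> inner E cur (edge w1) (edge w2) (edge w3) (edge w4) (edge e') (edge f')).
  apply: (four_curves_parity n.+1 vtx E cur G).
  - apply: edge_cases => g /He [c1 c2 p]; split; [exact/pboolP | split; [exact/pboolP|]].
    exact: (proj1 (epos_lt _ c1) p).
  - apply: edge_cases => g /Hf [c1 c2 p]; split; [exact/pboolP | split; [exact/pboolP|]].
    exact: (proj1 (epos_lt _ c1) p).
  - move=> g g' hg hg'; move: g' hg'; apply: edge_cases => g' hg'; move: g hg.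
    apply: edge_cases => g hg.
    by apply: neq; exact: Hef.
  - move=> g w hg hw; move: w hw; apply: edge_cases => w hw; move: g hg; apply: edge_cases => g hg.
    have [h1 h2] := Hfw g w hg hw; split; first exact: neq.
    by move=> /pboolP /h2 h3 /hulln_hull h4; rewrite h4 in h3.
  - move=> g w hg hw; move: w hw; apply: edge_cases => w hw; move: g hg; apply: edge_cases => g hg.
    have [h1 h2] := Hew g w hg hw; split; first exact: neq.
    by move=> /pboolP /h2 h3 /hulln_hull h4; rewrite h4 in h3.
  - move=> w v hw hv; move: v hv; apply: edge_cases => v hv; move: w hw; apply: edge_cases => w hw; split.
      (* Here the two sides use the same edge w. Two intervals on w that overlap have an end of one
         inside the other, and the separation assumptions exclude this for each of the four ends. *)
      move=> /edge_inj_index wv; subst v.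
      have sep g : g = f \/ g = f' -> ~ hull (etime w e) (etime w e') (etime w g).
        move=> hg /hulln_hull h; have [_ h2] := Hfw g w hg hw.
        have cg : ecr w g by rewrite ecr_sym; case: (Hf g hg) hv => c3 c4 _ [] ->.
        by have := h2 cg; rewrite h.
      have sep' g : g = e \/ g = e' -> ~ hull (etime w f) (etime w f') (etime w g).
        move=> hg /hulln_hull h; have [_ h2] := Hew g w hg hv.
        have cg : ecr w g by rewrite ecr_sym; case: (He g hg) hw => c3 c4 _ [] ->.
        by have := h2 cg; rewrite h.
      move=> x hx hx'.
      have := sep f (or_introl erefl); have := sep f' (or_intror erefl).
      have := sep' e (or_introl erefl); have := sep' e' (or_intror erefl).
      move: hx hx'; rewrite /etime /hull => hx hx' s1 s2 s3 s4.
      move: (crossing_time cur (edge w) (edge e)) (crossing_time cur (edge w) (edge e'))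
        (crossing_time cur (edge w) (edge f)) (crossing_time cur (edge w) (edge f'))
        hx hx' s1 s2 s3 s4 => a b c d hx hx' s1 s2 s3 s4.
      by case: (Rle_dec a b); case: (Rle_dec c d); case: (Rle_dec a c) => *; lra.
    move=> /pboolP cwv /hulln_hull h /hulln_hull h'.
    by have := Hww w v hw hv cwv h; rewrite h'.
have [c1 _ _] := He e (or_introl erefl); have [c1' _ _] := He e' (or_intror erefl).
have [c3 _ _] := Hf f (or_introl erefl); have [c3' _ _] := Hf f' (or_intror erefl).
have par z (b : bool) (P : Prop) : (Z.Odd z <-> P) -> reflect P b -> Z.odd z = b.
  move=> h r; apply/idP/idP => [/Z.odd_spec /h /r // | /r /h /Z.odd_spec //].
rewrite -(par _ _ _ O1 (innerP _ _ c1 c3)) -(par _ _ _ O2 (innerP _ _ c1 c3')).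
rewrite -(par _ _ _ O3 (innerP _ _ c1' c3)) -(par _ _ _ O4 (innerP _ _ c1' c3')).
have := congr1 Z.odd S; rewrite !Z.odd_add /=.
by case: (Z.odd z1); case: (Z.odd z2); case: (Z.odd z3); case: (Z.odd z4).
Qed.

Lemma eformula : exists w : edge_index -> 'I_n.+1 -> bool, forall e f, vdisj esrc edst e f ->
  ecr e f = (w e (esrc f) (+) w e (edst f)) (+) ((w f (esrc e) (+) w f (edst e))
     (+) (((esrc f < esrc e) (+) (esrc f < edst e)) (+) ((edst f < esrc e) (+) (edst f < edst e)))).
Proof.
have [w hw] := crossing_parity n.+1 vtx E cur G.
exists (fun e v => Z.odd (w (edge e) v)) => e f /evdisj vd.
have := hw _ _ (edge_in e) (edge_in f) vd; rewrite -Z.odd_spec => h.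
have belowE p q : Z.odd (below p q) = (p < q).
  by rewrite /below; case: PeanoNat.Nat.ltb_spec0 => [/ltP -> | /ltP /negPf ->].
have -> : ecr e f = Z.odd (w (edge e) (fst (edge f)) +z w (edge e) (snd (edge f)) +z
   w (edge f) (fst (edge e)) +z w (edge f) (snd (edge e)) +z below (fst (edge f)) (fst (edge e)) +z
   below (fst (edge f)) (snd (edge e)) +z below (snd (edge f)) (fst (edge e)) +z
   below (snd (edge f)) (snd (edge e))).
  by apply/pboolP/idP => /h.
have xE u v : xorb u v = u (+) v by case: u; case: v.
by rewrite !Z.odd_add !belowE !xE !esrcE !edstE !addbA.
Qed.

Theorem edge_count k : (1 <= k)%coq_nat -> ~ has_k1_crossing_family k E cur ->
  exists L u : nat, (Nat.pow 2 L <= n.+1)%coq_nat /\ (Nat.pow 2 u < 2 * k)%coq_nat /\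
    (length E <= n.+1 * Nat.pow (L + 2) (566 * (u + 1) + 37))%coq_nat.
Proof.
move=> /leP k0 no.
exists (trunc_log 2 n.+1), (up_log 2 k); split; last split.
- by rewrite -expn_pow; apply/leP; have := trunc_log_bounds (isT : 1 < 2) (isT : 0 < n.+1) => /andP [].
- rewrite -expn_pow; apply/ltP; have [k1 | k2] := leqP k 1.
    by have -> : k = 1 by lia.
  have := up_log_gtn (isT : 1 < 2) k2; have : 0 < up_log 2 k by rewrite up_log_gt0 k2.
  by case: (up_log 2 k) => // j _ /=; rewrite expnS ltn_mul2l.
have [w hw] := eformula.
have loopless e : esrc e != edst e.
  by rewrite -val_eqE /= esrcE edstE; have /andP [h _] := edge_lt e; rewrite (ltn_eqF h).
have simple e f : esrc e = esrc f -> edst e = edst f -> e = f.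
  move=> h1 h2; apply: edge_inj_index.
  rewrite (surjective_pairing (edge e)) (surjective_pairing (edge f)).
  by rewrite -!esrcE -!edstE h1 h2.
have anti (u v : 'I_n.+1) : u != v -> (v < u) = ~~ (u < v).
  by rewrite -val_eqE /= => uv; case: ltngtP uv.
have kfr g : kfree ecr k (apart esrc edst ecr g).
  move=> F FA cF; rewrite ltnNge; apply/negP => kF; apply: no.
  have inF i : i \in take k (enum F) -> i \in F by move=> /mem_take; rewrite mem_enum.
  have memP (s : seq edge_index) x : List.In x (List.map edge s) -> exists2 i, i \in s & x = edge i.
    elim: s => //= i s IH [<- | /IH [j js ->]]; first by exists i; rewrite ?mem_head.
    by exists j => //; rewrite inE js orbT.
  exists (List.map edge (take k (enum F))), (edge g); split; last split; last split; last split;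
    last split.
  - rewrite List.length_map -[RHS](minn_idPl kF) cardE -size_take_min.
    by elim: (take _ _) => //= ? ? ->.
  - have : uniq (take k (enum F)) by rewrite take_uniq // enum_uniq.
    elim: (take k (enum F)) => [|i s IH] /=; first by constructor.
    move=> /andP [si us]; constructor; last exact: IH.
    by move=> /memP [j js /edge_inj_index ij]; rewrite ij js in si.
  - by move=> e /memP [i _ ->]; exact: edge_in.
  - move=> e f /memP [i /inF iF ->] /memP [j /inF jF ->] nij.
    have ij : i != j by apply/eqP => ij; apply: nij; rewrite ij.
    by have /pboolP [_ [_ [_]]] := cliqueP _ _ cF i j iF jF ij.
  - exact: edge_in.
  - move=> e /memP [i /inF iF ->].
    have := subsetP FA i iF; rewrite inE => /andP [/evdisj vd ncr].
    have := disjoint_or_crossing n.+1 vtx E cur G _ _ (edge_in g) (edge_in i) vd.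
    move=> h s t hs ht est; apply: (h _ t s ht hs (esym est)).
    by move=> c; move: ncr => /negP; apply; apply/pboolP.
have := k1_bound loopless simple anti hw ecr_sym ecr_irr econcurrent efour k0 kfr.
rewrite !card_ord /lg expn_pow => h; apply/leP.
by rewrite addn1.
Qed.

End Instance.

End Combinatorics.

(** * Passage to real logarithms and the final constant *)

Lemma two_vertices_edges (vtx : nat -> point) (E : list (nat * nat)) (cur : nat * nat -> R -> point) :
  simple_topological_graph 2 vtx E cur -> (length E <= 1)%nat.
Proof.
  intros [_ [ND [HE _]]].
  apply (NoDup_incl_length (l' := (0, 1)%nat :: nil) ND).
  intros [i j] He; destruct (HE _ He) as [H1 [H2 _]]; simpl in *.
  replace i with 0%nat by lia; replace j with 1%nat by lia; auto.
Qed.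

Lemma ln2_bounds : 1 / 2 < ln 2 < 1.
Proof.
  split; [assert (H := ln_lt_2); lra |].
  rewrite <- (ln_exp 1); apply ln_increasing; [lra |].
  assert (H := exp_ineq1 1 ltac:(lra)); lra.
Qed.

Lemma ln_pow2_le (L n : nat) : (Nat.pow 2 L <= n)%nat -> INR L * ln 2 <= ln (INR n).
Proof.
  intros H; rewrite <- ln_pow by lra.
  apply Rcomplements.ln_le; [apply pow_lt; lra |].
  replace (2 ^ L) with (INR (Nat.pow 2 L)); [apply le_INR, H |].
  rewrite pow_INR; reflexivity.
Qed.

(** From 2^3 <= 3^2. A base bounded away from 1 is what allows the shift by 2 in [lg] to be absorbed
    by the exponent. *)
Lemma log2_ge_3_2 (n : nat) : (3 <= n)%nat -> 3 / 2 <= log2 (INR n).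
Proof.
  intros Hn; destruct ln2_bounds as [H1 H2].
  assert (H3 : 3 * ln 2 <= 2 * ln 3).
  { assert (E1 := Rpower.ln_pow 2 ltac:(lra) 3); assert (E2 := Rpower.ln_pow 3 ltac:(lra) 2).
    simpl INR in E1, E2.
    assert (ln (2 ^ 3) <= ln (3 ^ 2)) by (apply Rcomplements.ln_le; lra).
    lra. }
  assert (H4 : ln 3 <= ln (INR n)).
  { apply Rcomplements.ln_le; [lra |]; replace 3 with (INR 3) by (simpl; lra).
    apply le_INR, Hn. }
  unfold log2; apply Rmult_le_reg_r with (ln 2); [lra |].
  replace (ln (INR n) / ln 2 * ln 2) with (ln (INR n)) by (field; lra); lra.
Qed.

Theorem theorem7 :
  exists C : R, 0 < C /\
    forall (k n : nat), (1 <= k)%nat -> (2 <= n)%nat ->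
    forall (vtx : nat -> point) (E : list (nat * nat)) (cur : nat * nat -> R -> point),
      simple_topological_graph n vtx E cur ->
      ~ has_k1_crossing_family k E cur ->
      INR (length E) <= INR n * Rpower (log2 (INR n)) (C * (1 + ln (INR k))).
Proof.
  (* 4676 = 4 (566 * 2 + 37): here u + 1 <= 2 (1 + ln k), and x + 2 <= x^4 for x >= 3/2. *)
  exists (IZR 4676); split; [lra |].
  intros k n Hk Hn vtx E cur G Hno.
  destruct ln2_bounds as [B1 B2].
  assert (Lk : 0 <= ln (INR k)).
  { rewrite <- ln_1; apply Rcomplements.ln_le; [lra |].
    replace 1 with (INR 1) by reflexivity; apply le_INR, Hk. }
  (* For n = 2 the logarithm is 1 and the right-hand side is 2 for every exponent, so nothing can be
     absorbed; there is at most one edge. *)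
  destruct (Nat.eq_dec n 2) as [-> | Hn2].
  - assert (H := two_vertices_edges vtx E cur G); apply le_INR in H; simpl in H.
    replace (log2 (INR 2)) with 1
      by (unfold log2; replace (INR 2) with 2 by (simpl; lra); field; lra).
    unfold Rpower; rewrite ln_1, Rmult_0_r, exp_0; simpl; lra.
  - assert (Hx := log2_ge_3_2 n ltac:(lia)).
    destruct n as [| n]; [lia |].
    destruct (Combinatorics.edge_count G Hk Hno) as [L [u [HL [Hu HE]]]].
    set (x := log2 (INR (S n))) in *.
    assert (HLx : INR L <= x).
    { apply ln_pow2_le in HL; unfold x, log2; apply Rmult_le_reg_r with (ln 2); [lra |].
      replace (ln (INR (S n)) / ln 2 * ln 2) with (ln (INR (S n))) by (field; lra); lra. }
    (* From 2^u < 2 k one gets u <= 1 + ln k / ln 2, and ln 2 > 1/2. *)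
    assert (Hu' : INR u <= 1 + 2 * ln (INR k)).
    { assert (Q : INR u * ln 2 <= ln (INR (2 * k))) by (apply ln_pow2_le; lia).
      rewrite mult_INR, ln_mult in Q; [| simpl; lra | apply lt_0_INR; lia].
      simpl (INR 2) in Q; replace (1 + 1) with 2 in Q by ring; nra. }
    set (N := (566 * (u + 1) + 37)%nat) in *.
    assert (HN : INR (4 * N) <= 4676 * (1 + ln (INR k))).
    { unfold N; rewrite mult_INR, plus_INR, mult_INR, plus_INR.
      replace (INR 566) with 566 by (rewrite INR_IZR_INZ; reflexivity).
      replace (INR 37) with 37 by (rewrite INR_IZR_INZ; reflexivity).
      simpl (INR 4); simpl (INR 1); lra. }
    apply le_INR in HE; rewrite mult_INR, pow_INR, plus_INR in HE.
    apply Rle_trans with (1 := HE).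
    apply Rmult_le_compat_l; [apply pos_INR |].
    apply Rle_trans with (x ^ (4 * N)).
    + rewrite pow_mult; apply pow_incr; split.
      * apply Rplus_le_le_0_compat; apply pos_INR.
      * simpl (INR 2); simpl pow.
        assert (9 / 4 <= x * x) by nra; nra.
    + rewrite <- Rpower_pow by lra; apply Rle_Rpower; [lra | exact HN].
Qed.
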